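(* Let $f:\overline{\Omega}\times\mathbb{R}^{m\times n}\to\mathbb{R}_{\ge 0}$ be Borel measurable, convex in the second variable, and assume there are constants $c_0,C_0>0$ with $c_0|Ay|\le f(x,y)\le C_0(1+|Ay|)$ for all $(x,y)$. Then for all $u,r\in L^2(\Omega,\mathbb{R}^m)$ the following are equivalent: (a) $r\in\partial F_{dual}(u)$ (subdifferential in $L^2(\Omega,\mathbb{R}^m)$). (b) There is $z\in\mathcal{Z}$ such that for all $w\in\mathrm{BV}^{\mathbb{A}}(\Omega)\cap L^2(\Omega,\mathbb{R}^m)$ $$\int_\Omega\langle w-u,r\rangle\,dx\le\int_\Omega -f^*(x,z)\,dx+\int_\Omega (z,\mathbb{A}w)-F_{dual}(u).$$ (c) There is $z\in\mathcal{Z}$ such that for all $w\in\mathrm{BV}^{\mathbb{A}}(\Omega)\cap L^2(\Omega,\mathbb{R}^m)$ $$\int_\Omega\langle w-u,r\rangle\,dx=\int_\Omega -f^*(x,z)\,dx+\int_\Omega (z,\mathbb{A}w)-F_{dual}(u).$$ (d) $u\in \mathrm{BV}^{\mathbb{A}}(\Omega)$ and there is $z\in\mathcal{Z}$ such that $r=-\operatorname{div}z$, $\langle z,\nu\rangle=0$ on $\partial\Omega$, and $$F_{dual}(u)=\int_\Omega -f^*(x,z)\,dx+\int_\Omega (z,\mathbb{A}u).$$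
   Context: Setting: $\Omega\subset\mathbb{R}^n$ is a bounded open set with Lipschitz boundary and outer unit normal $\nu$. $A:\mathbb{R}^{m\times n}\to\mathbb{R}^{m\times n}$ is a fixed linear map, symmetric with respect to the Frobenius product $y:y'=\sum_{i,j}y_{ij}y'_{ij}$, with $A^2=A$. For $u:\Omega\to\mathbb{R}^m$ set $\mathbb{A}u:=A\,\mathrm{D}u$ (distributional). $\mathrm{BV}^{\mathbb{A}}(\Omega)$ is the space of $u\in L^1(\Omega,\mathbb{R}^m)$ for which $\mathbb{A}u$ is a bounded $\mathbb{R}^{m\times n}$-valued Radon measure on $\Omega$. The divergence of matrix fields is taken row-wise, $(\operatorname{div}z)_i=\sum_j\partial_jz_{ij}$, in the distributional sense. $X_2(\Omega):=\{z\in L^\infty(\Omega,\mathbb{R}^{m\times n}): Az=z,\ \operatorname{div}z\in L^2(\Omega,\mathbb{R}^m)\}$. For $u\in\mathrm{BV}^{\mathbb{A}}(\Omega)\cap L^2(\Omega,\mathbb{R}^m)$ and $z\in X_2(\Omega)$ the pairing $(z,\mathbb{A}u)$ is the distribution $\langle (z,\mathbb{A}u),\phi\rangle:=-\int_\Omega\sum_{i,j}(\phi\,\partial_jz_{ij}u_i+\partial_j\phi\, z_{ij}u_i)\,dx$, $\phi\in C_c^\infty(\Omega)$, which is a bounded Radon measure on $\Omega$. For $z\in X_2(\Omega)$, the normal trace $\langle z,\nu\rangle\in L^\infty(\partial\Omega,\mathbb{R}^m)$ is the unique function with $\int_\Omega\langle\operatorname{div}z,\phi\rangle+z:\mathrm{D}\phi\,dx=\int_{\partial\Omega}\langle\phi,\langle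 z,\nu\rangle\rangle\,d\mathcal{H}^{n-1}$ for all $\phi\in (W^{1,1}\cap L^{2})(\Omega,\mathbb{R}^m)$; for $z\in C^1(\overline\Omega)$ it is $(\sum_j z_{ij}\nu_j)_i$. $f^*(x,\cdot)$ is the Legendre transform of $f(x,\cdot)$: $f^*(x,z)=\sup_{y}(z:y-f(x,y))$. $\mathcal{Z}:=\{z\in X_2(\Omega): f^*(x,z(x))\in L^1(\Omega)\}$. For $u\in L^2(\Omega,\mathbb{R}^m)$, $F_{dual}(u):=\sup_{z\in\mathcal{Z}}\big(\int_\Omega -f^*(x,z(x))\,dx+\int_\Omega (z,\mathbb{A}u)\big)$ if $u\in\mathrm{BV}^{\mathbb{A}}(\Omega)$ and $F_{dual}(u):=+\infty$ otherwise. For $\mathcal{G}:H\to\mathbb{R}\cup\{+\infty\}$ on a Hilbert space $H$: $v\in\partial\mathcal{G}(u)$ iff $\langle v,w-u\rangle\le\mathcal{G}(w)-\mathcal{G}(u)$ for all $w\in H$ (for $\mathcal G\not\equiv+\infty$ this forces $\mathcal{G}(u)<\infty$). *)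

(* Defs.v *)
From HB Require Import structures.
From mathcomp Require Export all_boot all_order all_algebra.
From mathcomp Require Export all_classical all_reals all_analysis measurable_realfun.
Export Order.TTheory GRing.Theory Num.Theory.
Export numFieldNormedType.Exports.

Set Implicit Arguments.
Unset Strict Implicit.
Unset Printing Implicit Defensive.

Local Open Scope classical_set_scope.
Local Open Scope ring_scope.

(* Points of R^n are row vectors 'rV[R]_n, values in R^m are row vectors
   'rV[R]_m, and R^(m x n) is 'M[R]_(m, n).  The library norm on matrices is
   the sup norm, hence the Frobenius product and norm below; on row vectors
   they are the Euclidean ones. *)
Definition frob (R : realType) (p q : nat) (y y' : 'M[R]_(p, q)) : R :=
  \sum_(i < p) \sum_(j < q) y i j * y' i j.

Definition fnorm (R : realType) (p q : nat) (y : 'M[R]_(p, q)) : R :=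
  Num.sqrt (frob y y).

HB.instance Definition _ (R : realType) (p q : nat) :=
  @isMeasurable.Build (sigma_display (@open 'M[R]_(p, q))) 'M[R]_(p, q)
    <<s @open 'M[R]_(p, q) >> (@sigma_algebra0 _ _ _) (@sigma_algebraC _ _)
    (@sigma_algebra_bigcup _ _ _).

Section lebesgue_measure_Rn.
Context {R : realType}.

Definition snoc (n : nat) (vt : 'rV[R]_n * R) : 'rV[R]_n.+1 :=
  \row_i oapp (fun j => vt.1 0 j) vt.2 (unlift ord_max i).

Lemma ball_snoc (n : nat) (a b : 'rV[R]_n) (s t e : R) :
  ball a e b -> ball s e t -> ball (snoc (a, s)) e (snoc (b, t)).
Proof.
move=> [e0 ab] st; split=> // i j; rewrite !mxE /=.
by case: (unlift _ _) => [k|//] /=; exact: ab.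
Qed.

Lemma ball_ratr (n : nat) (a : 'rV[R]_n) (e : R) : 0 < e ->
  exists p : 'rV[rat]_n, ball (map_mx (ratr : rat -> R) p) e a.
Proof.
move=> e0.
have /choice [p hp] j : exists q : rat, ball (ratr q : R) e (a 0 j).
  have /rat_in_itvoo [q] : a 0 j - e < a 0 j + e
    by rewrite ltrBlDr -addrA ltrDl addr_gt0.
  rewrite in_itv /= => /andP[q1 q2]; exists q.
  by rewrite /ball /= ltr_distl q1.
exists (\row_j p j); split=> // i j; rewrite !mxE (ord1 i); exact: hp.
Qed.

Lemma measurable_snoc (n : nat) : measurable_fun [set: 'rV[R]_n * R] (@snoc n).
Proof.
apply: (@measurability _ _ _ _ _ _ (@open 'rV[R]_n.+1)) => //.
move=> _ [U oU <-]; rewrite setTI.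
pose W (x : 'rV[rat]_n * rat * nat) : set ('rV[R]_n * R) :=
  ball (map_mx (ratr : rat -> R) x.1.1) x.2.+1%:R^-1
    `*` ball (ratr x.1.2 : R) x.2.+1%:R^-1.
pose F x := if pselect (W x `<=` @snoc n @^-1` U) is left _ then W x else set0.
have -> : @snoc n @^-1` U = \bigcup_x F x.
  apply/seteqP; split=> [[a s] Uas|y [x _]]; last first.
    by rewrite /F; case: pselect => // h; exact: h.
  have /nbhs_ballP[e /= e0 eU] : nbhs (snoc (a, s)) U by exact: open_nbhs_nbhs.
  have [k ke] : exists k : nat, (k.+1%:R^-1 : R) < e / 2.
    have /ltr_add_invr[k] : (0 : R) < e / 2 by rewrite divr_gt0.
    by rewrite add0r => hk; exists k.
  have k0 : (0 : R) < k.+1%:R^-1 by rewrite invr_gt0.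
  have [p pa] := ball_ratr a k0.
  have [q [_ /(_ 0 0)]] := ball_ratr (const_mx s : 'rV[R]_1) k0.
  rewrite !mxE => qs.
  exists (p, q 0 0, k) => //; rewrite /F; case: pselect => // -[].
  move=> -[b t] [/= pb qt]; apply: eU.
  apply: (@le_ball _ _ _ (k.+1%:R^-1 + k.+1%:R^-1)).
    by rewrite [leRHS]splitr lerD // ltW.
  by apply: ball_snoc; [apply: (ball_triangle (ball_sym pa) pb)
    | apply: (ball_triangle (ball_sym qs) qt)].
apply: countable_bigcupT_measurable => // x; rewrite /F; case: pselect => // _.
apply: measurableX; last exact: measurable_ball.
by apply: sub_sigma_algebra; exact: ball_open.
Qed.

Definition pushforward_measure d d' (T : measurableType d)
    (T' : measurableType d') (mu : {measure set T -> \bar R}) (g : T -> T')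
    (mg : measurable_fun [set: T] g) : {measure set T' -> \bar R}.
Proof. by refine (pushforward mu g : {measure set T' -> \bar R}). Defined.

(* Lebesgue measure on R^n, as the n-fold product of the one-dimensional one. *)
Fixpoint leb (n : nat) : {measure set 'rV[R]_n -> \bar R} :=
  if n is k.+1
  then pushforward_measure (leb k \x @lebesgue_measure R)%E (@measurable_snoc k)
  else dirac (0 : 'rV[R]_0).

End lebesgue_measure_Rn.

Arguments leb {R} n.

Section hausdorff_measure.
Context {R : realType} {n : nat}.
Implicit Types E C : set 'rV[R]_n.

Definition diam C : \bar R :=
  ereal_sup [set (fnorm (x - y))%:E | x in C & y in C].

(* omega s * (diam C / 2) ^ s, where omega s is the volume of the unit ball
   of R^s; the empty set has gauge 0 also for s = 0. *)
Definition hausdorff_gauge (s : nat) C : \bar R :=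
  if C == set0 then 0%E
  else (leb s [set x | (fnorm x <= 1)%R] * ((diam C * (2^-1)%:E) ^+ s))%E.

Definition hausdorff_delta (s : nat) (delta : R) E : \bar R :=
  ereal_inf [set (\sum_(k <oo) hausdorff_gauge s (C k))%E |
    C in [set C : (set 'rV[R]_n)^nat |
      E `<=` \bigcup_k C k /\ forall k, (diam (C k) <= delta%:E)%E]].

(* Hausdorff outer measure; it is only used on the Borel sigma-algebra, on
   which it is a measure. *)
Definition hausdorff (s : nat) E : \bar R :=
  ereal_sup [set hausdorff_delta s delta E | delta in [set delta | 0 < delta]].

End hausdorff_measure.

Section smooth_functions.
Context {R : realType} {n : nat}.

Definition partial (j : 'I_n) (phi : 'rV[R]_n -> R) : 'rV[R]_n -> R :=
  fun x => 'D_(delta_mx 0 j) phi x.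

Fixpoint class_C (k : nat) (phi : 'rV[R]_n -> R) : Prop :=
  if k is k'.+1
  then continuous phi /\ forall j : 'I_n,
    (forall x, derivable phi x (delta_mx 0 j)) /\ class_C k' (partial j phi)
  else continuous phi.

(* C_c^oo(Omega); test functions are extended by 0 to the whole of R^n. *)
Definition test_function (Omega : set 'rV[R]_n) (phi : 'rV[R]_n -> R) : Prop :=
  [/\ forall k, class_C k phi,
      compact (closure [set x | phi x != 0])
    & closure [set x | phi x != 0] `<=` Omega].

End smooth_functions.

Definition bd (R : realType) (n : nat) (Omega : set 'rV[R]_n) : set 'rV[R]_n :=
  closure Omega `\` interior Omega.

(* Near each boundary point, and after a rotation of the coordinate axes,
   Omega is the region lying strictly above the graph of a Lipschitz function
   of the first n coordinates. *)
Definition lipschitz_boundary (R : realType) (n : nat)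
    (Omega : set 'rV[R]_n.+1) : Prop :=
  forall p, bd Omega p ->
  exists (Q : 'M[R]_n.+1) (g : 'rV[R]_n -> R) (rho : R),
    [/\ Q *m Q^T = 1%:M, lipschitz g, 0 < rho &
        forall v t, fnorm (snoc (v, t) *m Q - p) < rho ->
          (Omega (snoc (v, t) *m Q) <-> g v < t)].

Section function_spaces.
Context {R : realType} {n : nat}.
Variable Omega : set 'rV[R]_n.

(* Elements of L^p(Omega) are represented by Borel functions on R^n of which
   only the values on Omega matter. *)
Definition Lp (r : \bar R) (p q : nat) (u : 'rV[R]_n -> 'M[R]_(p, q)) : Prop :=
  forall i j, (fun x => u x i j) \_ Omega \in Lfun (leb n) r.

Definition is_weak_gradient (m : nat) (phi : 'rV[R]_n -> 'rV[R]_m)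
    (G : 'rV[R]_n -> 'M[R]_(m, n)) : Prop :=
  forall psi, test_function Omega psi -> forall i j,
    \int[leb n]_(x in Omega) (phi x 0 i * partial j psi x) =
    - \int[leb n]_(x in Omega) (G x i j * psi x).

Definition is_weak_div (m : nat) (z : 'rV[R]_n -> 'M[R]_(m, n))
    (d : 'rV[R]_n -> 'rV[R]_m) : Prop :=
  forall psi, test_function Omega psi -> forall i,
    \int[leb n]_(x in Omega) (\sum_j z x i j * partial j psi x) =
    - \int[leb n]_(x in Omega) (d x 0 i * psi x).

(* Only meaningful (and then unique up to null sets) when div z is in L^2. *)
Definition weak_div (m : nat) (z : 'rV[R]_n -> 'M[R]_(m, n)) :
    'rV[R]_n -> 'rV[R]_m :=
  xget (fun=> 0) [set d | Lp 2%:E d /\ is_weak_div z d].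

(* A bounded signed Radon measure is given as a difference P - N of two finite
   Borel measures; this is its action on a test function. *)
Definition signed_int (P N : {finite_measure set 'rV[R]_n -> \bar R})
    (phi : 'rV[R]_n -> R) : R :=
  \int[P]_(x in Omega) phi x - \int[N]_(x in Omega) phi x.

(* The boundary trace of a W^{1,1} function, as the limit of its averages over
   Omega `&` B(x, r). *)
Definition boundary_trace (m : nat) (phi : 'rV[R]_n -> 'rV[R]_m)
    (x : 'rV[R]_n) : 'rV[R]_m :=
  \row_i lim ((fun r : R =>
    let D := Omega `&` [set y | fnorm (y - x) < r] in
    (fine (leb n D))^-1 * \int[leb n]_(y in D) phi y 0 i) @ 0^'+).

End function_spaces.

Section BVA.
Context {R : realType} {m n : nat}.
Variables (Omega : set 'rV[R]_n) (A : {linear 'M[R]_(m, n) -> 'M[R]_(m, n)}).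
Implicit Types (u w : 'rV[R]_n -> 'rV[R]_m) (z : 'rV[R]_n -> 'M[R]_(m, n)).

(* The distribution A (Du), tested against a scalar function. *)
Definition A_gradient u (phi : 'rV[R]_n -> R) : 'M[R]_(m, n) :=
  A (\matrix_(i, j) - \int[leb n]_(x in Omega) (u x 0 i * partial j phi x)).

Definition BVA u : Prop :=
  Lp Omega 1%:E u /\
  exists P N : 'I_m -> 'I_n -> {finite_measure set 'rV[R]_n -> \bar R},
  forall phi, test_function Omega phi -> forall i j,
    A_gradient u phi i j = signed_int Omega (P i j) (N i j) phi.

Definition X2 z : Prop :=
  [/\ Lp Omega +oo%E z,
      {ae leb n, forall x, Omega x -> A (z x) = z x}
    & exists d, Lp Omega 2%:E d /\ is_weak_div Omega z d].

Definition pairing z u (phi : 'rV[R]_n -> R) : R :=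
  - \int[leb n]_(x in Omega)
      (\sum_i phi x * weak_div Omega z x 0 i * u x 0 i +
       \sum_i \sum_j partial j phi x * z x i j * u x 0 i).

(* The total mass (z, Au)(Omega) of the signed measure P - N that represents
   the pairing. *)
Definition pairing_mass z u : R :=
  xget 0 [set c | exists P N : {finite_measure set 'rV[R]_n -> \bar R},
    (forall phi, test_function Omega phi ->
       pairing z u phi = signed_int Omega P N phi) /\
    c = fine (P Omega) - fine (N Omega)].

(* g is the normal trace <z, nu>; nu itself does not enter the defining
   identity. *)
Definition is_normal_trace z (g : 'rV[R]_n -> 'rV[R]_m) : Prop :=
  (forall i, measurable_fun (bd Omega) (fun x => g x 0 i)) /\
  (exists M : R,
     {ae hausdorff n.-1, forall x, bd Omega x -> fnorm (g x) <= M}) /\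
  forall phi G, Lp Omega 1%:E phi -> Lp Omega 2%:E phi ->
    Lp Omega 1%:E G -> is_weak_gradient Omega phi G ->
    (\int[leb n]_(x in Omega)
       (frob (weak_div Omega z x) (phi x) + frob (z x) (G x))%:E =
     \int[hausdorff n.-1]_(x in bd Omega)
       (frob (boundary_trace Omega phi x) (g x))%:E)%E.

End BVA.

Section duality.
Context {R : realType} {m n : nat}.
Variables (Omega : set 'rV[R]_n) (A : {linear 'M[R]_(m, n) -> 'M[R]_(m, n)}).
Variable f : 'rV[R]_n -> 'M[R]_(m, n) -> R.
Implicit Types (u w r : 'rV[R]_n -> 'rV[R]_m) (z : 'rV[R]_n -> 'M[R]_(m, n)).

Definition conjugate (x : 'rV[R]_n) (p : 'M[R]_(m, n)) : \bar R :=
  ereal_sup [set (frob p y - f x y)%:E | y in setT].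

Definition admissible z : Prop :=
  X2 Omega A z /\ (leb n).-integrable Omega (fun x => conjugate x (z x)).

Definition dual_energy z u : \bar R :=
  (\int[leb n]_(x in Omega) (- conjugate x (z x)) +
   (pairing_mass Omega z u)%:E)%E.

Definition F_dual u : \bar R :=
  if `[< BVA Omega A u >]
  then ereal_sup [set dual_energy z u | z in admissible]
  else +oo%E.

(* When G takes the value +oo at both w and u, the difference is -oo in \bar R
   and the inequality fails, so that G u < +oo is forced. *)
Definition subdifferential (G : ('rV[R]_n -> 'rV[R]_m) -> \bar R) u :
    set ('rV[R]_n -> 'rV[R]_m) :=
  [set r | forall w, Lp Omega 2%:E w ->
    ((\int[leb n]_(x in Omega) frob (r x) (w x - u x)%R)%R%:E <= G w - G u)%E].

End duality.

(* Main.v *)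
(* Two ingredients: a Gauss-Green formula and a duality argument.

   Gauss-Green.  Let z be bounded with Az = z and suppose that z, extended by 0,
   has a square integrable divergence on the whole space (a weak form of zero
   normal trace).  Mollification, together with the symmetry of A, bounds the
   pairing (z, Au) by |z|_oo times the total variation of Au.  Then
   (z, Au)(Omega) = - int u . div z: this is direct when z has compact support in
   Omega, and a partition of unity reduces the general case to fields that a small
   translation along a Lipschitz chart pushes into Omega.

   From (a) to (b).  The subgradient inequality for smooth fields w reads
   int r . w <= int f(x, Dw) + c, with c = int r . u - F(u).  By Hahn-Banach the
   functional Dw |-> int r . w extends to all bounded matrix fields Y, dominated
   by int f(x, Y) + c.  The growth of f bounds it by C0 int |AY|, so that it has a
   bounded density z with Az = z, and optimising Y pointwise gives
   int f^*(x, z) <= c.  As z tests against every Dw as r tests against w,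
   Gauss-Green turns int r . w into (z, Aw)(Omega) for all w.

   Conversely, (b) applied to the multiples t w forces the linear functional
   (z, Aw)(Omega) - int r . w to vanish, which gives (c) and (d); and a zero normal
   trace, tested against smooth fields, is again the hypothesis of Gauss-Green. *)

From HB Require Import structures.
From mathcomp Require Import ring lra.
Require Import Defs.

Set Implicit Arguments.
Unset Strict Implicit.
Unset Printing Implicit Defensive.

Local Open Scope classical_set_scope.
Local Open Scope ring_scope.

(** * Lebesgue measure on row vectors *)

(** Two obstacles shape the proof. The translations in the Gauss-Green part act on [z], while the
    gradient of [u] is only a measure, on which translation is not continuous in mass. The limit is
    saved by a bound that is uniform over translates: for every field with compact support in
    [Omega], the defect in Gauss-Green at a cutoff is controlled by the mass that one fixed measure
    leaves uncovered by that cutoff. On the duality side, density of smooth fields in BV^A and any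
    identification of [F_dual] with a relaxed functional are bypassed: the gradients of smooth
    fields already determine enough of [z], and Gauss-Green carries the identity from them to every
    [w], so that only the upper bound of [F_dual] on smooth fields enters. The additive constant [c]
    makes the dominating functional convex but not sublinear, which fixes the form of Hahn-Banach.
    Finally, [weak_div] and [pairing_mass] are defined by choice: the former is pinned down almost
    everywhere by the fundamental lemma of the calculus of variations, the latter as a limit of
    pairings along cutoffs that exhaust [Omega]. *)

Section measurability_rV.
Context {R : realType}.

Lemma open_measurable_rV (n : nat) (U : set 'rV[R]_n) : open U -> measurable U.
Proof. by move=> oU; exact: sub_sigma_algebra. Qed.

Lemma closed_measurable_rV (n : nat) (U : set 'rV[R]_n) : closed U -> measurable U.
Proof.
move=> cU; rewrite -(setCK U); apply: measurableC; apply: open_measurable_rV.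
exact: closed_openC.
Qed.

Lemma continuous_measurable_rV (n : nat) (g : 'rV[R]_n -> R) :
  continuous g -> measurable_fun [set: 'rV[R]_n] g.
Proof.
move=> cg; apply: (measurability (@RGenOInfty.G R)).
  exact: RGenOInfty.measurableE.
move=> _ [_ [a ->] <-]; rewrite setTI; apply: open_measurable_rV.
by move/continuousP : cg; apply; rewrite set_itvE; exact: open_gt.
Qed.

Lemma measurable_coord (n : nat) (j : 'I_n) :
  measurable_fun [set: 'rV[R]_n] (fun x : 'rV[R]_n => x 0 j).
Proof. by apply: continuous_measurable_rV; exact: coord_continuous. Qed.

Lemma bigsetI_ord (T : Type) (n : nat) (F : 'I_n -> set T) (t : T) :
  (\big[setI/setT]_(j < n) F j) t <-> forall j, F j t.
Proof.
split=> [h j|h]; first by move: h; rewrite (bigD1 j) //= => -[].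
by elim/big_ind : _ => // A B hA hB; split.
Qed.

Lemma ball_rVE (n : nat) (a : 'rV[R]_n) (e : R) (x : 'rV[R]_n) : 0 < e ->
  ball a e x <-> forall j, `|a 0 j - x 0 j| < e.
Proof.
move=> e0; split => [[_ h] j|h]; first exact: h.
by split=> // i j; rewrite (ord1 i); exact: h.
Qed.

(** Open sets generate the sigma-algebra, and an open set is the countable union of the rational
    cubes inside it; the preimage of a cube is a finite intersection of conditions on single
    coordinates. *)
Lemma measurable_rV d (T : measurableType d) (n : nat) (g : T -> 'rV[R]_n) :
  (forall j, measurable_fun [set: T] (fun t => g t 0 j)) ->
  measurable_fun [set: T] g.
Proof.
move=> mg; apply: (@measurability _ _ _ _ _ _ (@open 'rV[R]_n)) => //.
move=> _ [U oU <-]; rewrite setTI.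
pose W (x : 'rV[rat]_n * nat) : set 'rV[R]_n :=
  ball (map_mx (ratr : rat -> R) x.1) x.2.+1%:R^-1.
pose F x := if pselect (W x `<=` U) is left _ then g @^-1` (W x) else set0.
have -> : g @^-1` U = \bigcup_x F x.
  apply/seteqP; split=> [t Ut|y [x _]]; last first.
    by rewrite /F; case: pselect => // h; exact: h.
  have /nbhs_ballP[e /= e0 eU] : nbhs (g t) U by exact: open_nbhs_nbhs.
  have [k ke] : exists k : nat, (k.+1%:R^-1 : R) < e / 2.
    have /ltr_add_invr[k] : (0 : R) < e / 2 by rewrite divr_gt0.
    by rewrite add0r => hk; exists k.
  have k0 : (0 : R) < k.+1%:R^-1 by rewrite invr_gt0.
  have [p pa] := ball_ratr (g t) k0.
  exists (p, k) => //; rewrite /F; case: pselect => // -[].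
  move=> y /= py; apply: eU.
  apply: (@le_ball _ _ _ (k.+1%:R^-1 + k.+1%:R^-1)).
    by rewrite [leRHS]splitr lerD // ltW.
  exact: (ball_triangle (ball_sym pa) py).
apply: countable_bigcupT_measurable => // x; rewrite /F; case: pselect => // _.
have -> : g @^-1` (W x) = \big[setI/setT]_(j < n)
    [set t | `|map_mx (ratr : rat -> R) x.1 0 j - g t 0 j| < x.2.+1%:R^-1].
  apply/seteqP; split=> t /=.
    by move=> /ball_rVE h; apply/bigsetI_ord => j; apply: h.
  by move=> /bigsetI_ord h; apply/ball_rVE => // j; apply: (h j).
apply: bigsetI_measurable => j _.
rewrite -[X in measurable X]setTI.
have m : measurable_fun setT
    (fun t => `|map_mx (ratr : rat -> R) x.1 0 j - g t 0 j| < x.2.+1%:R^-1).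
  apply: measurable_fun_ltr => //; apply: measurableT_comp => //.
  exact: measurable_funB.
exact: (m measurableT [set true]).
Qed.

Lemma measurable_addl (n : nat) (a : 'rV[R]_n) :
  measurable_fun [set: 'rV[R]_n] (fun x => a + x).
Proof.
apply: measurable_rV => j; under eq_fun do rewrite mxE.
by apply: measurable_funD => //; exact: measurable_coord.
Qed.

Lemma measurable_subr_pair (n : nat) :
  measurable_fun [set: 'rV[R]_n * 'rV[R]_n] (fun x => x.1 - x.2).
Proof.
apply: measurable_rV => j; under eq_fun do rewrite !mxE.
apply: measurable_funB => //.
  by apply: (measurableT_comp (measurable_coord j)).
by apply: (measurableT_comp (measurable_coord j)).
Qed.

Lemma measurable_addr_pair (n : nat) :
  measurable_fun [set: 'rV[R]_n * 'rV[R]_n] (fun x => x.1 + x.2).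
Proof.
apply: measurable_rV => j; under eq_fun do rewrite !mxE.
apply: measurable_funD => //.
  by apply: (measurableT_comp (measurable_coord j)).
by apply: (measurableT_comp (measurable_coord j)).
Qed.

Lemma measurable_fun_ballrV (n : nat) (a : 'rV[R]_n) (e : R) : measurable (ball a e).
Proof. by apply: open_measurable_rV; exact: ball_open. Qed.

End measurability_rV.

Section leb_theory.
Context {R : realType}.

Lemma leb_prod (n : nat) (E : set 'rV[R]_n.+1) :
  leb n.+1 E = (leb n \x @lebesgue_measure R)%E (@snoc R n @^-1` E).
Proof. by []. Qed.

Lemma snoc_ball (n : nat) (a : 'rV[R]_n) (s e : R) : 0 < e ->
  @snoc R n @^-1` ball (snoc (a, s)) e = ball a e `*` ball s e.
Proof.
move=> e0; apply/seteqP; split=> [[b t]|[b t]] /=.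
  move=> /ball_rVE h; split.
    apply/ball_rVE => // j; have := h e0 (lift ord_max j).
    by rewrite !mxE liftK.
  by have := h e0 ord_max; rewrite !mxE unlift_none.
by move=> [h1 h2]; apply: ball_snoc.
Qed.

Lemma snoc_surj (n : nat) (x : 'rV[R]_n.+1) :
  x = snoc (\row_j x 0 (lift ord_max j), x 0 ord_max).
Proof.
apply/rowP => i; rewrite !mxE.
by case: (unliftP ord_max i) => [j ->|->] /=; rewrite ?mxE.
Qed.

Lemma lebesgue_measure_ball_fin (a e : R) : 0 < e ->
  lebesgue_measure (ball a e) = (2 * e)%:E.
Proof.
move=> e0; rewrite ball_itv lebesgue_measure_itv /= lte_fin ltrBlDr -addrA.
rewrite ltrDl addr_gt0 // -EFinD; congr EFin.
by rewrite opprD opprK addrACA subrr add0r -mulr2n mulr_natl.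
Qed.

(** Balls of the sup norm are cubes, so the product structure yields their measure directly. *)
Lemma leb_ball (n : nat) (a : 'rV[R]_n) (e : R) : 0 < e ->
  leb n (ball a e) = ((2 * e) ^+ n)%:E.
Proof.
elim: n a => [|n IH] a e0.
  rewrite expr0 /= diracE mem_set //; apply/ball_rVE => //.
  by case.
have mb := measurable_fun_ballrV (\row_j a 0 (lift ord_max j)) e.
have ms := measurable_ball (a 0 ord_max) e.
rewrite leb_prod (snoc_surj a) snoc_ball // product_measure1E //.
by rewrite exprSr EFinM; congr (_ * _)%E; [exact: IH|exact: lebesgue_measure_ball_fin].
Qed.

(** The pushforward under the translation agrees with Lebesgue measure on half-open intervals, and
    these determine it. *)
Lemma lebesgue_measure_translate (a : R) (E : set R) : measurable E ->
  lebesgue_measure ((fun x => a + x) @^-1` E) = lebesgue_measure E.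
Proof.
move=> mE.
have ma : measurable_fun [set: measurableTypeR R]
    ((fun x => a + x) : measurableTypeR R -> measurableTypeR R).
  exact: measurable_funD.
pose mu := pushforward_measure (@lebesgue_measure R) ma.
have := @lebesgue_measure_unique R mu _ E mE.
move=> ->//= _ [[b c] _ <-].
rewrite /mu /= /pushforward.
have -> : (fun x => a + x) @^-1` `]b, c] = `]b - a, c - a]%classic.
  by apply/seteqP; split=> x /=; rewrite !in_itv /= ltrBlDl lerBrDl.
by rewrite !lebesgue_measure_itv /= !lte_fin ltrD2r -!EFinD opprB addrA subrK.
Qed.

Lemma snocD (n : nat) (a b : 'rV[R]_n) (s t : R) :
  snoc (a, s) + snoc (b, t) = snoc (a + b, s + t).
Proof.
apply/rowP => i; rewrite !mxE.
by case: (unlift _ _) => [j|] //=; rewrite mxE.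
Qed.

(** Translating the last coordinate preserves the measure of each section; the inductive hypothesis
    then changes variables in the base. *)
Lemma leb_translate (n : nat) (a : 'rV[R]_n) (E : set 'rV[R]_n) :
  measurable E -> leb n ((fun x => a + x) @^-1` E) = leb n E.
Proof.
elim: n a E => [|n IH] a E mE.
  by congr (leb 0 _); apply/seteqP; split => x /=; rewrite (thinmx0 (a + x)) (thinmx0 x).
rewrite !leb_prod (snoc_surj a).
set a' := \row_j _; set s := a _ _.
have mF : measurable (@snoc R n @^-1` E).
  by rewrite -[X in measurable X]setTI; exact: measurable_snoc.
set F := @snoc R n @^-1` E in mF *.
rewrite /product_measure1.
pose g v := lebesgue_measure (xsection F v).
have mg : measurable_fun setT g by exact: (measurable_fun_xsection lebesgue_measure).
transitivity (\int[leb n]_v g (a' + v)%R)%E.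
  apply: eq_integral => v _ /=.
  rewrite /g -[RHS](lebesgue_measure_translate s); last exact: measurable_xsection.
  congr (lebesgue_measure _); apply/seteqP; split => t;
  by rewrite /xsection /= !inE /= /F /= snocD.
have ma := measurable_addl a'.
rewrite -[LHS](@ge0_integral_pushforward _ _ _ _ R _ ma (leb n) setT g) //.
apply: eq_measure_integral => B mB _; exact: IH.
Qed.

Lemma leb_ball_fin (n : nat) (a : 'rV[R]_n) (e : R) : (leb n (ball a e) < +oo)%E.
Proof.
have [e0|e0] := ltP 0 e; first by rewrite leb_ball // ltry.
have -> : ball a e = set0.
  apply/seteqP; split => // x [h _]; by move: (lt_le_trans h e0); rewrite ltxx.
by rewrite measure0.
Qed.

Lemma bigcup_ball (n : nat) : \bigcup_k ball (0 : 'rV[R]_n) k.+1%:R = setT.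
Proof.
apply/seteqP; split => // x _.
exists (Num.Def.truncn `|x|) => //.
rewrite -ball_normE /= sub0r normrN.
exact: truncnS_gt.
Qed.

Lemma leb_sigma_finite (n : nat) : sigma_finite setT (@leb R n).
Proof.
exists (fun k => ball (0 : 'rV[R]_n) k.+1%:R); first by rewrite bigcup_ball.
by move=> k; split; [exact: measurable_fun_ballrV|exact: leb_ball_fin].
Qed.

(* [leb n] is a record without a head constant on which canonical structures
   can be keyed; its sigma-finite packaging needs one *)
Definition sfleb (n : nat) : set 'rV[R]_n -> \bar R := leb n.

HB.instance Definition _ (n : nat) := Measure.copy (@sfleb n) (leb n).
HB.instance Definition _ (n : nat) :=
  @Measure_isSigmaFinite.Build _ _ _ (@sfleb n) (@leb_sigma_finite n).
End leb_theory.

(** * Summable real functions *)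

Section real_integrals.
Context d (T : measurableType d) (R : realType) (mu : {measure set T -> \bar R}).
Implicit Types f g h : T -> R.

(** Integration is over the whole space: functions on [Omega] are extended by zero, so that no
    domain of integration has to be carried through translations and Fubini. *)
Definition summ f := mu.-integrable setT (EFin \o f).

Lemma summ_measurable f : summ f -> measurable_fun setT f.
Proof. by move=> /integrableP[mf _]; exact/measurable_EFinP. Qed.

Lemma eq_summ f g : f =1 g -> summ f -> summ g.
Proof. by move=> /funext ->. Qed.

Lemma summ0 : summ (fun=> 0).
Proof. exact: integrable0. Qed.

Lemma summD f g : summ f -> summ g -> summ (fun x => f x + g x).
Proof. by move=> hf hg; exact: (integrableD measurableT hf hg). Qed.

Lemma summZ a f : summ f -> summ (fun x => a * f x).
Proof. by move=> hf; exact: (integrableZl measurableT a hf). Qed.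

Lemma summN f : summ f -> summ (fun x => - f x).
Proof. by move=> hf; apply: eq_summ (summZ (-1) hf) => x; rewrite mulN1r. Qed.

Lemma summB f g : summ f -> summ g -> summ (fun x => f x - g x).
Proof. by move=> hf hg; exact: (summD hf (summN hg)). Qed.

Lemma summ_sum I (s : seq I) (P : pred I) (F : I -> T -> R) :
  (forall i, P i -> summ (F i)) -> summ (fun x => \sum_(i <- s | P i) F i x).
Proof.
move=> hF; elim: s => [|i s IH].
  by apply: eq_summ summ0 => x; rewrite big_nil.
have [Pi|Pi] := boolP (P i).
  by apply: eq_summ (summD (hF i Pi) IH) => x; rewrite big_cons Pi.
by apply: eq_summ IH => x; rewrite big_cons (negbTE Pi).
Qed.

Lemma summ_norm f : summ f -> summ (fun x => `|f x|).
Proof. by move=> hf; have := integrable_norm hf. Qed.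

Lemma le_summ f g : measurable_fun setT f -> (forall x, `|f x| <= g x) ->
  summ g -> summ f.
Proof.
move=> mf fg hg; apply: (le_integrable measurableT _ _ hg).
  exact/measurable_EFinP.
move=> x _ /=; rewrite lee_fin (le_trans (fg x)) // ler_norm //.
Qed.

Lemma summM_bounded (M : R) f g : measurable_fun setT g ->
  (forall x, `|g x| <= M) -> summ f -> summ (fun x => f x * g x).
Proof.
move=> mg gM hf; apply: (le_summ (g := fun x => M * `|f x|)).
- by apply: measurable_funM => //; exact: summ_measurable.
- by move=> x; rewrite normrM mulrC ler_wpM2r.
- by apply: summZ; exact: summ_norm.
Qed.

Lemma RintD f g : summ f -> summ g ->
  \int[mu]_x (f x + g x) = \int[mu]_x f x + \int[mu]_x g x.
Proof. by move=> hf hg; exact: RintegralD. Qed.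

Lemma RintZ a f : summ f -> \int[mu]_x (a * f x) = a * \int[mu]_x f x.
Proof. by move=> hf; exact: RintegralZl. Qed.

Lemma RintN f : summ f -> \int[mu]_x (- f x) = - \int[mu]_x f x.
Proof.
by move=> hf; rewrite -mulN1r -RintZ //; apply: eq_Rintegral => x _; rewrite mulN1r.
Qed.

Lemma RintB f g : summ f -> summ g ->
  \int[mu]_x (f x - g x) = \int[mu]_x f x - \int[mu]_x g x.
Proof. by move=> hf hg; exact: RintegralB. Qed.

Lemma Rint0 : \int[mu]_x (0 : R) = 0.
Proof. by rewrite /Rintegral integral0. Qed.

Lemma Rint_sum I (s : seq I) (P : pred I) (F : I -> T -> R) :
  (forall i, P i -> summ (F i)) ->
  \int[mu]_x (\sum_(i <- s | P i) F i x) = \sum_(i <- s | P i) \int[mu]_x F i x.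
Proof.
move=> hF; elim: s => [|i s IH].
  by rewrite big_nil -[RHS]Rint0; apply: eq_Rintegral => x _; rewrite big_nil.
rewrite big_cons; have [Pi|Pi] := boolP (P i).
  rewrite -IH -RintD; first by apply: eq_Rintegral => x _; rewrite big_cons Pi.
    exact: hF.
  exact: summ_sum.
by rewrite -IH; apply: eq_Rintegral => x _; rewrite big_cons (negbTE Pi).
Qed.

Lemma le_Rint f g : summ f -> summ g -> (forall x, f x <= g x) ->
  \int[mu]_x f x <= \int[mu]_x g x.
Proof. by move=> hf hg fg; apply: le_Rintegral. Qed.

Lemma normr_Rint f : summ f -> `|\int[mu]_x f x| <= \int[mu]_x `|f x|.
Proof. by move=> hf; exact: le_normr_Rintegral. Qed.

Lemma le_normr_Rint f g : summ f -> summ g -> (forall x, `|f x| <= g x) ->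
  `|\int[mu]_x f x| <= \int[mu]_x g x.
Proof.
move=> hf hg fg; apply: (le_trans (normr_Rint hf)).
by apply: le_Rint => //; exact: summ_norm.
Qed.

Lemma Rint_ge0 f : (forall x, 0 <= f x) -> 0 <= \int[mu]_x f x.
Proof. by move=> f0; exact: Rintegral_ge0. Qed.

Lemma EFin_Rint f : summ f -> (\int[mu]_x f x)%:E = (\int[mu]_x (f x)%:E)%E.
Proof. by move=> hf; rewrite fineK //; exact: integrable_fin_num. Qed.

Lemma ae_eq_Rint f g : measurable_fun setT f -> measurable_fun setT g ->
  {ae mu, forall x, f x = g x} -> \int[mu]_x f x = \int[mu]_x g x.
Proof.
move=> mf mg fg; congr fine; apply: ae_eq_integral => //.
- exact/measurable_EFinP.
- exact/measurable_EFinP.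
- by apply: filterS fg => x -> _.
Qed.

Lemma ae_eq_summ f g : measurable_fun setT g ->
  {ae mu, forall x, f x = g x} -> summ f -> summ g.
Proof.
move=> mg fg hf; have /integrableP[mf fi] := hf.
apply/integrableP; split; first exact/measurable_EFinP.
rewrite (_ : (\int[mu]_x `|(EFin \o g) x|)%E = (\int[mu]_x `|(EFin \o f) x|)%E) //.
apply: ae_eq_integral => //.
- by apply: measurableT_comp => //; exact/measurable_EFinP.
- by apply: measurableT_comp.
- by apply: filterS fg => x /= -> _.
Qed.

Lemma Rint_dominated (fk : nat -> T -> R) f g :
  (forall k, measurable_fun setT (fk k)) -> measurable_fun setT f ->
  (forall x, fk k x @[k --> \oo] --> f x) ->
  summ g -> (forall k x, `|fk k x| <= g x) ->
  \int[mu]_x fk k x @[k --> \oo] --> \int[mu]_x f x.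
Proof.
move=> mfk mf cf hg fg.
have m1 k : measurable_fun setT (EFin \o fk k) by exact/measurable_EFinP.
have m2 : measurable_fun setT (EFin \o f) by exact/measurable_EFinP.
have c1 : {ae mu, forall x, setT x -> (EFin \o fk k) x @[k --> \oo] --> (EFin \o f) x}.
  by apply: nearW => x _; apply: cvg_EFin => //; [exact: nearW|exact: cf].
have d1 : {ae mu, forall x, forall k, setT x -> (`|(EFin \o fk k) x| <= (EFin \o g) x)%E}.
  by apply: nearW => x k _ /=; rewrite lee_fin.
have [h1 _ h2] := dominated_convergence measurableT m1 m2 c1 hg d1.
apply: fine_cvg; rewrite fineK //.
exact: integrable_fin_num.
Qed.

End real_integrals.

Arguments summ {d T R} mu f.

(** * Translation invariance and Fubini *)

Section translation.
Context {R : realType} {n : nat}.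
Local Notation X := 'rV[R]_n.

Lemma integral_translate (a : X) (f : X -> \bar R) : measurable_fun setT f ->
  (\int[leb n]_x f (a + x)%R = \int[leb n]_x f x)%E.
Proof.
move=> mf; have ma := measurable_addl a.
have H (g : X -> \bar R) : measurable_fun setT g -> (forall x, 0 <= g x)%E ->
    (\int[leb n]_x g (a + x)%R = \int[leb n]_x g x)%E.
  move=> mg g0.
  rewrite -[LHS](@ge0_integral_pushforward _ _ _ _ R _ ma (leb n) setT g) //.
  by apply: eq_measure_integral => B mB _; exact: leb_translate.
rewrite [LHS]integralE [RHS]integralE; congr (_ - _)%E.
  rewrite -[RHS](H _ (measurable_funepos mf)); last by move=> x; exact: funepos_ge0.
  by apply: eq_integral => x _; rewrite !funeposE.
rewrite -[RHS](H _ (measurable_funeneg mf)); last by move=> x; exact: funeneg_ge0.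
by apply: eq_integral => x _; rewrite !funenegE.
Qed.

Lemma Rint_translate (a : X) (f : X -> R) : measurable_fun setT f ->
  \int[leb n]_x f (a + x) = \int[leb n]_x f x.
Proof.
move=> mf; congr fine; apply: (integral_translate a (f := EFin \o f)).
exact/measurable_EFinP.
Qed.

Lemma summ_translate (a : X) (f : X -> R) :
  summ (leb n) f -> summ (leb n) (fun x => f (a + x)).
Proof.
move=> /integrableP[mf fi]; apply/integrableP; split.
  exact: measurableT_comp mf (measurable_addl a).
have := integral_translate a (f := fun x => `|(EFin \o f) x|%E).
by move=> /(_ (measurableT_comp _ mf)) /= -> //.
Qed.

Lemma measurable_translate (a : X) (f : X -> R) :
  measurable_fun setT f -> measurable_fun setT (fun x => f (a + x)).
Proof. by move=> mf; exact: (measurableT_comp mf (measurable_addl a)). Qed.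

Lemma summ_prodP (F : X * X -> R) : measurable_fun setT F ->
  (forall x, summ (leb n) (fun y => F (x, y))) ->
  summ (leb n) (fun x => \int[leb n]_y `|F (x, y)|) ->
  (@sfleb R n \x @sfleb R n)%E.-integrable setT (EFin \o F).
Proof.
move=> mF Fx FF.
apply/(@integrable12ltyP _ _ _ _ _ (@sfleb R n) (@sfleb R n)).
  exact/measurable_EFinP.
have /integrableP[_] := FF.
apply: le_lt_trans; apply: ge0_le_integral => //.
- by move=> x _; apply: integral_ge0.
- have := @measurable_fun_fubini_tonelli_F _ _ _ _ _ (@sfleb R n) (fun z => `|F z|%:E).
  apply; last by move=> z; rewrite lee_fin.
  by apply/measurable_EFinP; exact: measurableT_comp.
- by have /integrableP[mm _] := FF; exact: measurableT_comp.
move=> x _.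
rewrite /= ger0_norm; last exact: Rint_ge0.
by rewrite (EFin_Rint (summ_norm (Fx x))).
Qed.

(** Every section, not merely almost every one, is assumed summable: the inner integrals are real
    numbers, and [fine] would send a divergent one to 0. *)
Lemma Rint_fubini (F : X * X -> R) : measurable_fun setT F ->
  (forall x, summ (leb n) (fun y => F (x, y))) ->
  (forall y, summ (leb n) (fun x => F (x, y))) ->
  summ (leb n) (fun x => \int[leb n]_y `|F (x, y)|) ->
  [/\ summ (leb n) (fun x => \int[leb n]_y F (x, y)),
      summ (leb n) (fun y => \int[leb n]_x F (x, y)) &
  \int[leb n]_x (\int[leb n]_y F (x, y)) =
  \int[leb n]_y (\int[leb n]_x F (x, y))].
Proof.
move=> mF Fx Fy FF; have FP := summ_prodP mF Fx FF.
split.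
- have := integrable_fubini_F FP; congr (_.-integrable _ _).
  by apply/funext => x /=; rewrite (EFin_Rint (Fx x)).
- have FS : (@sfleb R n \x @sfleb R n)%E.-integrable setT (EFin \o (fun z => F (z.2, z.1))).
    have mFs : measurable_fun setT (EFin \o (fun z => F (z.2, z.1))).
      by apply/measurable_EFinP; exact: (measurableT_comp mF (measurable_fun_pair measurable_snd measurable_fst)).
    apply/(@integrable12ltyP _ _ _ _ _ (@sfleb R n) (@sfleb R n) _ mFs).
    apply/(@integrable21ltyP _ _ _ _ _ (@sfleb R n) (@sfleb R n) (EFin \o F)) => //.
    exact/measurable_EFinP.
  have := integrable_fubini_F FS; congr (_.-integrable _ _).
  by apply/funext => x /=; rewrite (EFin_Rint (Fy x)).
congr fine; have := Fubini FP => /= E.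
transitivity (\int[leb n]_x (\int[leb n]_y (F (x, y))%:E))%E.
  by apply: eq_integral => x _; rewrite (EFin_Rint (Fx x)).
transitivity (\int[leb n]_y (\int[leb n]_x (F (x, y))%:E))%E; first exact: E.
by apply: eq_integral => y _; rewrite (EFin_Rint (Fy y)).
Qed.

(** Moves a convolution from one factor to the other; the product [|h x| * |k y| * M] dominates the
    integrand. *)
Lemma Rint_fubini_kernel (h k : X -> R) (rho : X * X -> R) (M : R) :
  summ (leb n) h -> summ (leb n) k ->
  measurable_fun setT rho -> (forall z, `|rho z| <= M) ->
  [/\ summ (leb n) (fun x => h x * \int[leb n]_y (k y * rho (x, y))),
      summ (leb n) (fun y => k y * \int[leb n]_x (h x * rho (x, y))) &
  \int[leb n]_x (h x * \int[leb n]_y (k y * rho (x, y))) =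
  \int[leb n]_y (k y * \int[leb n]_x (h x * rho (x, y)))].
Proof.
move=> hh hk mrho rhoM.
have mh := summ_measurable hh; have mk := summ_measurable hk.
pose F z := h z.1 * (k z.2 * rho z).
have mF : measurable_fun setT F.
  apply: measurable_funM; first exact: (measurableT_comp mh).
  by apply: measurable_funM => //; exact: (measurableT_comp mk).
have m1 x : measurable_fun setT (fun y => rho (x, y)).
  exact: measurableT_comp mrho (measurable_pair1 x).
have m2 y : measurable_fun setT (fun x => rho (x, y)).
  exact: measurableT_comp mrho (measurable_pair2 y).
have s1 x : summ (leb n) (fun y => k y * rho (x, y)).
  by apply: (summM_bounded (M := M)) => //.
have s2 y : summ (leb n) (fun x => h x * rho (x, y)).
  by apply: (summM_bounded (M := M)) => //.
have Fx x : summ (leb n) (fun y => F (x, y)) by exact: (summZ (h x) (s1 x)).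
have Fy y : summ (leb n) (fun x => F (x, y)).
  by apply: eq_summ (summZ (k y) (s2 y)) => x; rewrite /F /= mulrCA.
have M0 : 0 <= M by exact: le_trans (normr_ge0 _) (rhoM (0, 0)).
have FF : summ (leb n) (fun x => \int[leb n]_y `|F (x, y)|).
  pose C := \int[leb n]_y (`|k y| * M).
  apply: (le_summ (g := fun x => C * `|h x|)).
  - have := @measurable_fun_fubini_tonelli_F _ _ _ _ _ (@sfleb R n) (fun z => `|F z|%:E).
    move=> /(_ _ _) H.
    apply: (measurableT_comp (f := fine)) => //; apply: H.
      by apply/measurable_EFinP; exact: measurableT_comp.
    by move=> z; rewrite lee_fin.
  - move=> x; rewrite ger0_norm; last exact: Rint_ge0.
    rewrite mulrC /C -RintZ.
      apply: le_Rint; first exact: summ_norm.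
        apply: summZ; apply: eq_summ (summZ M (summ_norm hk)) => y.
        exact: mulrC.
      by move=> y; rewrite /F /= !normrM ler_wpM2l // ler_wpM2l.
    by apply: eq_summ (summZ M (summ_norm hk)) => y; exact: mulrC.
  - by apply: summZ; exact: summ_norm.
have [r1 r2 r3] := Rint_fubini mF Fx Fy FF.
have e1 x : \int[leb n]_y F (x, y) = h x * \int[leb n]_y (k y * rho (x, y)).
  by rewrite -RintZ.
have e2 y : \int[leb n]_x F (x, y) = k y * \int[leb n]_x (h x * rho (x, y)).
  by rewrite -RintZ //; apply: eq_Rintegral => x _; rewrite /F /= mulrCA.
split.
- exact: eq_summ r1.
- exact: eq_summ r2.
- rewrite (eq_Rintegral _ _ (g := fun x => \int[leb n]_y F (x, y))) ?r3 //.
  by apply: eq_Rintegral => x _; rewrite e2.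
Qed.

End translation.

(** * Smooth functions and cutoffs *)

Section class_C_theory.
Context {R : realType} {n : nat}.
Local Notation X := 'rV[R]_n.
Implicit Types (f g : X -> R) (j : 'I_n).

Definition smooth f := forall k, class_C k f.

Lemma class_C_continuous k f : class_C k f -> continuous f.
Proof. by case: k => [|k] //= -[]. Qed.

Lemma class_CS k f : class_C k.+1 f -> class_C k f.
Proof.
elim: k f => [|k IH] f; first by move=> [].
by move=> [cf h]; split=> // j; have [h1 h2] := h j; split => //; exact: IH.
Qed.

Lemma class_C_derivable k f j x : class_C k.+1 f -> derivable f x (delta_mx 0 j).
Proof. by move=> [_ /(_ j) []]. Qed.

Lemma class_C_partial k f j : class_C k.+1 f -> class_C k (partial j f).
Proof. by move=> [_ /(_ j) []]. Qed.

Lemma smooth_continuous f : smooth f -> continuous f.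
Proof. by move=> /(_ 0%N). Qed.

Lemma smooth_derivable f j x : smooth f -> derivable f x (delta_mx 0 j).
Proof. by move=> /(_ 1%N); exact: class_C_derivable. Qed.

Lemma smooth_partial f j : smooth f -> smooth (partial j f).
Proof. by move=> h k; exact: class_C_partial. Qed.

Lemma partial_cst j (c : R) : partial j (fun _ : X => c) = fun=> 0.
Proof. by apply/funext => x; exact: derive_cst. Qed.

Lemma smooth_cst (c : R) : smooth (fun _ : X => c).
Proof.
move=> k; elim: k c => [|k IH] c; first exact: cst_continuous.
split=> [|j]; first exact: cst_continuous.
by split=> [x|]; [exact: derivable_cst|rewrite partial_cst].
Qed.

Lemma partialD j f g x : derivable f x (delta_mx 0 j) ->
  derivable g x (delta_mx 0 j) ->
  partial j (fun x => f x + g x) x = partial j f x + partial j g x.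
Proof. by move=> df dg; exact: (deriveD df dg). Qed.

Lemma partialM j f g x : derivable f x (delta_mx 0 j) ->
  derivable g x (delta_mx 0 j) ->
  partial j (fun x => f x * g x) x = f x * partial j g x + g x * partial j f x.
Proof. by move=> df dg; exact: (deriveM df dg). Qed.

Lemma class_CD k f g : class_C k f -> class_C k g -> class_C k (fun x => f x + g x).
Proof.
elim: k f g => [|k IH] f g; first by move=> cf cg x; exact: (cvgD (cf x) (cg x)).
move=> [cf df] [cg dg]; split=> [x|j]; first exact: (cvgD (cf x) (cg x)).
have [d1 c1] := df j; have [d2 c2] := dg j; split=> [x|].
  exact: (derivableD (d1 x) (d2 x)).
have -> : partial j (fun x => f x + g x) = fun x => partial j f x + partial j g x.
  by apply/funext => x; exact: partialD.
exact: IH.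
Qed.

Lemma class_CM k f g : class_C k f -> class_C k g -> class_C k (fun x => f x * g x).
Proof.
elim: k f g => [|k IH] f g; first by move=> cf cg x; exact: (cvgM (cf x) (cg x)).
move=> hf hg; have [cf df] := hf; have [cg dg] := hg.
split=> [x|j]; first exact: (cvgM (cf x) (cg x)).
have [d1 c1] := df j; have [d2 c2] := dg j; split=> [x|].
  exact: (derivableM (d1 x) (d2 x)).
have -> : partial j (fun x => f x * g x) =
    fun x => f x * partial j g x + g x * partial j f x.
  by apply/funext => x; exact: partialM.
by apply: class_CD; apply: IH => //; exact: class_CS.
Qed.

Lemma class_CV k f : (forall x, f x != 0) -> class_C k f ->
  class_C k (fun x => (f x)^-1).
Proof.
move=> f0; elim: k => [|k IH]; first by move=> cf x; exact: (cvgV (f0 x) (cf x)).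
move=> hf; have [cf df] := hf; split=> [x|j]; first exact: (cvgV (f0 x) (cf x)).
have [d1 c1] := df j; split=> [x|]; first exact: (derivableV (f0 x) (d1 x)).
have -> : partial j (fun x => (f x)^-1) =
    fun x => (-1) * ((f x)^-1 * (f x)^-1 * partial j f x).
  apply/funext => x; rewrite /partial deriveV //.
  by rewrite /GRing.scale /= -exprVn expr2 mulN1r mulNr.
have hI : class_C k (fun x => (f x)^-1) by apply: IH; exact: class_CS.
by apply: class_CM; [exact: smooth_cst|apply: class_CM => //; exact: class_CM].
Qed.

Lemma smoothD f g : smooth f -> smooth g -> smooth (fun x => f x + g x).
Proof. by move=> hf hg k; exact: class_CD. Qed.

Lemma smoothM f g : smooth f -> smooth g -> smooth (fun x => f x * g x).
Proof. by move=> hf hg k; exact: class_CM. Qed.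

Lemma smoothZ a f : smooth f -> smooth (fun x => a * f x).
Proof. by move=> hf; apply: smoothM => //; exact: smooth_cst. Qed.

Lemma smooth_prod (I : Type) (s : seq I) (F : I -> X -> R) :
  (forall i, smooth (F i)) -> smooth (fun x => \prod_(i <- s) F i x).
Proof.
move=> hF; elim: s => [|i s IH].
  have -> : (fun x => \prod_(i <- [::]) F i x) = (fun=> 1 : R).
    by apply/funext => x; rewrite big_nil.
  exact: smooth_cst.
have -> : (fun x => \prod_(j <- i :: s) F j x) =
    (fun x => F i x * \prod_(j <- s) F j x).
  by apply/funext => x; rewrite big_cons.
exact: smoothM.
Qed.

Lemma partialZ j a f x : derivable f x (delta_mx 0 j) ->
  partial j (fun x => a * f x) x = a * partial j f x.
Proof.
move=> df; rewrite (partialM (smooth_derivable (smooth_cst a)) df).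
by rewrite partial_cst mulr0 addr0.
Qed.

Lemma dnbhs0N : -%R @ (0 : R)^' --> (0 : R)^'.
Proof.
move=> P /nbhs_ballP[e /= e0 h]; apply/nbhs_ballP; exists e => // y /= ye y0.
apply: h; last by rewrite oppr_eq0.
by move: ye; rewrite -!ball_normE /= !sub0r opprK normrN.
Qed.

Lemma reflect_cvg f (a x v : X) : derivable f (a - x) v ->
  h^-1 *: ((fun y => f (a - y)) (h *: v + x) - f (a - x)) @[h --> (0:R)^']
    --> - 'D_v f (a - x).
Proof.
move=> df.
have /cvgN := @cvg_comp _ _ _ _ _ _ _ _ dnbhs0N df.
apply: cvg_trans; apply: near_eq_cvg; near=> h.
have -> : a - (h *: v + x) = - h *: v + (a - x) by rewrite scaleNr opprD addrCA.
change (- ((- h)^-1 *: (f (- h *: v + (a - x)) - f (a - x))) =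
  h^-1 *: (f (- h *: v + (a - x)) - f (a - x))).
by rewrite invrN scaleNr opprK.
Unshelve. all: end_near. Qed.

Lemma derivable_reflect f (a x v : X) : derivable f (a - x) v ->
  derivable (fun y => f (a - y)) x v.
Proof. by move=> df; apply/cvg_ex; exists (- 'D_v f (a - x)); exact: reflect_cvg. Qed.

Lemma partial_reflect j f (a x : X) : derivable f (a - x) (delta_mx 0 j) ->
  partial j (fun y => f (a - y)) x = - partial j f (a - x).
Proof. by move=> df; apply/cvg_lim => //; exact: reflect_cvg. Qed.

Lemma class_C_reflect k f (a : X) : class_C k f -> class_C k (fun x => f (a - x)).
Proof.
have ct : continuous (fun x : X => a - x).
  by move=> x; apply: (@cvgB _ _ _ (nbhs x) _ (fun=> a) id); [exact: cvg_cst|exact: cvg_id].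
elim: k f => [|k IH] f; first by move=> cf x; apply: continuous_comp; [exact: ct|exact: cf].
move=> [cf df]; split=> [x|j].
  by apply: continuous_comp; [exact: ct|exact: cf].
have [d1 c1] := df j; split=> [x|]; first exact: derivable_reflect.
have -> : partial j (fun x => f (a - x)) = fun x => (-1) * partial j f (a - x).
  by apply/funext => x; rewrite partial_reflect // mulN1r.
by apply: class_CM; [exact: smooth_cst|exact: IH].
Qed.

Lemma smooth_reflect f (a : X) : smooth f -> smooth (fun x => f (a - x)).
Proof. by move=> hf k; exact: class_C_reflect. Qed.

End class_C_theory.

(** * Bump functions *)

Section bump.
Context {R : realType}.
Implicit Types (t : R) (k : nat).

(* The family is stable under differentiation: [flat k]' is a combination of
   [flat k.+1] and [flat k.+2]. *)
Definition flat k t : R := if 0 < t then t^-1 ^+ k * expR (- t^-1) else 0.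

Lemma flat_ge0 k t : 0 <= flat k t.
Proof.
rewrite /flat; case: ifPn => // t0.
by rewrite mulr_ge0 ?expR_ge0 // exprn_ge0 // invr_ge0 ltW.
Qed.

Lemma flat_le0 k t : t <= 0 -> flat k t = 0.
Proof. by rewrite /flat leNgt => /negbTE ->. Qed.

Lemma flat0_gt0 t : 0 < t -> 0 < flat 0 t.
Proof. by move=> t0; rewrite /flat t0 expr0 mul1r expR_gt0. Qed.

Lemma flat_bound k : exists C : R, 0 < C /\ forall t, flat k t <= C * t ^+ 2.
Proof.
exists (k.+2)`!%:R; split; first by rewrite ltr0n fact_gt0.
move=> t; rewrite /flat; case: ifPn => t0; last by rewrite mulr_ge0 ?sqr_ge0.
have t'0 : 0 < t^-1 by rewrite invr_gt0.
have F0 : 0 < (k.+2)`!%:R :> R by rewrite ltr0n fact_gt0.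
have H : t^-1 ^+ k.+2 <= (k.+2)`!%:R * expR (t^-1).
  rewrite mulrC -ler_pdivrMr // (le_trans _ (expR_ge1Dxn k.+1 (ltW t'0))) //.
  by rewrite lerDr.
rewrite expRN ler_pdivrMr ?expR_gt0 // mulrAC -ler_pdivrMr ?exprn_gt0 //.
by rewrite -exprVn -exprD addn2.
Qed.

Lemma is_derive_flat k t :
  is_derive t (1 : R) (flat k) (flat k.+2 t - k%:R * flat k.+1 t).
Proof.
have [t0|t0|->] := ltgtP t 0.
- rewrite !flat_le0 ?(ltW t0) // mulr0 subr0.
  have E : {near t, (fun=> 0) =1 flat k}.
    by near=> y; rewrite flat_le0 //; apply: ltW; near: y; exact: lt_nbhsl.
  apply: DeriveDef; first exact: near_eq_derivable E (derivable_cst _ _ _).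
  by rewrite -(near_eq_derive _ E) derive_cst.
- have E : {near t, (fun y => y^-1 ^+ k * expR (- y^-1)) =1 flat k}.
    near=> y; rewrite /flat; suff -> : 0 < y by [].
    by near: y; exact: lt_nbhsr.
  have tn0 : t != 0 by rewrite gt_eqF.
  have D : is_derive t (1 : R) (fun y => y^-1 ^+ k * expR (- y^-1))
      (flat k.+2 t - k%:R * flat k.+1 t).
    have V := is_deriveV tn0 (is_derive_id t (1 : R)).
    have NV : is_derive t (1 : R) (fun y : R => - y^-1) (- ((- t ^- 2) *: 1)) := is_deriveN V.
    have E1 := @is_derive1_comp R expR (fun y : R => - y^-1) t _ _ (is_derive_expR (- t^-1)) NV.
    have := is_deriveM (is_deriveX k V) E1.
    rewrite exprfctE => H; apply: (is_derive_eq H).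
    rewrite /flat t0 /GRing.scale /= -exprVn !mulr1 opprK.
    case: k {E H} => [|k]; rewrite /= ?exprS; first by ring.
    ring.
  apply: DeriveDef; first by apply: near_eq_derivable E _; exact: ex_derive.
  by rewrite -(near_eq_derive _ E) derive_val.
- rewrite !flat_le0 // mulr0 subr0.
  have [C [C0 hC]] := flat_bound k.
  suff H : h^-1 *: ((flat k \o shift 0) (h *: 1) - flat k 0) @[h --> (0:R)^'] --> (0 : R).
    by apply: DeriveDef; [apply/cvg_ex; exists 0|apply/cvg_lim].
  apply/cvgrPdist_le => e e0; near=> h.
  have -> : (flat k \o shift 0) (h *: 1) - flat k 0 = flat k h.
    by rewrite /= addr0 /GRing.scale /= mulr1 (flat_le0 k (lexx 0)) subr0.
  rewrite sub0r normrN.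
  have h0 : h != 0 by near: h; exact: nbhs_dnbhs_neq.
  rewrite /GRing.scale /= normrM (ger0_norm (flat_ge0 _ _)).
  apply: (@le_trans _ _ (`|h^-1| * (C * h ^+ 2))).
    by rewrite ler_wpM2l.
  rewrite -real_normK ?num_real // normrV ?unitfE // expr2 mulrCA mulKf ?normr_eq0 //.
  rewrite -ler_pdivlMl //.
  near: h; apply: nbhs_dnbhs.
  have := @nbhs0_le R R (C^-1 * e) _; apply; by rewrite mulr_gt0 ?invr_gt0.
Unshelve. all: end_near. Qed.

Section along_coordinate.
Variable n : nat.
Local Notation X := 'rV[R]_n.

Lemma dnbhs0M (c : R) : c != 0 -> h * c @[h --> (0 : R)^'] --> (0 : R)^'.
Proof.
move=> c0 P /nbhs_ballP[e /= e0 h]; apply/nbhs_ballP.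
exists (e / `|c|); first by rewrite /= divr_gt0 // normr_gt0.
move=> y /= ye y0; apply: h; last by rewrite mulf_neq0.
move: ye; rewrite -!ball_normE /= !sub0r !normrN normrM.
by rewrite ltr_pdivlMr // normr_gt0.
Qed.

Lemma derive_line_cvg (g : R -> R) (t c l : R) : is_derive t (1 : R) g l ->
  h^-1 *: (g (h * c + t) - g t) @[h --> (0 : R)^'] --> c * l.
Proof.
move=> [dg gl]; have [->|c0] := eqVneq c 0.
  rewrite mul0r; apply: cvg_near_cst; near=> h.
  by rewrite mulr0 add0r subrr scaler0.
have H : h^-1 *: ((g \o shift t) (h *: 1) - g t) @[h --> (0 : R)^'] --> l.
  by rewrite -gl; exact: dg.
have := cvgM (cvg_cst c) (@cvg_comp _ _ _ _ _ _ _ _ (dnbhs0M c0) H).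
move=> /(_ _ (dnbhs_filter _)); apply: cvg_trans; apply: near_eq_cvg; near=> h.
rewrite /= /GRing.scale /= mulr1.
change (c * ((h * c)^-1 * (g (h * c + t) - g t)) = h^-1 * (g (h * c + t) - g t)).
by rewrite invfM mulrA mulrCA mulfV // mulr1.
Unshelve. all: end_near. Qed.

Variables (a s : R) (j : 'I_n).
Local Notation lin x := (a + s * (x : X) 0 j).

Lemma is_derive_coord_comp (g : R -> R) (l : R) (x : X) (i : 'I_n) :
  is_derive (lin x) (1 : R) g l ->
  h^-1 *: (g (lin (h *: delta_mx 0 i + x)) - g (lin x)) @[h --> (0 : R)^']
    --> (s * (i == j)%:R) * l.
Proof.
move=> /derive_line_cvg; move/(_ (s * (i == j)%:R)).
apply: cvg_trans; apply: near_eq_cvg; near=> h.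
rewrite !mxE eqxx /= [j == i]eq_sym; congr (_ *: (g _ - _)); ring.
Unshelve. all: end_near. Qed.

Lemma class_C_flat k m : class_C m (fun x : X => flat k (lin x)).
Proof.
elim: m k => [|m IH] k.
  move=> x; apply: (@continuous_comp _ _ _ (fun x : X => lin x) (flat k)).
    apply: (@cvgD _ _ _ (nbhs x) _ (fun=> a) (fun y : X => s * y 0 j)).
      exact: cvg_cst.
    apply: (@cvgM _ _ (nbhs x) _ (fun=> s) (fun y : X => y 0 j)).
      exact: cvg_cst.
    exact: coord_continuous.
  have [df _] := is_derive_flat k (lin x).
  by apply: differentiable_continuous; exact/derivable1_diffP.
split=> [|i]; first exact: (class_C_continuous (IH k)).
have E x := @is_derive_coord_comp (flat k) _ x i (is_derive_flat k (lin x)).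
split=> [x|]; first by apply/cvg_ex; eexists; exact: E.
have -> : partial i (fun x : X => flat k (lin x)) =
    fun x => (s * (i == j)%:R) * (flat k.+2 (lin x) + (- k%:R) * flat k.+1 (lin x)).
  by apply/funext => x; rewrite mulNr; apply/cvg_lim => //; exact: E.
apply: class_CM; first exact: smooth_cst.
apply: class_CD; first exact: IH.
by apply: class_CM; [exact: smooth_cst|exact: IH].
Qed.
End along_coordinate.

(** The standard smooth transition from 0 on the negative half-line to 1 beyond 1; the two summands
    of the denominator never vanish together. *)
Definition step t : R := flat 0 t / (flat 0 t + flat 0 (1 - t)).

Lemma step_den t : 0 < flat 0 t + flat 0 (1 - t).
Proof.
have [t0|t0] := ltP 0 t; first by rewrite ltr_pwDl ?flat0_gt0 ?flat_ge0.
by rewrite ltr_pwDr ?flat_ge0 // flat0_gt0 // subr_gt0 (le_lt_trans t0).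
Qed.

Lemma step_ge0 t : 0 <= step t.
Proof. by rewrite divr_ge0 ?flat_ge0 // ltW // step_den. Qed.

Lemma step_le1 t : step t <= 1.
Proof. by rewrite ler_pdivrMr ?step_den // mul1r lerDl flat_ge0. Qed.

Lemma step_eq0 t : t <= 0 -> step t = 0.
Proof. by move=> t0; rewrite /step flat_le0 // mul0r. Qed.

Lemma step_eq1 t : 1 <= t -> step t = 1.
Proof.
move=> t1; rewrite /step (@flat_le0 0 (1 - t)) ?subr_le0 // addr0 divff //.
by rewrite gt_eqF // flat0_gt0 // (lt_le_trans ltr01).
Qed.

Section plateau.
Variable n : nat.
Local Notation X := 'rV[R]_n.

Lemma smooth_step (a s : R) (j : 'I_n) : smooth (fun x : X => step (a + s * x 0 j)).
Proof.
move=> k; apply: class_CM; first exact: class_C_flat.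
apply: class_CV => [x|]; first by rewrite gt_eqF // step_den.
apply: class_CD; first exact: class_C_flat.
have -> : (fun x : X => flat 0 (1 - (a + s * x 0 j))) =
    (fun x : X => flat 0 ((1 - a) + (- s) * x 0 j)).
  by apply/funext => x; congr flat; ring.
exact: class_C_flat.
Qed.

(** A product over coordinates suits the sup norm: the value is 1 on the cube of radius [e] about
    [a] and 0 off the cube of radius [2 * e]. *)
Definition plateau (a : X) (e : R) (x : X) : R :=
  \prod_(j < n) (step (2 - (x 0 j - a 0 j) / e) * step (2 + (x 0 j - a 0 j) / e)).

Lemma smooth_plateau a e : smooth (plateau a e).
Proof.
apply: smooth_prod => j; apply: smoothM.
  have -> : (fun x : X => step (2 - (x 0 j - a 0 j) / e)) =
      (fun x : X => step ((2 + a 0 j / e) + (- e^-1) * x 0 j)).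
    by apply/funext => x; congr step; ring.
  exact: smooth_step.
have -> : (fun x : X => step (2 + (x 0 j - a 0 j) / e)) =
    (fun x : X => step ((2 - a 0 j / e) + e^-1 * x 0 j)).
  by apply/funext => x; congr step; ring.
exact: smooth_step.
Qed.

Lemma plateau_ge0 a e x : 0 <= plateau a e x.
Proof. by apply: prodr_ge0 => j _; rewrite mulr_ge0 // step_ge0. Qed.

Lemma plateau_le1 a e x : plateau a e x <= 1.
Proof.
apply: prodr_ile1 => j _; rewrite mulr_ge0 ?step_ge0 //=.
by rewrite mulr_ile1 ?step_ge0 ?step_le1.
Qed.

Lemma plateau_eq1 a e x : 0 < e -> ball a e x -> plateau a e x = 1.
Proof.
move=> e0 /(ball_rVE _ _ e0) h; apply: big1 => j _.
have hj := h j.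
have : `|(x 0 j - a 0 j) / e| <= 1.
  rewrite normrM distrC normfV (gtr0_norm e0) ler_pdivrMr // mul1r.
  exact: ltW.
rewrite ler_norml => /andP[h1 h2].
by rewrite !step_eq1 ?mulr1 //; lra.
Qed.

Lemma plateau_eq0 a e x : 0 < e -> ~ ball a (2 * e) x -> plateau a e x = 0.
Proof.
move=> e0 nb.
have [j hj] : exists j, 2 * e <= `|a 0 j - x 0 j|.
  apply: contrapT => /forallNP h; apply: nb; apply/ball_rVE; first by rewrite mulr_gt0.
  by move=> j; have /negP := h j; rewrite -ltNge.
apply/eqP; rewrite prodf_seq_eq0; apply/hasP; exists j; first exact: mem_index_enum.
have : 2 <= `|(x 0 j - a 0 j) / e|.
  by rewrite normrM distrC normfV (gtr0_norm e0) ler_pdivlMr.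
rewrite /= ler_normr => /orP[h|h].
  by rewrite step_eq0 ?mul0r ?eqxx //; lra.
by rewrite [X in _ * X]step_eq0 ?mulr0 ?eqxx //; lra.
Qed.

Lemma plateau_even e x : plateau 0 e (- x) = plateau 0 e x.
Proof.
apply: eq_bigr => j _; rewrite !mxE !subr0 mulNr opprK mulrC; congr (_ * _).
Qed.

End plateau.

End bump.

Lemma summ_indic d (T : measurableType d) (R : realType)
  (mu : {measure set T -> \bar R}) (B : set T) :
  measurable B -> (mu B < +oo)%E -> summ mu (\1_B : T -> R).
Proof.
move=> mB Bfin; apply/integrableP; split; first exact/measurable_EFinP.
rewrite (eq_integral (fun x => (\1_B x)%:E)); last first.
  by move=> t _; rewrite /= ger0_norm.
by rewrite integral_indic // setIT.
Qed.

(** * Test functions, cutoffs and exhaustions *)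

Section test_functions.
Context {R : realType} {n : nat}.
Local Notation X := 'rV[R]_n.
Implicit Types (f g phi psi : X -> R) (j : 'I_n) (Omega K : set X).

Lemma hausdorff_rV : hausdorff_space X.
Proof. exact: norm_hausdorff. Qed.

Lemma compact_closed_rV K : compact K -> closed K.
Proof. exact: (compact_closed hausdorff_rV). Qed.

(** Any compact set off which the function vanishes may replace the closure of the support; this
    form is stable under sums, products and derivatives. *)
Lemma test_functionP Omega phi : test_function Omega phi <->
  smooth phi /\ exists K, [/\ compact K, K `<=` Omega & forall x, ~ K x -> phi x = 0].
Proof.
split=> [[h1 h2 h3]|[h1 [K [cK KO hK]]]].
  split=> //; exists (closure [set x | phi x != 0]); split=> // x hx.
  by apply/eqP/negPn/negP => h; apply: hx; exact: subset_closure.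
have sK : closure [set x | phi x != 0] `<=` K.
  have /closure_id -> := compact_closed_rV cK.
  by apply: closure_subset => x /= /eqP h; apply: contrapT => /hK.
split=> //; last exact: subset_trans sK KO.
by apply: (subclosed_compact _ cK sK); exact: closed_closure.
Qed.

Lemma test_smooth Omega phi : test_function Omega phi -> smooth phi.
Proof. by move=> /test_functionP[]. Qed.

Lemma partial_eq0 K phi j x : closed K -> (forall x, ~ K x -> phi x = 0) ->
  ~ K x -> partial j phi x = 0.
Proof.
move=> cK h nKx.
have E : {near x, (fun=> 0) =1 phi}.
  have : nbhs x (~` K) by apply: open_nbhs_nbhs; split=> //; exact: closed_openC.
  by apply: filterS => y /h ->.
by rewrite /partial -(near_eq_derive _ E) derive_cst.
Qed.

Lemma test_subset Omega Omega' phi : Omega `<=` Omega' ->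
  test_function Omega phi -> test_function Omega' phi.
Proof.
move=> OO /test_functionP[h [K [cK KO hK]]]; apply/test_functionP; split=> //.
by exists K; split=> //; exact: subset_trans KO OO.
Qed.

Lemma test0 Omega : test_function Omega (fun _ : X => 0).
Proof.
apply/test_functionP; split; first exact: smooth_cst.
by exists set0; split=> //; exact: compact0.
Qed.

Lemma testM Omega phi g : test_function Omega phi -> smooth g ->
  test_function Omega (fun x => phi x * g x).
Proof.
move=> /test_functionP[h [K [cK KO hK]]] hg; apply/test_functionP.
split; first exact: smoothM.
by exists K; split=> // x /hK ->; rewrite mul0r.
Qed.

Lemma testMr Omega phi g : test_function Omega phi -> smooth g ->
  test_function Omega (fun x => g x * phi x).
Proof.
move=> h hg; have -> : (fun x => g x * phi x) = (fun x => phi x * g x).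
  by apply/funext => x; rewrite mulrC.
exact: testM.
Qed.

Lemma testZ Omega a phi : test_function Omega phi ->
  test_function Omega (fun x => a * phi x).
Proof. by move=> h; apply: testMr => //; exact: smooth_cst. Qed.

Lemma testD Omega phi psi : test_function Omega phi -> test_function Omega psi ->
  test_function Omega (fun x => phi x + psi x).
Proof.
move=> /test_functionP[h [K [cK KO hK]]] /test_functionP[h' [K' [cK' KO' hK']]].
apply/test_functionP; split; first exact: smoothD.
exists (K `|` K'); split; first exact: compactU.
  by move=> x [/KO|/KO'].
by move=> x /not_orP[/hK -> /hK' ->]; rewrite addr0.
Qed.

Lemma test_partial Omega phi j : test_function Omega phi ->
  test_function Omega (partial j phi).
Proof.
move=> /test_functionP[h [K [cK KO hK]]]; apply/test_functionP.
split; first exact: smooth_partial.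
exists K; split=> // x; apply: partial_eq0 => //.
exact: compact_closed_rV.
Qed.

Lemma smooth_measurable f : smooth f -> measurable_fun setT f.
Proof. by move=> h; apply: continuous_measurable_rV; exact: smooth_continuous. Qed.

Lemma continuous_bounded_compact K f : compact K -> continuous f ->
  exists M : R, 0 < M /\ forall x, K x -> `|f x| <= M.
Proof.
move=> cK cf.
have : compact (f @` K).
  by apply: continuous_compact => //; exact: continuous_subspaceT.
move=> /compact_bounded [M [_ hM]]; exists (`|M| + 1); split.
  by rewrite ltr_wpDl.
move=> x Kx; apply: (hM (`|M| + 1)); last by exists x.
by rewrite (le_lt_trans (ler_norm M)) // ltrDl.
Qed.

Lemma test_bounded Omega phi : test_function Omega phi ->
  exists M : R, 0 < M /\ forall x, `|phi x| <= M.
Proof.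
move=> /test_functionP[h [K [cK KO hK]]].
have [M [M0 hM]] := continuous_bounded_compact cK (smooth_continuous h).
exists M; split=> // x; have [/hM //|/hK ->] := pselect (K x).
by rewrite normr0 ltW.
Qed.

Lemma bounded_set_ball K : bounded_set K -> exists r : R, 0 < r /\ K `<=` ball 0 r.
Proof.
move=> [M [_ hM]]; exists (`|M| + 2); split; first by rewrite ltr_wpDl.
move=> x Kx; rewrite -ball_normE /= sub0r normrN.
have := hM (`|M| + 1); rewrite (le_lt_trans (ler_norm M)) ?ltrDl //.
by move=> /(_ erefl x Kx) /le_lt_trans; apply; rewrite ltrD2l ltr1n.
Qed.

Lemma le_indic (M : R) f (B : set X) x : (forall x, `|f x| <= M) ->
  (~ B x -> f x = 0) -> `|f x| <= M * \1_B x.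
Proof.
move=> fM f0; rewrite indicE; have [xb|xb] := boolP (x \in B); first by rewrite mulr1.
by rewrite f0 ?normr0 ?mulr0 //; move: xb; rewrite notin_setE.
Qed.

Lemma summ_bounded_support (M r : R) f : measurable_fun setT f ->
  (forall x, `|f x| <= M) -> (forall x, ~ ball 0 r x -> f x = 0) ->
  summ (leb n) f.
Proof.
move=> mf fM f0.
have mB : measurable (ball (0 : X) r) by exact: measurable_fun_ballrV.
apply: (le_summ (g := fun x => M * \1_(ball (0 : X) r) x)) => //.
  by move=> x; apply: le_indic => //; exact: f0.
apply: summZ; apply: summ_indic => //.
exact: leb_ball_fin.
Qed.

Lemma test_support_ball Omega phi : test_function Omega phi ->
  exists r : R, 0 < r /\ forall x, ~ ball 0 r x -> phi x = 0.
Proof.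
move=> /test_functionP[h [K [cK KO hK]]].
have [r [r0 Kr]] := bounded_set_ball (compact_bounded cK).
by exists r; split=> // x hx; apply: hK => /Kr.
Qed.

Lemma test_summ Omega phi : test_function Omega phi -> summ (leb n) phi.
Proof.
move=> hphi; have [M [_ hM]] := test_bounded hphi.
have [r [_ hr]] := test_support_ball hphi.
apply: (summ_bounded_support _ hM hr).
exact: smooth_measurable (test_smooth hphi).
Qed.

Lemma is_derive_line phi j (x : X) (t : R) : smooth phi ->
  is_derive t (1 : R) (fun t => phi (t *: delta_mx 0 j + x))
    (partial j phi (t *: delta_mx 0 j + x)).
Proof.
move=> h; set e := delta_mx 0 j.
have H : h^-1 *: (((fun t => phi (t *: e + x)) \o shift t) (h *: (1 : R)) -
    phi (t *: e + x)) @[h --> (0 : R)^'] --> partial j phi (t *: e + x).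
  have := smooth_derivable (j := j) (x := t *: e + x) h.
  apply: cvg_trans; apply: near_eq_cvg; near=> k.
  congr (_ *: (phi _ - _)); rewrite /=.
  by rewrite (_ : k%:A = k) ?scalerDl ?addrA // /GRing.scale /= mulr1.
by apply: DeriveDef; [apply/cvg_ex; eexists; exact: H|apply/cvg_lim].
Unshelve. all: end_near. Qed.

Lemma smooth_increment phi j (M : R) (x : X) (t : R) : smooth phi ->
  (forall x, `|partial j phi x| <= M) ->
  0 <= t -> `|phi (t *: delta_mx 0 j + x) - phi x| <= M * t.
Proof.
move=> h hM t0; set e := delta_mx 0 j.
have D s := is_derive_line j x s h.
have cts : {within `[0, t], continuous (fun t => phi (t *: e + x))}.
  apply: continuous_subspaceT => s; apply: differentiable_continuous.
  by apply/derivable1_diffP; have [] := D s.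
have [c _ E] := MVT_segment t0 (fun s _ => D s) cts.
move: E; rewrite scale0r add0r subr0 => ->.
by rewrite normrM (ger0_norm t0) ler_wpM2r.
Qed.

(* Difference quotients have vanishing integral by translation invariance. *)
Lemma Rint_partial_eq0 Omega phi j : test_function Omega phi ->
  \int[leb n]_x partial j phi x = 0.
Proof.
move=> tphi; have sphi := test_smooth tphi.
have [M [M0 hM]] := test_bounded (test_partial j tphi).
have /test_functionP[_ [K [cK _ hK]]] := tphi.
have [r [r0 Kr]] := bounded_set_ball (compact_bounded cK).
(* The increments [k.+1%:R^-1] are at most 1, so this one ball carries all the difference
   quotients. *)
pose B := ball (0 : X) (r + 1).
have dphi0 x : ~ B x -> partial j phi x = 0.
  move=> nb; apply: (partial_eq0 _ (compact_closed_rV cK) hK) => /Kr h.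
  by apply: nb; apply: le_ball h; rewrite lerDl.
pose e : X := delta_mx 0 j.
pose dk k x := k.+1%:R * (phi (k.+1%:R^-1 *: e + x) - phi x).
have mphi := smooth_measurable sphi.
have mdk k : measurable_fun setT (dk k).
  apply: measurable_funM => //; apply: measurable_funB => //.
  exact: measurable_translate.
have dkM k x : `|dk k x| <= M.
  rewrite normrM ger0_norm // -ler_pdivlMl // mulrC.
  by apply: smooth_increment => //; rewrite invr_ge0.
have k1 k : 0 < (k.+1%:R^-1 : R) <= 1 by rewrite invr_gt0 ltr0n /= invf_le1 // ler1n.
have dk0 k x : ~ B x -> dk k x = 0.
  move=> nb.
  have h1 : phi x = 0.
    by apply: hK => /Kr h; apply: nb; apply: le_ball h; rewrite lerDl.
  have h2 : phi (k.+1%:R^-1 *: e + x) = 0.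
    apply: hK => /Kr /(ball_rVE _ _ r0) h; apply: nb.
    apply/ball_rVE; rewrite ?addr_gt0 // => i; have := h i; rewrite !mxE eqxx /= => hi.
    have -> : 0 - x 0 i = (0 - (k.+1%:R^-1 * (i == j)%:R + x 0 i)) +
      k.+1%:R^-1 * (i == j)%:R by ring.
    apply: (le_lt_trans (ler_normD _ _)); apply: ltr_leD => //.
    have /andP[/ltW k0 k1'] := k1 k.
    by rewrite normrM normr_nat ger0_norm //; case: (_ == _); rewrite ?mulr1 ?mulr0.
  by rewrite /dk h1 h2 subrr mulr0.
have ck x : dk k x @[k --> \oo] --> partial j phi x.
  have D : h^-1 * (phi (h *: e + x) - phi x) @[h --> (0 : R)^'] --> partial j phi x.
    exact: (smooth_derivable (j := j) (x := x) sphi).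
  have := (cvgr_dnbhsP (fun h => h^-1 * (phi (h *: e + x) - phi x)) 0 (partial j phi x)).1 D.
  move=> /(_ (fun k => k.+1%:R^-1)) H.
  have {}H := H (conj _ _); apply: cvg_trans (H _ _) => [|k|]; last exact: cvg_harmonic.
    by apply: near_eq_cvg; near=> k; rewrite /dk /= invrK.
  by rewrite gt_eqF //; have /andP[] := k1 k.
have gs : summ (leb n) (fun x => M * \1_B x).
  apply: summZ; apply: summ_indic => //.
    exact: measurable_fun_ballrV.
  exact: leb_ball_fin.
have dg k x : `|dk k x| <= M * \1_B x.
  by apply: le_indic => //; exact: dk0.
have := Rint_dominated mdk (smooth_measurable (smooth_partial j sphi)) ck gs dg.
have -> : (fun k => \int[leb n]_x dk k x) = (fun=> 0).
  apply/funext => k.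
  have sp := test_summ tphi.
  rewrite /dk RintZ; last by apply: summB => //; exact: summ_translate.
  by rewrite RintB ?Rint_translate ?subrr ?mulr0 //; exact: summ_translate.
by move=> /(cvg_lim (@Rhausdorff R)) <-; rewrite lim_cst.
Unshelve. all: end_near. Qed.

Lemma Rint_by_parts Omega phi psi j : smooth phi -> test_function Omega psi ->
  \int[leb n]_x (phi x * partial j psi x) = - \int[leb n]_x (partial j phi x * psi x).
Proof.
move=> sphi tpsi; apply/eqP; rewrite -addr_eq0; apply/eqP.
have t1 := testMr (test_partial j tpsi) sphi.
have t2 := testMr tpsi (smooth_partial j sphi).
rewrite -RintD; [|exact: test_summ t1|exact: test_summ t2].
rewrite -(Rint_partial_eq0 j (testMr tpsi sphi)); apply: eq_Rintegral => x _.
rewrite partialM ?(mulrC (psi x)) //; apply: smooth_derivable => //.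
exact: test_smooth tpsi.
Qed.

Lemma bounded_subset (A B : set X) : A `<=` B -> bounded_set B -> bounded_set A.
Proof.
by move=> AB [M [Mr hM]]; exists M; split=> // N hN x /AB; exact: hM.
Qed.

Lemma plateau_test (U : set X) (a : X) (e : R) : 0 < e -> ball a (3 * e) `<=` U ->
  test_function U (plateau a e).
Proof.
move=> e0 h; apply/test_functionP; split; first exact: smooth_plateau.
have e20 : 0 < 2 * e by rewrite mulr_gt0.
exists (closed_ball a (2 * e)); split.
- apply: bounded_closed_compact; last exact: closed_ball_closed.
  exists (`|a| + 2 * e); split; first exact: num_real.
  move=> N hN x; rewrite closed_ballE // => hx.
  apply: le_trans (ltW hN); rewrite -[x in X in X <= _](subrK a) addrC.
  by rewrite (le_trans (ler_normD _ _)) // lerD2l distrC.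
- move=> x; rewrite closed_ballE // => hx; apply: h.
  rewrite -ball_normE /=; apply: le_lt_trans hx _.
  by rewrite ltr_pM2r // ltr_nat.
- by move=> x hx; apply: plateau_eq0 => // /subset_closed_ball.
Qed.

(** The value 1 is taken on an open neighbourhood [W] of [K], and not only on [K], so that the
    derivatives of the cutoff vanish on [K]. *)
Lemma cutoff (K U : set X) : compact K -> open U -> K `<=` U ->
  exists (phi : X -> R) (W : set X),
    [/\ test_function U phi, forall x, 0 <= phi x <= 1, open W, K `<=` W &
        forall x, W x -> phi x = 1].
Proof.
move=> cK oU KU.
have /choice[e he] (x : X) : exists e : R, 0 < e /\ (U x -> ball x (3 * e) `<=` U).
  have [Ux|] := pselect (U x); last by exists 1.
  have /nbhs_ballP[e /= e0 eU] : nbhs x U by exact: open_nbhs_nbhs.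
  exists (e / 3); split; first by rewrite divr_gt0.
  by rewrite mulrC divfK.
move: cK; rewrite compact_cover => /(_ X K (fun x => ball x (e x))).
case=> [x _|x Kx|D' DK KD].
- exact: ball_open.
- by exists x => //; apply: ballxx; have [] := he x.
have [phi [tphi phi01 phi1]] : exists phi : X -> R,
    [/\ test_function U phi, forall x, 0 <= phi x <= 1 &
      forall i, i \in finmap.enum_fset D' -> forall x, ball i (e i) x -> phi x = 1].
  have : {subset finmap.enum_fset D' <= K} by [].
  elim: (finmap.enum_fset D') => [|i s IH] sK.
    exists (fun=> 0); split=> //; first exact: test0.
    by move=> x; rewrite lexx ler01.
  have [|phi [tphi phi01 phi1]] := IH.
    by move=> y ys; apply: sK; rewrite inE ys orbT.
  have Ki : K i by have := sK i; rewrite !inE eqxx; apply.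
  have [ei hi] := he i.
  have tp := plateau_test ei (hi (KU _ Ki)).
  (* This is 1 minus the product of [1 - phi] and [1 - plateau]: it stays between 0 and 1 and is 1
     wherever one of the two functions is. *)
  exists (fun x => phi x + (-1) * (phi x * plateau i (e i) x) + plateau i (e i) x).
  split.
  - apply: testD => //; apply: testD => //; apply: testZ; apply: testM => //.
    exact: smooth_plateau.
  - move=> x; have /andP[a0 a1] := phi01 x.
    have b0 := plateau_ge0 i (e i) x; have b1 := plateau_le1 i (e i) x.
    by apply/andP; split; nra.
  - move=> y; rewrite inE => /orP[/eqP ->|ys] x hx.
      by rewrite (plateau_eq1 _ hx) //; ring.
    by rewrite (phi1 _ ys _ hx); ring.
exists phi, (\bigcup_(i in [set` finmap.enum_fset D']) ball i (e i)); split=> //.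
- by apply: bigcup_open => i _; exact: ball_open.
- by move=> x [i iD hx]; exact: (phi1 i).
Qed.

(** The k-th cutoff is 1 on the points whose ball of radius [k.+1%:R^-1] lies in [U]. These form a
    closed set, because the complement is a union of balls centred outside [U]. *)
Lemma exhaustion (U : set X) : bounded_set U -> open U ->
  exists theta : nat -> X -> R,
    [/\ forall k, test_function U (theta k), forall k x, 0 <= theta k x <= 1 &
      forall x, U x -> exists N, forall k, (N <= k)%N -> theta k x = 1].
Proof.
move=> bU oU.
pose K k := [set x : X | ball x k.+1%:R^-1 `<=` U].
have k0 k : 0 < k.+1%:R^-1 :> R by rewrite invr_gt0.
have KU k : K k `<=` U by move=> x; apply; exact: ballxx.
have cK k : compact (K k).
  apply: bounded_closed_compact; first exact: bounded_subset (KU k) bU.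
  rewrite -[K k]setCK; apply: open_closedC.
  have -> : ~` K k = \bigcup_(y in ~` U) ball y k.+1%:R^-1.
    apply/seteqP; split=> [x|x [y nUy yx] h].
      move=> /existsNP[y] /not_implyP[xy nUy]; exists y => //; exact: ball_sym.
    by apply: nUy; apply: h; exact: ball_sym.
  by apply: bigcup_open => y _; exact: ball_open.
have /choice[theta ht] k : exists phi : X -> R,
    [/\ test_function U phi, forall x, 0 <= phi x <= 1 & forall x, K k x -> phi x = 1].
  have [phi [W [h1 h2 _ h3 h4]]] := cutoff (cK k) oU (@KU k).
  by exists phi; split=> // x /h3; exact: h4.
exists theta; split=> [k|k x|x Ux]; [by have [] := ht k|by have [] := ht k|].
have /nbhs_ballP[e /= e0 eU] : nbhs x U by exact: open_nbhs_nbhs.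
have [N hN] : exists N : nat, (N.+1%:R^-1 : R) < e.
  by have /ltr_add_invr[N] := e0; rewrite add0r; exists N.
exists N => k Nk; have [_ _] := ht k; apply.
move=> y xy; apply: eU; apply: le_ball xy; apply: le_trans (ltW hN).
by rewrite lef_pV2 ?posrE // ler_nat.
Qed.

End test_functions.

Import HBSimple HBNNSimple.
(** * Translation and mollification *)

Section square_integrable.
Context d (T : measurableType d) (R : realType) (mu : {measure set T -> \bar R}).
Implicit Types f g : T -> R.

Definition sqsumm f := measurable_fun setT f /\ summ mu (fun x => f x ^+ 2).

Lemma sqsummM f g : sqsumm f -> sqsumm g -> summ mu (fun x => f x * g x).
Proof.
move=> [mf hf] [mg hg].
apply: (le_summ (g := fun x => f x ^+ 2 + g x ^+ 2)).
- exact: measurable_funM.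
- move=> x; rewrite ler_norml; apply/andP; split; nra.
- exact: summD.
Qed.

Lemma sqsummD f g : sqsumm f -> sqsumm g -> sqsumm (fun x => f x + g x).
Proof.
move=> hf hg; have [mf sf] := hf; have [mg sg] := hg.
split; first exact: measurable_funD.
have := summD (summD sf (summZ 2 (sqsummM hf hg))) sg.
by apply: eq_summ => x; ring.
Qed.

Lemma sqsummZ a f : sqsumm f -> sqsumm (fun x => a * f x).
Proof.
move=> [mf sf]; split; first exact: measurable_funM.
by apply: eq_summ (summZ (a ^+ 2) sf) => x; rewrite exprMn.
Qed.

Lemma sqsummM_bounded (M : R) f g : measurable_fun setT g ->
  (forall x, `|g x| <= M) -> sqsumm f -> sqsumm (fun x => f x * g x).
Proof.
move=> mg gM [mf sf]; split; first exact: measurable_funM.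
have := summM_bounded (M := M ^+ 2) (g := fun x => g x ^+ 2) _ _ sf.
move=> h; have {}h := h (measurable_funX _ mg) _.
apply: eq_summ (h _) => x; first by rewrite exprMn.
by rewrite normrX lerXn2r ?nnegrE // (le_trans _ (gM x)).
Qed.

(* AM-GM form of Cauchy-Schwarz *)
Lemma Rint_amgm (s : R) f g : 0 < s -> sqsumm f -> sqsumm g ->
  `|\int[mu]_x (f x * g x)| <=
    s * \int[mu]_x (f x ^+ 2) + s^-1 * \int[mu]_x (g x ^+ 2).
Proof.
move=> s0 hf hg; have [mf sf] := hf; have [mg sg] := hg.
rewrite -!RintZ // -RintD; [|exact: summZ|exact: summZ].
apply: le_normr_Rint; first exact: sqsummM.
  by apply: summD; exact: summZ.
move=> x.
have e : s * f x ^+ 2 + s^-1 * g x ^+ 2 =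
    s^-1 * ((s * f x) ^+ 2 + g x ^+ 2).
  by rewrite exprMn mulrDr expr2 !mulrA mulVf ?gt_eqF // mul1r.
rewrite e ler_pdivlMl // -[X in X * _](gtr0_norm s0) -normrM mulrA ler_norml.
by apply/andP; split; nra.
Qed.

Lemma Lfun2_sqsumm f : f \in Lfun mu 2%:E -> sqsumm f.
Proof.
move=> hf; split; last exact: Lfun2_integrable_sqr hf.
by move: hf; rewrite inE => /andP[/[!inE]/= mf _].
Qed.

Lemma Lfun1_summ f : f \in Lfun mu 1%:E -> summ mu f.
Proof. by move=> /Lfun1_integrable. Qed.

End square_integrable.

Arguments sqsumm {d T R} mu f.

(** * Continuity of translation in the mean *)

Section continuity_of_translation.
Context {R : realType} {n : nat}.
Local Notation X := 'rV[R]_n.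
Local Notation leb := (leb n).

Lemma cvg_approx (u : nat -> R) (l : R) :
  (forall e, 0 < e -> exists2 v : nat -> R, exists2 l' : R,
     v k @[k --> \oo] --> l' & `|l' - l| <= e & forall k, `|u k - v k| <= e) ->
  u k @[k --> \oo] --> l.
Proof.
move=> H; apply/cvgrPdist_le => e e0.
have e30 : 0 < e / 3 by rewrite divr_gt0.
have [v [l' cv l'l] uv] := H _ e30.
move/cvgrPdist_le : cv => /(_ _ e30); apply: filterS => k hk.
have -> : l - u k = - (l' - l) + (l' - v k) + - (u k - v k) by ring.
have -> : e = e / 3 + e / 3 + e / 3 by field.
apply: (le_trans (ler_normD _ _)); apply: lerD; last by rewrite normrN.
by apply: (le_trans (ler_normD _ _)); apply: lerD => //; rewrite normrN.
Qed.

Lemma cvgn_sub0 (u v : nat -> R) (l : R) :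
  u k - v k @[k --> \oo] --> 0 -> v k @[k --> \oo] --> l -> u k @[k --> \oo] --> l.
Proof.
move=> uv vl; have -> : u = (fun k => (u k - v k) + v k).
  by apply/funext => k; rewrite subrK.
by rewrite -[l]add0r; exact: cvgD.
Qed.

Section bounded_left.
Variables (y : nat -> X) (h : X -> R) (M : R).
Hypotheses (y0 : y k @[k --> \oo] --> (0 : X)) (mh : measurable_fun setT h)
  (M0 : 0 < M) (hM : forall x, `|h x| <= M).

(** Continuity of translation, tested against the bounded function [h]. The class of such [g]
    contains the open sets of finite measure; Dynkin induction adds the Borel subsets of a ball, and
    L^1 limits of simple functions add everything summable. *)
Let good (g : X -> R) := \int[leb]_x (h x * g (y k + x)) @[k --> \oo]
  --> \int[leb]_x (h x * g x).

Let sh g : summ leb g -> summ leb (fun x => h x * g x).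
Proof.
move=> sg; apply: eq_summ (summM_bounded mh hM sg) => x; exact: mulrC.
Qed.

(** Translation preserves L^1 distances, so the error of replacing [g] by [g'] is the same for all
    translates. *)
Let good_lim (g : X -> R) : summ leb g ->
  (forall e, 0 < e -> exists2 g', summ leb g' /\ good g' &
     \int[leb]_x `|g x - g' x| <= e) -> good g.
Proof.
move=> sg H; apply: cvg_approx => e e0.
have [g' [sg' gg'] dg'] := H (e / M) (divr_gt0 e0 M0).
have D a : `|\int[leb]_x (h x * g (a + x)) - \int[leb]_x (h x * g' (a + x))| <= e.
  rewrite -RintB; [|by apply: sh; exact: summ_translate..].
  have sB : summ leb (fun x => g x - g' x) by exact: summB.
  have sN := summ_norm sB.
  apply: (@le_trans _ _ (\int[leb]_x (M * `|g (a + x) - g' (a + x)|))).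
    apply: le_normr_Rint.
    - by apply: summB; apply: sh; exact: summ_translate.
    - by apply: summZ; exact: (summ_translate a sN).
    - by move=> x; rewrite -mulrBr normrM ler_wpM2r.
  rewrite RintZ; last exact: (summ_translate a sN).
  rewrite (Rint_translate a (f := fun x => `|g x - g' x|)); last exact: summ_measurable sN.
  by rewrite mulrC -ler_pdivlMr.
exists (fun k => \int[leb]_x (h x * g' (y k + x))); last by move=> k; exact: D.
exists (\int[leb]_x (h x * g' x)) => //.
have := D 0; rewrite distrC; congr (`|_ - _| <= _);
  by apply: eq_Rintegral => x _; rewrite add0r.
Qed.

Let goodD g g' : summ leb g -> summ leb g' -> good g -> good g' ->
  good (fun x => g x + g' x).
Proof.
move=> sg sg' Gg Gg'; rewrite /good.
have E a : \int[leb]_x (h x * (g (a + x) + g' (a + x))) =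
    \int[leb]_x (h x * g (a + x)) + \int[leb]_x (h x * g' (a + x)).
  rewrite -RintD; [|by apply: sh; exact: summ_translate..].
  by apply: eq_Rintegral => x _; rewrite mulrDr.
under eq_cvg do rewrite E.
have -> : \int[leb]_x (h x * (g x + g' x)) =
    \int[leb]_x (h x * g x) + \int[leb]_x (h x * g' x).
  rewrite -RintD; [|exact: sh..].
  by apply: eq_Rintegral => x _; rewrite mulrDr.
exact: cvgD.
Qed.

Let goodZ c g : summ leb g -> good g -> good (fun x => c * g x).
Proof.
move=> sg Gg; rewrite /good.
have E a : \int[leb]_x (h x * (c * g (a + x))) = c * \int[leb]_x (h x * g (a + x)).
  rewrite -RintZ; last by apply: sh; exact: summ_translate.
  by apply: eq_Rintegral => x _; rewrite mulrCA.
under eq_cvg do rewrite E.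
have -> : \int[leb]_x (h x * (c * g x)) = c * \int[leb]_x (h x * g x).
  rewrite -RintZ; last exact: sh.
  by apply: eq_Rintegral => x _; rewrite mulrCA.
by apply: cvgM => //; exact: cvg_cst.
Qed.

Let good0 : good (fun=> 0).
Proof.
rewrite /good; under eq_cvg do under eq_Rintegral do rewrite mulr0.
by under eq_Rintegral do rewrite mulr0; exact: cvg_cst.
Qed.

Let good_sum (I : Type) (s : seq I) (F : I -> X -> R) :
  (forall i, summ leb (F i)) -> (forall i, good (F i)) ->
  good (fun x => \sum_(i <- s) F i x).
Proof.
move=> sF gF; elim: s => [|i s IH].
  by under eq_fun do rewrite big_nil; exact: good0.
under eq_fun do rewrite big_cons.
by apply: goodD => //; exact: summ_sum.
Qed.

(** As [U] is open, a point of [U] stays in [U] under small translations, so the overlap of [U] with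
    its translates tends to [U]. The translates have the same measure as [U], hence what they carry
    outside [U] has vanishing measure. *)
Let good_open (U : set X) : open U -> (leb U < +oo)%E -> good (\1_U).
Proof.
move=> oU Ufin.
have mU := open_measurable_rV oU.
have sU : summ leb (\1_U : X -> R) by exact: summ_indic.
have mI : measurable_fun setT (\1_U : X -> R) by exact: measurable_indic.
have mIk (a : X) : measurable_fun setT (fun x : X => \1_U (a + x) : R).
  exact: measurable_translate.
have I1 x : `|\1_U x : R| <= 1 by rewrite indicE normr_nat; case: (_ \in _).
have ck x : \1_U x * \1_U (y k + x) @[k --> \oo] --> (\1_U x : R).
  have [xU|xU] := boolP (x \in U); last first.
    rewrite indicE (negbTE xU); apply: cvg_near_cst.
    by near=> k; rewrite mul0r.
  apply: cvg_near_cst; near=> k.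
  rewrite !indicE xU mul1r (_ : (y k + x \in U) = true) //.
  apply/mem_set; near: k.
  have : y k + x @[k --> \oo] --> (0 + x : X) by apply: cvgD => //; exact: cvg_cst.
  rewrite add0r; apply; apply: open_nbhs_nbhs; split=> //; exact: set_mem.
have lim1 (g : X -> R) N : measurable_fun setT g -> (forall x, `|g x| <= N) ->
    \int[leb]_x (g x * (\1_U x * \1_U (y k + x))) @[k --> \oo] -->
    \int[leb]_x (g x * \1_U x).
  move=> mg gN; apply: (@Rint_dominated _ _ _ leb _ _ (fun x => N * \1_U x)).
  - move=> k; apply: measurable_funM => //; apply: measurable_funM => //.
  - exact: measurable_funM.
  - by move=> x; apply: cvgM; [exact: cvg_cst|exact: ck].
  - exact: summZ.
  - move=> k x; rewrite normrM ler_pM // normrM (ger0_norm (_ : 0 <= \1_U x)) //.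
    by rewrite ler_piMr.
have L1 := lim1 _ _ mh hM.
have L2 := lim1 (fun=> 1) 1 (measurable_cst _) _.
have {L2} : \int[leb]_x (\1_U x * \1_U (y k + x)) @[k --> \oo] --> \int[leb]_x (\1_U x : R).
  have := L2 _; under eq_cvg do under eq_Rintegral do rewrite mul1r.
  by under eq_Rintegral do rewrite mul1r; apply=> x; rewrite normr1.
move=> L2; rewrite /good.
have S k : summ leb (fun x => \1_U x * \1_U (y k + x) : R).
  apply: (summM_bounded (M := 1)) => //.
have D k : `|\int[leb]_x (h x * \1_U (y k + x)) -
    \int[leb]_x (h x * (\1_U x * \1_U (y k + x)))| <=
    M * (\int[leb]_x (\1_U x : R) - \int[leb]_x (\1_U x * \1_U (y k + x))).
  have sUk := summ_translate (y k) sU.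
  rewrite -{1}(Rint_translate (y k) mI) -!RintB //; [|exact: sh..].
  rewrite -RintZ; last exact: summB.
  apply: le_normr_Rint; first by apply: summB; exact: sh.
    by apply: summZ; exact: summB.
  move=> x; rewrite -mulrBr normrM ler_pM // ger0_norm // subr_ge0.
  by rewrite ler_piMl // !indicE; case: (_ \in _).
have L3 : \int[leb]_x (h x * \1_U (y k + x)) -
    \int[leb]_x (h x * (\1_U x * \1_U (y k + x))) @[k --> \oo] --> (0 : R).
  apply/cvgr0Pnorm_le => e e0.
  have : M * (\int[leb]_x (\1_U x : R) - \int[leb]_x (\1_U x * \1_U (y k + x)))
      @[k --> \oo] --> (0 : R).
    rewrite -(mulr0 M) -(subrr (\int[leb]_x (\1_U x : R))).
    by apply: cvgM; [exact: cvg_cst|apply: cvgB => //; exact: cvg_cst].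
  move=> /cvgr0Pnorm_le /(_ _ e0); apply: filterS => k; apply: le_trans.
  by rewrite (le_trans (D k)) // ler_norm.
exact: (cvgn_sub0 L3 L1).
Unshelve. all: end_near. Qed.

(** Intersecting with [B], of finite measure, keeps complements summable, so that the class of sets
    [F] is a Dynkin class containing the open sets. *)
Let good_setI (B F : set X) : open B -> (leb B < +oo)%E -> measurable F ->
  good (\1_(F `&` B)).
Proof.
move=> oB Bfin; have mB := open_measurable_rV oB.
have IBfin (F' : set X) : measurable F' -> (leb (F' `&` B) < +oo)%E.
  move=> mF; apply: le_lt_trans Bfin; apply: le_measure; rewrite ?inE //.
  exact: measurableI.
have sI (F' : set X) : measurable F' -> summ leb (\1_(F' `&` B) : X -> R).
  by move=> mF; apply: summ_indic; [exact: measurableI|exact: IBfin].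
have gB : good (\1_B) by exact: good_open.
apply: (@dynkin_induction _ X (@open X) (fun F => good (\1_(F `&` B)))) => //.
- exact: openI.
- by rewrite setTI.
- move=> U oU; apply: good_open; first exact: openI.
  by apply: IBfin; exact: open_measurable_rV.
- move=> S mS gS.
  have -> : \1_(~` S `&` B) = (fun x => \1_B x + (-1) * \1_(S `&` B) x) :> (X -> R).
    apply/funext => x; rewrite !indicE !in_setI in_setC.
    by case: (x \in S); case: (x \in B) => /=; ring.
  apply: goodD => //; first exact: summ_indic.
    by apply: summZ; exact: sI.
  by apply: goodZ => //; exact: sI.
- move=> G mG tG gG.
  have mUG : measurable (\bigcup_k G k) by exact: bigcupT_measurable.
  pose P N x : R := \sum_(i < N) \1_(G i `&` B) x.
  have sP N : summ leb (P N) by apply: summ_sum => i _; exact: sI.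
  have P0 N x : (forall i, ~ G i x) -> P N x = 0.
    move=> nG; apply: big1 => i _; rewrite indicE memNset // => -[/nG[]].
  have P1 N i x : G i x -> P N x = (i < N)%:R * \1_B x.
    move=> Gix.
    have ne j : j != i -> ~ G j x.
      by move=> /eqP ji Gjx; apply: ji; apply: (tG j i) => //; exists x.
    have [iN|Ni] := ltnP i N.
      rewrite /P (bigD1 (Ordinal iN)) //= big1 ?addr0 ?mul1r.
        by rewrite !indicE in_setI (mem_set Gix).
      move=> j jN; rewrite indicE memNset // => -[+ _]; apply: ne.
      by move: jN; apply: contraNneq => ji; apply/eqP/val_inj.
    rewrite mul0r; apply: big1 => j _; rewrite indicE memNset // => -[+ _]; apply: ne.
    by apply/eqP => ji; move: (ltn_ord j); rewrite ji ltnNge Ni.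
  apply: good_lim => [|e e0]; first exact: sI.
  have D : \int[leb]_x `|\1_(\bigcup_k G k `&` B) x - P N x| @[N --> \oo] -->
      \int[leb]_x (0 : R).
    apply: (@Rint_dominated _ _ _ leb _ _ (\1_B)).
    - move=> N; apply: measurableT_comp => //; apply: measurable_funB.
        exact: summ_measurable (sI _ mUG).
      exact: summ_measurable (sP N).
    - exact: measurable_cst.
    - move=> x; have [[i _ Gix]|nG] := pselect ((\bigcup_k G k) x).
        apply: cvg_near_cst; near=> N; rewrite (P1 N i) //.
        rewrite indicE in_setI (mem_set (_ : (\bigcup_k G k) x)); last by exists i.
        rewrite (_ : (i < N)%N); last by near: N; exists i.+1.
        by rewrite indicE mul1r subrr normr0.
      apply: cvg_near_cst; near=> N.
      rewrite P0; last by move=> i Gix; apply: nG; exists i.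
      by rewrite subr0 indicE memNset ?normr0 // => -[/nG[]].
    - exact: summ_indic.
    - move=> N x; rewrite normr_id.
      have [[i _ Gix]|nG] := pselect ((\bigcup_k G k) x).
        rewrite (P1 N i) // indicE in_setI (mem_set (_ : (\bigcup_k G k) x)); last by exists i.
        by rewrite indicE; case: (x \in B); case: (i < N)%N;
          rewrite /= ?mulr1 ?mulr0 ?subrr ?subr0 ?normr0 ?normr1.
      rewrite P0 ?subr0; last by move=> i Gix; apply: nG; exists i.
      by rewrite indicE memNset ?normr0 // => -[/nG[]].
  move: D; rewrite Rint0 => /cvgr0Pnorm_le /(_ _ e0) [N _ hN].
  exists (P N); last first.
    by rewrite (le_trans (ler_norm _)) //; apply: hN => /=.
  by split => //; apply: good_sum => i; [exact: sI|exact: gG].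
Unshelve. all: end_near. Qed.

Lemma translate_bounded_cvg (g : X -> R) : summ leb g ->
  \int[leb]_x (h x * g (y k + x)) @[k --> \oo] --> \int[leb]_x (h x * g x).
Proof.
move=> sg; have mg := summ_measurable sg.
pose B k : set X := ball (0 : X) k.+1%:R.
have mB k : measurable (B k) by exact: measurable_fun_ballrV.
have I1 k x : `|\1_(B k) x : R| <= 1 by rewrite indicE normr_nat; case: (_ \in _).
have sgB k : summ leb (fun x => g x * \1_(B k) x).
  by apply: (summM_bounded (M := 1)).
have gB k : good (fun x => g x * \1_(B k) x).
  have /(approximation_sfun_integrable (mB k)) [s_ [si _ sl]] :
    leb.-integrable (B k) (EFin \o g) by apply: integrableS sg.
  have sE j (x : X) : s_ j x * \1_(B k) x =
      \sum_(v <- finmap.enum_fset (fset_set (range (s_ j))))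
        v * \1_(s_ j @^-1` [set v] `&` B k) x.
    rewrite fimfunE fsbig_finite //= mulr_suml; apply: eq_bigr => v _.
    by rewrite -mulrA !indicE in_setI -natrM mulnb.
  have Bfin : (leb (B k) < +oo)%E by exact: leb_ball_fin.
  have sI j v : summ leb (\1_(s_ j @^-1` [set v] `&` B k) : X -> R).
    have mI : measurable (s_ j @^-1` [set v] `&` B k) by exact: measurableI.
    apply: summ_indic => //; apply: le_lt_trans Bfin.
    by apply: le_measure; rewrite ?inE //; apply: subIsetr.
  have ss j : summ leb (fun x => s_ j x * \1_(B k) x).
    have : summ leb (fun x => \sum_(v <- finmap.enum_fset (fset_set (range (s_ j))))
        v * \1_(s_ j @^-1` [set v] `&` B k) x).
      by apply: summ_sum => v _; apply: summZ; exact: sI.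
    by apply: eq_summ => x; rewrite sE.
  apply: good_lim => // e e0.
  have [N hN] : exists N, (\int[leb]_(z in B k) `|(EFin \o g) z - (s_ N z)%:E| < e%:E)%E.
    have : nbhs (0 : \bar R)%E [set x | (x < e%:E)%E].
      by apply: open_nbhs_nbhs; split; [exact: open_ereal_lt_ereal|rewrite /= lte_fin].
    by move=> /sl [N _ hN]; exists N; exact: hN (leqnn N).
  exists (fun x => s_ N x * \1_(B k) x).
    split=> //; under eq_fun do rewrite sE.
    apply: good_sum => v; first by apply: summZ; exact: sI.
    apply: goodZ; first exact: sI.
    by apply: good_setI => //; exact: ball_open.
  rewrite -lee_fin EFin_Rint; last by apply: summ_norm; exact: summB.
  apply: le_trans (ltW hN); rewrite [leRHS]integral_mkcond le_eqVlt; apply/orP; left.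
  apply/eqP; apply: eq_integral => x _; rewrite patchE indicE.
  by case: ifPn => xB; rewrite ?mulr1 ?mulr0 ?subrr ?normr0.
apply: good_lim => // e e0.
have : \int[leb]_x `|g x - g x * \1_(B k) x| @[k --> \oo] --> \int[leb]_x (0 : R).
  apply: (@Rint_dominated _ _ _ leb _ _ (fun x => `|g x|)).
  - move=> k; apply: measurableT_comp => //; apply: measurable_funB => //.
    exact: summ_measurable (sgB k).
  - exact: measurable_cst.
  - move=> x; apply: cvg_near_cst.
    have : (\bigcup_k B k) x by rewrite bigcup_ball.
    move=> [k0 _ xk0]; exists k0 => // k /= kk.
    rewrite indicE mem_set ?mulr1 ?subrr ?normr0 //.
    by apply: le_ball xk0; rewrite ler_nat.
  - exact: summ_norm.
  - move=> k x; rewrite normr_id indicE; case: (x \in B k).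
      by rewrite mulr1 subrr normr0.
    by rewrite mulr0 subr0.
rewrite Rint0 => /cvgr0Pnorm_le /(_ _ e0) [N _ hN].
exists (fun x => g x * \1_(B N) x); first by split.
by rewrite (le_trans (ler_norm _)) //; apply: hN => /=.
Qed.
End bounded_left.

End continuity_of_translation.

(** * Mollification *)

Section mollification.
Context {R : realType} {n : nat}.
Local Notation X := 'rV[R]_n.
Local Notation leb := (leb n).

Lemma translate_L2_cvg (y : nat -> X) (h g : X -> R) :
  y k @[k --> \oo] --> (0 : X) -> sqsumm leb h -> sqsumm leb g -> summ leb g ->
  \int[leb]_x (h x * g (y k + x)) @[k --> \oo] --> \int[leb]_x (h x * g x).
Proof.
move=> y0 hh hg sg; have [mh sh] := hh; have [mg sg2] := hg.
(* The part of [h] of height at most [N] is bounded and falls under the bounded case; the rest is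
   small in L^2, and its contribution is estimated uniformly over the translates of [g]. *)
pose t (N : nat) (x : X) : R := h x * (`|h x| <= N%:R)%R%:R.
have mt N : measurable_fun setT (t N).
  apply: measurable_funM => //.
  have mb : measurable_fun setT (fun x => `|h x| <= N%:R).
    by apply: measurable_fun_ler => //; exact: measurableT_comp.
  exact: (measurableT_comp (f := fun b : bool => b%:R : R)).
have tN N x : `|t N x| <= N%:R.
  rewrite /t; case: (boolP (`|h x| <= N%:R)) => [h1|_]; first by rewrite mulr1.
  by rewrite mulr0 normr0.
have sd N : sqsumm leb (fun x => h x - t N x).
  split; first exact: measurable_funB.
  apply: (le_summ _ _ sh); first by apply: measurable_funX; exact: measurable_funB.
  move=> x; rewrite ger0_norm ?sqr_ge0 // /t.
  case: (`|h x| <= N%:R); last by rewrite mulr0 subr0.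
  by rewrite mulr1 subrr expr0n sqr_ge0.
have st N : sqsumm leb (t N).
  have := sqsummD hh (sqsummZ (-1) (sd N)).
  by congr (sqsumm _ _); apply/funext => x; ring.
have L : \int[leb]_x ((h x - t N x) ^+ 2) @[N --> \oo] --> \int[leb]_x (0 : R).
  apply: (@Rint_dominated _ _ _ leb _ _ (fun x => h x ^+ 2)) => //.
  - by move=> N; apply: measurable_funX; exact: measurable_funB.
  - move=> x; apply: cvg_near_cst; near=> N.
    rewrite /t (_ : `|h x| <= N%:R); first by rewrite mulr1 subrr expr0n.
    near: N; exists (Num.Def.truncn `|h x|).+1 => // N /= hN.
    by rewrite (le_trans (ltW (truncnS_gt _))) // ler_nat.
  - move=> N x; rewrite ger0_norm ?sqr_ge0 // /t.
    case: (`|h x| <= N%:R); last by rewrite mulr0 subr0.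
  by rewrite mulr1 subrr expr0n sqr_ge0.
rewrite Rint0 in L.
apply: cvg_approx => e e0.
pose G := \int[leb]_x (g x ^+ 2); have G0 : 0 <= G by apply: Rint_ge0 => x; exact: sqr_ge0.
(* Makes the term [s^-1 * G] of the AM-GM bound at most [e / 2]; the remainder of the truncation is
   then taken below [e / 2 / s]. *)
pose s : R := 2 * (G + 1) / e.
have s0 : 0 < s by rewrite divr_gt0 // mulr_gt0 // ltr_wpDl.
have es0 : 0 < e / 2 / s by apply: divr_gt0 => //; exact: divr_gt0.
move: L => /cvgr0Pnorm_le /(_ _ es0) [N _ /(_ N (leqnn N)) hN].
have D (a : X) : `|\int[leb]_x (h x * g (a + x)) - \int[leb]_x (t N x * g (a + x))| <= e.
  have sga : sqsumm leb (fun x => g (a + x)).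
    by split; [exact: measurable_translate|exact: (summ_translate a sg2)].
  rewrite -RintB; [|exact: sqsummM..].
  under eq_Rintegral do rewrite -mulrBl.
  apply: le_trans (Rint_amgm s0 (sd N) sga) _.
  rewrite (Rint_translate a (f := fun x => g x ^+ 2)); last exact: summ_measurable sg2.
  have -> : e = e / 2 + e / 2 by field.
  apply: lerD.
    rewrite mulrC -ler_pdivlMr //; apply: le_trans hN; exact: ler_norm.
  rewrite ler_pdivrMl // -/G (_ : s * (e / 2) = G + 1) ?lerDl //.
  by rewrite /s; field; rewrite gt_eqF.
exists (fun k => \int[leb]_x (t N x * g (y k + x))); last by move=> k; exact: D.
exists (\int[leb]_x (t N x * g x)).
  apply: (@translate_bounded_cvg _ _ _ _ N.+1%:R) => // x.
  by apply: le_trans (tN N x) _; rewrite ler_nat.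
have := D 0; rewrite distrC; congr (`|_ - _| <= _);
  by apply: eq_Rintegral => x _; rewrite add0r.
Unshelve. all: end_near. Qed.

(** The substitution [x - a] moves the translation onto the summable factor and leaves the bounded
    one fixed. *)
Lemma translate_L1_cvg (y : nat -> X) (h g : X -> R) (M : R) :
  y k @[k --> \oo] --> (0 : X) -> summ leb h -> measurable_fun setT g ->
  (forall x, `|g x| <= M) ->
  \int[leb]_x (h x * g (y k + x)) @[k --> \oo] --> \int[leb]_x (h x * g x).
Proof.
move=> y0 sh mg gM; have mh := summ_measurable sh.
have E (a : X) : \int[leb]_x (h x * g (a + x)) = \int[leb]_x (g x * h (- a + x)).
  rewrite -(Rint_translate (- a) (f := fun x => h x * g (a + x))).
    by apply: eq_Rintegral => x _; rewrite addNKr mulrC.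
  by apply: measurable_funM => //; exact: measurable_translate.
under eq_cvg do rewrite E.
under eq_Rintegral do rewrite mulrC.
apply: (@translate_bounded_cvg _ _ (fun k => - y k) _ (`|M| + 1)) => //.
- by rewrite -oppr0; apply: cvgN.
- by move=> x; rewrite (le_trans (gM x)) // (le_trans (ler_norm M)) // lerDl.
Qed.

(** Dominated convergence speaks of sequences, but a radius is required to choose the support of a
    mollifying kernel. *)
Lemma seq_continuous_at0 (T : X -> R) (l : R) :
  (forall y : nat -> X, y k @[k --> \oo] --> (0 : X) -> T (y k) @[k --> \oo] --> l) ->
  forall e, 0 < e -> exists2 d, 0 < d & forall y, ball 0 d y -> `|T y - l| <= e.
Proof.
move=> H e e0; apply: contrapT => nH.
have /choice[y hy] k : exists y : X, ball 0 k.+1%:R^-1 y /\ e < `|T y - l|.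
  apply: contrapT => /forallNP h; apply: nH; exists k.+1%:R^-1; first by rewrite invr_gt0.
  by move=> y yk; have /not_andP[//|/negP] := h y; rewrite -leNgt.
have cy : y k @[k --> \oo] --> (0 : X).
  apply/cvgrPdist_lt => d d0; near=> k.
  have [+ _] := hy k; rewrite -ball_normE /= => /lt_le_trans; apply.
  near: k.
  have : (k.+1%:R^-1 : R) @[k --> \oo] --> (0 : R) by exact: cvg_harmonic.
  move=> /cvgr0Pnorm_le /(_ _ d0); apply: filterS => k; apply: le_trans.
  exact: ler_norm.
have /cvgrPdist_le /(_ _ e0) [N _ /(_ N (leqnn N))] := H y cy.
by rewrite distrC leNgt; have [_ ->] := hy N.
Unshelve. all: end_near. Qed.

Definition translate_pair (h g : X -> R) (y : X) : R := \int[leb]_x (h x * g (y + x)).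

Lemma measurable_kernel (rho : X -> R) : measurable_fun setT rho ->
  measurable_fun setT (fun z : X * X => rho (z.1 - z.2)).
Proof. by move=> mr; exact: (measurableT_comp mr (@measurable_subr_pair R n)). Qed.

(** Fubini and the substitution [x + y] for [y], with [rho] even, turn the double integral into the
    integral of [rho y * translate_pair h g y]. On the support of [rho] the second factor is within
    [e] of its value at 0. The kernel is not normalised, so its mass stands on both sides. *)
Lemma mollify_approx (h g rho : X -> R) (M d e : R) :
  summ leb h -> summ leb g -> (forall y, summ leb (fun x => h x * g (y + x))) ->
  summ leb rho -> (forall x, 0 <= rho x <= M) -> (forall x, rho (- x) = rho x) ->
  (forall x, ~ ball 0 d x -> rho x = 0) ->
  (forall y, ball 0 d y -> `|translate_pair h g y - translate_pair h g 0| <= e) ->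
  `|\int[leb]_y (g y * \int[leb]_x (h x * rho (x - y))) -
    (\int[leb]_x rho x) * translate_pair h g 0| <= e * \int[leb]_x rho x.
Proof.
move=> sh sg shg sr rM rN r0 hT.
have mr := summ_measurable sr; have mh := summ_measurable sh; have mg := summ_measurable sg.
have rM' x : `|rho x| <= M by have /andP[a b] := rM x; rewrite ger0_norm.
have M0 : 0 <= M by exact: le_trans (normr_ge0 _) (rM' 0).
have [_ _ <-] := Rint_fubini_kernel sh sg (measurable_kernel mr) (fun z => rM' _).
pose F (z : X * X) := h z.1 * g (z.1 + z.2) * rho z.2.
have E1 x : h x * \int[leb]_y (g y * rho (x - y)) = \int[leb]_y F (x, y).
  rewrite -RintZ.
    rewrite -(Rint_translate x); last first.
      apply: measurable_funM => //; apply: measurable_funM => //.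
      exact: (measurableT_comp (measurable_kernel mr) (measurable_pair1 x)).
    apply: eq_Rintegral => y _; rewrite /F /= -mulrA; congr (_ * (_ * _)).
    by rewrite opprD addNKr rN.
  apply: (summM_bounded (M := M)) => //.
  exact: (measurableT_comp (measurable_kernel mr) (measurable_pair1 x)).
under eq_Rintegral do rewrite E1.
have mF : measurable_fun setT F.
  apply: measurable_funM; last exact: (measurableT_comp mr).
  apply: measurable_funM; first exact: (measurableT_comp mh).
  exact: (measurableT_comp mg (@measurable_addr_pair R n)).
have Fx x : summ leb (fun y => F (x, y)).
  exact: (summM_bounded mr rM' (summZ (h x) (summ_translate x sg))).
have Fy y : summ leb (fun x => F (x, y)).
  apply: eq_summ (summZ (rho y) (shg y)) => x.
  by rewrite /F /= mulrC (addrC y).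
pose C := M * \int[leb]_x `|g x|.
have FF : summ leb (fun x => \int[leb]_y `|F (x, y)|).
  apply: (le_summ (g := fun x => C * `|h x|)).
  - have := @measurable_fun_fubini_tonelli_F _ _ _ _ _ (@sfleb R n) (fun z => `|F z|%:E).
    move=> /(_ _ _) H.
    apply: (measurableT_comp (f := fine)) => //; apply: H.
      by apply/measurable_EFinP; exact: measurableT_comp.
    by move=> z; rewrite lee_fin.
  - move=> x; rewrite ger0_norm; last exact: Rint_ge0.
    have sgx : summ leb (fun y => `|g (x + y)|) by apply: summ_norm; exact: summ_translate.
    rewrite /C -(Rint_translate x (f := fun y => `|g y|)); last exact: measurableT_comp.
    rewrite mulrC mulrCA mulrA -RintZ //; apply: le_Rint.
    + exact: summ_norm.
    + exact: summZ.
    + by move=> y; rewrite /F /= !normrM mulrAC [M * _]mulrC ler_wpM2r // ler_wpM2l.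
  - by apply: summZ; exact: summ_norm.
have [_ s2 ->] := Rint_fubini mF Fx Fy FF.
have E2 y : \int[leb]_x F (x, y) = rho y * translate_pair h g y.
  by rewrite -RintZ //; apply: eq_Rintegral => x _; rewrite /F /= mulrC (addrC y).
under eq_Rintegral do rewrite E2.
rewrite [X in _ - X]mulrC -[X in _ - X]RintZ // -RintB; [|exact: eq_summ s2|exact: summZ].
rewrite -RintZ //; apply: le_normr_Rint.
- by apply: summB; [exact: eq_summ s2|exact: summZ].
- exact: summZ.
- move=> y; rewrite [_ * rho y]mulrC -mulrBr normrM [e * _]mulrC.
  have [yd|yd] := pselect (ball 0 d y); last by rewrite r0 // normr0 !mul0r.
  have /andP[ry _] := rM y; rewrite (ger0_norm ry) ler_wpM2l //; exact: hT.
Qed.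

End mollification.

(** * Dominated extension and representation of functionals *)

Section hahn_banach.
Context {R : realType} {V : lmodType R}.
Implicit Types (D F : set V) (p g : V -> R) (G : set (V * R)).

Definition is_subspace D := D 0 /\ forall a x y, D x -> D y -> D (a *: x + y).

Definition linear_on D g := forall a x y, D x -> D y -> g (a *: x + y) = a * g x + g y.

Definition convex_on D p := forall t x y, D x -> D y -> 0 <= t <= 1 ->
  p (t *: x + (1 - t) *: y) <= t * p x + (1 - t) * p y.

Lemma subspaceZ D a x : is_subspace D -> D x -> D (a *: x).
Proof. by move=> [D0 hD] Dx; rewrite -[_ *: _]addr0; exact: hD. Qed.

Lemma subspaceD D x y : is_subspace D -> D x -> D y -> D (x + y).
Proof. by move=> [D0 hD] Dx Dy; rewrite -[x]scale1r; exact: hD. Qed.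

Lemma linear_on0 D g : is_subspace D -> linear_on D g -> g 0 = 0.
Proof.
move=> [D0 _] hg; have := hg 1 0 0 D0 D0.
by rewrite scale1r addr0 mul1r -{1}[g 0]addr0 => /addrI.
Qed.

Lemma linear_onZ D g a x : is_subspace D -> linear_on D g -> D x -> g (a *: x) = a * g x.
Proof.
move=> sD hg Dx; have [D0 _] := sD.
by rewrite -[a *: x]addr0 hg // (linear_on0 sD hg) addr0.
Qed.

Section extension.
Variables (D F : set V) (p g0 : V -> R).
Hypotheses (sD : is_subspace D) (sF : is_subspace F) (FD : F `<=` D)
  (cp : convex_on D p) (lg0 : linear_on F g0) (g0p : forall x, F x -> g0 x <= p x).

(** Partial functionals are handled as graphs: extension becomes inclusion, and a chain has its
    union as upper bound. *)
Let gr0 : set (V * R) := [set z | F z.1 /\ z.2 = g0 z.1].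

Let Q G := [/\ forall x a b, G (x, a) -> G (x, b) -> a = b,
  forall c x y a b, G (x, a) -> G (y, b) -> G (c *: x + y, c * a + b) &
  forall x a, G (x, a) -> D x /\ a <= p x].

Let Q0 : Q gr0.
Proof.
split=> [x a b [_ /= ->] [_ /= ->] //|c x y a b [/= Fx ->] [/= Fy ->]|x a [/= Fx ->]].
  by split=> /=; [exact: sF.2|rewrite lg0].
by split; [exact: FD|exact: g0p].
Qed.

Let maximal : exists G, [/\ Q G, gr0 `<=` G & forall G', Q G' -> G `<=` G' -> G' `<=` G].
Proof.
(* Zorn is applied to the sets that satisfy [Q] after union with [gr0]; thus the empty chain causes
   no trouble and the maximal graph contains [gr0]. *)
have [|A [QA mA]] := @Zorn_bigcup _ (fun A => Q (A `|` gr0)).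
  move=> C CQ tC.
  have [->|/set0P[A0 CA0]] := eqVneq C set0; first by rewrite bigcup_set0 set0U.
  have up z : (\bigcup_(X in C) X `|` gr0) z -> exists2 X, C X & (X `|` gr0) z.
    by case=> [[X CX Xz]|gz]; [exists X => //; left|exists A0 => //; right].
  have up2 z z' : (\bigcup_(X in C) X `|` gr0) z -> (\bigcup_(X in C) X `|` gr0) z' ->
      exists2 X, C X & (X `|` gr0) z /\ (X `|` gr0) z'.
    move=> /up[X CX Xz] /up[Y CY Yz].
    have [XY|YX] := tC _ _ CX CY.
      by exists Y => //; split=> //; case: Xz => [/XY|]; [left|right].
    by exists X => //; split=> //; case: Yz => [/YX|]; [left|right].
  split=> [x a b h1 h2|c x y a b h1 h2|x a /up[X CX h]].
  - have [X CX [k1 k2]] := up2 _ _ h1 h2; have [q _ _] := CQ _ CX; exact: q k1 k2.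
  - have [X CX [k1 k2]] := up2 _ _ h1 h2; have [_ q _] := CQ _ CX.
    by case: (q c x y a b k1 k2) => h; [left; exists X|right].
  - by have [_ _ q] := CQ _ CX; exact: q h.
exists (A `|` gr0); split=> // G' QG' AG'.
have G'E : G' `|` gr0 = G'.
  by apply/setUidPl; apply: subset_trans AG'; exact: subsetUr.
have [AG|nAG] := pselect (G' `<=` A); first exact: subset_trans AG (@subsetUl _ _ _).
exfalso; apply: (mA G'); last by rewrite G'E.
split; last by move=> h; exact: nAG.
by apply: subset_trans AG'; exact: subsetUl.
Qed.

(** Convexity of [p] takes the place of sublinearity. The one-dimensional extension step compares
    slopes of [p] on the two sides of the graph, which uses convexity alone. *)
Lemma hahn_banach_dominated : exists g : V -> R,
  [/\ linear_on D g, forall x, D x -> g x <= p x & forall x, F x -> g x = g0 x].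
Proof.
have [G [[fG lG dG] grG mG]] := maximal.
have G00 : G (0, 0).
  apply: grG; split=> /=; first exact: sF.1.
  by rewrite (linear_on0 sF lg0).
have GZ c x a : G (x, a) -> G (c *: x, c * a).
  by move=> h; have := lG c x 0 a 0 h G00; rewrite !addr0.
have GD x y a b : G (x, a) -> G (y, b) -> G (x + y, a + b).
  by move=> h k; have := lG 1 x y a b h k; rewrite scale1r mul1r.
have total v : D v -> exists a, G (v, a).
  move=> Dv; apply: contrapT => nv.
  (* Lower slopes, coming from the points [x - s *: v]. Each lies below every upper slope
     [(p (x + t *: v) - a) / t], so that the supremum of [L] is a value at [v] compatible with [p]
     on both sides. *)
  pose L := [set l : R | exists x a s, [/\ G (x, a), 0 < s & l = (a - p (x - s *: v)) / s]].
  have LU x a t : G (x, a) -> 0 < t -> ubound L ((p (x + t *: v) - a) / t).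
    move=> Gx t0 l [y [b [s [Gy s0 ->]]]].
    rewrite ler_pdivrMr // mulrAC ler_pdivlMr //.
    have st0 : 0 < s + t by rewrite addr_gt0.
    (* With these weights the multiples of [v] cancel, and the convex combination falls back into
       the domain of the graph. *)
    pose th := s / (s + t).
    have th01 : 0 <= th <= 1.
      by rewrite /th (divr_ge0 (ltW s0) (ltW st0)) /= ler_pdivrMr // mul1r lerDl; exact: ltW.
    have th1 : 1 - th = t / (s + t) by rewrite /th; field; rewrite gt_eqF.
    have [Dx _] := dG _ _ Gx; have [Dy _] := dG _ _ Gy.
    have Dx' : D (x + t *: v) by apply: (subspaceD sD) => //; exact: (subspaceZ _ sD).
    have Dy' : D (y - s *: v).
      by rewrite -scaleNr; apply: (subspaceD sD) => //; exact: (subspaceZ _ sD).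
    have := cp Dx' Dy' th01.
    have -> : th *: (x + t *: v) + (1 - th) *: (y - s *: v) = th *: x + (1 - th) *: y.
      rewrite th1 !scalerDr scalerN !scalerA addrACA /th.
      rewrite (_ : s / (s + t) * t = t / (s + t) * s); last by rewrite mulrAC [RHS]mulrAC [t * s]mulrC.
      by rewrite subrr addr0.
    have Gc := GD _ _ _ _ (GZ th _ _ Gx) (GZ (1 - th) _ _ Gy).
    have [_ le1] := dG _ _ Gc.
    move=> le2; have := ler_wpM2l (ltW st0) (le_trans le1 le2); rewrite th1 /th.
    set P1 := p _; set P2 := p _.
    rewrite (_ : (s + t) * (s / (s + t) * a + t / (s + t) * b) = s * a + t * b); last first.
      by field; rewrite gt_eqF.
    rewrite (_ : (s + t) * (s / (s + t) * P1 + t / (s + t) * P2) = s * P1 + t * P2); last first.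
      by field; rewrite gt_eqF.
    lra.
  have L0 : L !=set0.
    by exists ((0 - p (0 - 1 *: v)) / 1); exists 0, 0, 1; split.
  pose c := sup L.
  have cu x a t : G (x, a) -> 0 < t -> c <= (p (x + t *: v) - a) / t.
    by move=> Gx t0; apply: ge_sup => //; exact: LU.
  have cl l : L l -> l <= c.
    move=> Ll; apply: ub_le_sup => //.
    by exists ((p (0 + 1 *: v) - 0) / 1); exact: LU.
  pose G' : set (V * R) := [set z | exists x a t,
    [/\ G (x, a), z.1 = x + t *: v & z.2 = a + t * c]].
  have QG' : Q G'.
    split=> [w a b [x [a1 [t [Gx /= -> ->]]]] [y [b1 [s [Gy /= + ->]]]]|
      k w w' a b [x [a1 [t [Gx /= -> ->]]]] [y [b1 [s [Gy /= -> ->]]]]|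
      w a [x [a1 [t [Gx /= -> ->]]]]].
    - move=> e.
      have [st|st] := eqVneq s t.
        by move: e; rewrite st => /addIr e; rewrite (fG x a1 b1) // e.
      exfalso; apply: nv.
      have e2 : (t - s) *: v = y - x.
        have -> : y = x + t *: v - s *: v by rewrite e addrK.
        by rewrite -[x + _ - _]addrA [x + _]addrC addrK scalerBl.
      have ts : t - s != 0 by rewrite subr_eq0 eq_sym.
      exists ((t - s)^-1 * (b1 + -1 * a1)).
      have -> : v = (t - s)^-1 *: (y + (-1) *: x).
        by rewrite scaleN1r -e2 scalerA mulVf // scale1r.
      exact: (GZ _ _ _ (GD _ _ _ _ Gy (GZ _ _ _ Gx))).
    - exists (k *: x + y), (k * a1 + b1), (k * t + s); split=> /=.
      + exact: lG.
      + by rewrite scalerDr scalerDl scalerA addrACA.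
      + by ring.
    - have [Dx ax] := dG _ _ Gx; split.
        by apply: (subspaceD sD) => //; exact: (subspaceZ _ sD).
      have [t0|t0|->] := ltgtP t 0.
      + have : (a1 - p (x - (- t) *: v)) / (- t) <= c.
          by apply: cl; exists x, a1, (- t); split=> //; rewrite oppr_gt0.
        rewrite scaleNr opprK ler_pdivrMr ?oppr_gt0 // mulrN lerBlDr => h.
        by rewrite -lerBrDr; lra.
      + have := cu x a1 t Gx t0; rewrite ler_pdivlMr // => h; lra.
      + by rewrite scale0r mul0r !addr0.
  apply: nv; exists c; apply: (mG G' QG'); last first.
    by exists 0, 0, 1; split=> //=; rewrite add0r ?scale1r ?mul1r.
  move=> [x a] Gx; exists x, a, 0; split=> //=; first by rewrite scale0r addr0.
  by rewrite mul0r addr0.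
have /choice[g hg] x : exists a, D x -> G (x, a).
  by have [/total[a Ga]|nD] := pselect (D x); [exists a|exists 0].
exists g; split=> [a x y Dx Dy|x Dx|x Fx].
- apply: (fG (a *: x + y)); first by apply: hg; exact: sD.2.
  by apply: lG; exact: hg.
- by have [] := dG _ _ (hg x Dx).
- by apply: (fG x); [apply: hg; exact: FD|exact: grG].
Qed.

End extension.

End hahn_banach.

(** * Functionals dominated by a finite measure *)

Section dominated_functional.
Context d (T : measurableType d) (R : realType)
  (mu : {finite_measure set T -> \bar R}).
Implicit Types (f g : T -> R) (E : set T).

Definition bounded_measurable : set (T -> R) :=
  [set f : T -> R | measurable_fun setT f /\ exists M : R, forall x, `|f x| <= M].

Lemma bounded_measurable_subspace : is_subspace bounded_measurable.
Proof.
split; first by split; [exact: measurable_cst|exists 0 => x; rewrite normr0].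
move=> a f g [mf [M hM]] [mg [N hN]]; split.
  by apply: measurable_funD => //; exact: measurable_funM.
exists (`|a| * M + N) => x; apply: (le_trans (ler_normD _ _)).
by rewrite lerD // normrM ler_wpM2l.
Qed.

Lemma bounded_measurable_indic E : measurable E -> bounded_measurable (\1_E).
Proof.
move=> mE; split; first exact: measurable_indic.
by exists 1 => x; rewrite indicE normr_nat; case: (_ \in _).
Qed.

Lemma bounded_measurable_summ (m : {finite_measure set T -> \bar R}) f :
  bounded_measurable f -> summ m f.
Proof.
move=> [mf [M hM]]; apply: (le_summ (g := fun=> M)) => //.
by apply: finite_measure_integrable_cst.
Qed.

Variables (L : (T -> R) -> R) (C : R).
Hypotheses (lL : linear_on bounded_measurable L) (C0 : 0 <= C)
  (LC : forall f, bounded_measurable f -> `|L f| <= C * \int[mu]_x `|f x|).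

Let sD := bounded_measurable_subspace.

(** Adding [C * mu] makes the set function nonnegative, since [L] is bounded below by [- C * mu] on
    indicators. The value 0 off the measurable sets only makes it total. *)
Definition shifted_functional (E : set T) : \bar R :=
  if `[< measurable E >] then (L (\1_E) + C * fine (mu E))%:E else 0%E.

Let mass_indic E : measurable E -> \int[mu]_x (\1_E x) = fine (mu E).
Proof. by move=> mE; rewrite /Rintegral integral_indic // setIT. Qed.

Let LB f g : bounded_measurable f -> bounded_measurable g ->
  L (fun x => f x - g x) = L f - L g.
Proof.
move=> bf bg; have -> : (fun x => f x - g x) = (-1) *: g + f.
  by apply/funext => x /=; rewrite addrC !fctE /= scaleN1r.
by rewrite lL // mulN1r addrC.
Qed.

Let rep0 : shifted_functional set0 = 0%E.
Proof.
rewrite /shifted_functional asboolT // measure0 /= mulr0 addr0.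
by rewrite indic0 (linear_on0 sD lL).
Qed.

Let rep_ge0 E : (0 <= shifted_functional E)%E.
Proof.
rewrite /shifted_functional; case: asboolP => // mE; rewrite lee_fin.
have := LC (bounded_measurable_indic mE).
under eq_Rintegral do rewrite ger0_norm //.
by rewrite mass_indic // ler_norml => /andP[+ _]; rewrite -lerBlDr sub0r.
Qed.

Let rep_le E : measurable E -> (shifted_functional E <= (2 * C)%:E * mu E)%E.
Proof.
move=> mE; rewrite /shifted_functional asboolT //.
rewrite -[mu E]fineK ?fin_num_measure // -EFinM lee_fin.
have := LC (bounded_measurable_indic mE).
under eq_Rintegral do rewrite ger0_norm //.
rewrite mass_indic // ler_norml => /andP[_ h].
by rewrite mulrDl mul1r mulrDl lerD2r.
Qed.

(** Domination carries sigma-additivity over from [mu]: the tail of a disjoint union has small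
    [mu]-measure, and [L] of its indicator is at most [C] times that. *)
Let rep_sigma_additive : semi_sigma_additive shifted_functional.
Proof.
move=> F mF tF mUF.
pose U := \bigcup_n F n.
pose S N : T -> R := fun x => \sum_(0 <= i < N) \1_(F i) x.
have S0 : S 0%N = 0 by apply/funext => x; rewrite /S big_geq.
have SS N : S N.+1 = 1 *: S N + \1_(F N).
  by apply/funext => x; rewrite scale1r /S big_nat_recr.
have bI i := bounded_measurable_indic (mF i).
have bS N : bounded_measurable (S N).
  by elim: N => [|N IH]; [rewrite S0; exact: sD.1|rewrite SS; exact: sD.2].
have LS N : L (S N) = \sum_(0 <= i < N) L (\1_(F i)).
  elim: N => [|N IH]; first by rewrite S0 big_geq // (linear_on0 sD lL).
  by rewrite big_nat_recr //= -IH SS lL // mul1r.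
have SU N x : 0 <= \1_U x - S N x.
  rewrite subr_ge0 /S big_mkord.
  have [[i _ Fix]|nU] := pselect (U x); last first.
    rewrite big1 // => i _; rewrite indicE memNset // => Fx; apply: nU; by exists i.
  have ne j : j != i -> ~ F j x.
    by move=> /eqP ji Fjx; apply: ji; apply: (tF j i) => //; exists x.
  rewrite [leRHS]indicE mem_set; last by exists i.
  have [iN|Ni] := ltnP i N.
    rewrite (bigD1 (Ordinal iN)) //= big1 ?addr0; first by rewrite indicE; case: (_ \in _).
    move=> j jN; rewrite indicE memNset //; apply: ne.
    by move: jN; apply: contraNneq => ji; apply/eqP/val_inj.
  rewrite big1 // => j _; rewrite indicE memNset //; apply: ne.
  by apply/eqP => ji; move: (ltn_ord j); rewrite ji ltnNge Ni.
have IS N : \int[mu]_x S N x = \sum_(0 <= i < N) fine (mu (F i)).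
  rewrite Rint_sum; first by apply: eq_bigr => i _; exact: mass_indic.
  by move=> i _; exact: bounded_measurable_summ.
have cmu : \sum_(0 <= i < N) fine (mu (F i)) @[N --> \oo] --> fine (mu U).
  have := @measure_semi_sigma_additive _ _ _ mu F mF tF mUF.
  have -> : (fun n => (\sum_(0 <= i < n) mu (F i))%E) =
      (fun n => (\sum_(0 <= i < n) fine (mu (F i)))%:E).
    apply/funext => n; rewrite -sumEFin; apply: eq_bigr => i _.
    by rewrite fineK // fin_num_measure.
  move=> h; have {}h : (\sum_(0 <= i < n) fine (mu (F i)))%:E @[n --> \oo]
      --> (fine (mu U))%:E by rewrite fineK // fin_num_measure.
  exact: (fine_cvg h).
have -> : (fun n => (\sum_(0 <= i < n) shifted_functional (F i))%E) =
    (fun n => (L (S n) + C * \sum_(0 <= i < n) fine (mu (F i)))%:E).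
  apply/funext => n; rewrite LS mulr_sumr -big_split /= -sumEFin.
  by apply: eq_bigr => i _; rewrite /shifted_functional asboolT.
rewrite /shifted_functional asboolT //; apply: cvg_EFin; first exact: nearW.
apply: cvgD; last by apply: cvgM => //; exact: cvg_cst.
have D N : `|L (S N) - L (\1_U)| <= C * (fine (mu U) - \sum_(0 <= i < N) fine (mu (F i))).
  have bU := bounded_measurable_indic mUF.
  rewrite distrC -LB //; apply: le_trans (LC _) _.
    have := sD.2 (-1) _ _ (bS N) bU; congr bounded_measurable.
    by apply/funext => x; rewrite fctE /= addrC scaleN1r.
  rewrite -mass_indic // -IS -RintB; [|exact: bounded_measurable_summ..].
  by under eq_Rintegral do rewrite ger0_norm //.
apply/cvgrPdist_le => e e0.
have : C * (fine (mu U) - \sum_(0 <= i < N) fine (mu (F i))) @[N --> \oo] -->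
    C * (fine (mu U) - fine (mu U)).
  by apply: cvgM; [exact: cvg_cst|apply: cvgB => //; exact: cvg_cst].
rewrite subrr mulr0 => /cvgr0Pnorm_le /(_ _ e0); apply: filterS => k; apply: le_trans.
by rewrite distrC (le_trans (D k)) // ler_norm.
Qed.

#[local] HB.instance Definition _ := isMeasure.Build _ _ _ shifted_functional
  rep0 rep_ge0 rep_sigma_additive.

Let rep_fin : fin_num_fun shifted_functional.
Proof. by move=> E mE; rewrite /shifted_functional; case: ifP. Qed.

#[local] HB.instance Definition _ := @Measure_isFinite.Build _ _ _ shifted_functional rep_fin.

(** Both sides of the integral formula are continuous for the L^1 norm of [mu], the left one because
    [P] is at most [2 * C] times [mu]; agreement on simple functions therefore suffices. *)
Lemma dominated_functional_measure :
  exists P : {finite_measure set T -> \bar R},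
    (forall E, measurable E -> (P E <= (2 * C)%:E * mu E)%E) /\
    forall f, bounded_measurable f -> \int[P]_x f x = L f + C * \int[mu]_x f x.
Proof.
pose P : {finite_measure set T -> \bar R} := shifted_functional.
have PE E : measurable E -> P E = (L (\1_E) + C * fine (mu E))%:E.
  by move=> mE; rewrite /P /= /shifted_functional asboolT.
exists P; split; first exact: rep_le.
have nP (g : T -> R) : bounded_measurable g ->
    \int[P]_x `|g x| <= 2 * C * \int[mu]_x `|g x|.
  move=> bg; have C20 : 0 <= 2 * C by exact: mulr_ge0.
  have [mg _] := bg; have mng : measurable_fun setT (fun x => `|g x|%:E).
    by apply/measurable_EFinP; exact: measurableT_comp.
  rewrite -lee_fin EFinM !EFin_Rint; [|by apply: summ_norm; exact: bounded_measurable_summ..].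
  rewrite -(@ge0_integral_mscale _ _ _ mu setT measurableT (NngNum C20)) //.
  apply: ge0_le_measure_integral => // E mE; exact: rep_le.
pose good g := bounded_measurable g /\ \int[P]_x g x = L g + C * \int[mu]_x g x.
have goodL a g h : good g -> good h -> good (a *: g + h).
  move=> [bg Eg] [bh Eh]; split; first exact: sD.2.
  have E (m : {finite_measure set T -> \bar R}) :
      \int[m]_x (a *: g + h) x = a * \int[m]_x g x + \int[m]_x h x.
    rewrite -RintZ; last exact: bounded_measurable_summ.
    by rewrite -RintD //; [apply: summZ|]; exact: bounded_measurable_summ.
  by rewrite !E lL // Eg Eh; ring.
have good_sum (s : seq R) (A : R -> set T) : (forall v, measurable (A v)) ->
    good (fun x => \sum_(v <- s) v * \1_(A v) x).
  move=> mA; elim: s => [|v s IH].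
    have -> : (fun x => \sum_(v <- [::]) v * \1_(A v) x) = 0 :> (T -> R).
      by apply/funext => x; rewrite big_nil.
    split; first exact: sD.1.
    by rewrite (linear_on0 sD lL) !Rint0 mulr0 addr0.
  have -> : (fun x => \sum_(v <- v :: s) v * \1_(A v) x) =
      v *: \1_(A v) + (fun x => \sum_(v <- s) v * \1_(A v) x).
    by apply/funext => x; rewrite big_cons.
  apply: (goodL) => //; split; first exact: bounded_measurable_indic.
  rewrite mass_indic // /Rintegral integral_indic // setIT.
  by rewrite [X in fine X](PE _ (mA v)).
move=> f bf; have [mf _] := bf.
have sf := bounded_measurable_summ mu bf.
apply/eqP; rewrite -subr_eq0 -normr_le0; apply/ler_addgt0Pl => e e0; rewrite addr0.
have /(approximation_sfun_integrable measurableT) [s_ [_ _ sl]] := sf.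
(* The error is at most [4 * C] times the L^1 distance: [2 * C] from [P], and [C] each from [L] and
   from [C * mu]. The added 1 covers [C = 0]. *)
have d0 : 0 < e / (4 * C + 1) by rewrite divr_gt0 // ltr_wpDl // mulr_ge0.
have [N hN] : exists N, (\int[mu]_z `|(EFin \o f) z - (s_ N z)%:E| < (e / (4 * C + 1))%:E)%E.
  have : nbhs (0 : \bar R)%E [set x | (x < (e / (4 * C + 1))%:E)%E].
    by apply: open_nbhs_nbhs; split; [exact: open_ereal_lt_ereal|rewrite /= lte_fin].
  by move=> /sl [N _ hN]; exists N; exact: hN (leqnn N).
have [bs Es] : good (s_ N).
  have -> : (s_ N : T -> R) = fun x =>
      \sum_(v <- finmap.enum_fset (fset_set (range (s_ N)))) v * \1_(s_ N @^-1` [set v]) x.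
    by apply/funext => x; rewrite {1}fimfunE fsbig_finite.
  by apply: good_sum => v.
have bd : bounded_measurable (fun x => f x - s_ N x).
  have := sD.2 (-1) _ _ bs bf; congr bounded_measurable.
  by apply/funext => x; rewrite fctE /= addrC scaleN1r.
have {}hN : \int[mu]_x `|f x - s_ N x| <= e / (4 * C + 1).
  by rewrite -lee_fin EFin_Rint ?ltW //; apply: summ_norm; exact: bounded_measurable_summ.
have -> : \int[P]_x f x - (L f + C * \int[mu]_x f x) =
    \int[P]_x (f x - s_ N x) + (- L (fun x => f x - s_ N x) +
      - (C * \int[mu]_x (f x - s_ N x))).
  rewrite LB // !RintB //; try exact: bounded_measurable_summ.
  by rewrite Es; ring.
have B1 := normr_Rint (bounded_measurable_summ P bd).
have B2 := normr_Rint (bounded_measurable_summ mu bd).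
have B3 := nP _ bd; have B4 := LC bd.
set I := \int[mu]_x `|f x - s_ N x| in hN B2 B3 B4.
apply: (@le_trans _ _ ((4 * C) * I)).
  apply: (le_trans (ler_normD _ _)); apply: (@le_trans _ _ (2 * C * I + (C * I + C * I))).
    apply: lerD; first exact: le_trans B1 B3.
    apply: (le_trans (ler_normD _ _)); rewrite !normrN; apply: lerD => //.
    by rewrite normrM (ger0_norm C0) ler_wpM2l.
  by rewrite le_eqVlt; apply/orP; left; apply/eqP; ring.
have C4 : 0 <= 4 * C by exact: mulr_ge0.
apply: (@le_trans _ _ (4 * C * (e / (4 * C + 1)))); first by rewrite ler_wpM2l.
by rewrite mulrA ler_pdivrMr ?ltr_wpDl // mulrC ler_pM2l // lerDl.
Qed.

End dominated_functional.

Lemma dominated_functional_signed d (T : measurableType d) (R : realType)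
    (mu : {finite_measure set T -> \bar R}) (L : (T -> R) -> R) (C : R) :
  linear_on (@bounded_measurable d T R) L -> 0 <= C ->
  (forall f, bounded_measurable f -> `|L f| <= C * \int[mu]_x `|f x|) ->
  exists P N : {finite_measure set T -> \bar R},
    forall f, bounded_measurable f -> L f = \int[P]_x f x - \int[N]_x f x.
Proof.
move=> lL C0 LC.
have [P [_ hP]] := dominated_functional_measure lL C0 LC.
(* Applied to the zero functional, the construction returns [C * mu] as a finite measure. *)
have [||N [_ hN]] := @dominated_functional_measure _ _ _ mu (fun=> 0) C _ C0.
- by move=> a f g _ _; rewrite mulr0 addr0.
- move=> f _; rewrite normr0 mulr_ge0 //; exact: Rint_ge0.
by exists P, N => f bf; rewrite hP // hN //; ring.
Qed.

Section finite_measure_of.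
Context d (T : measurableType d) (R : realType) (m : {measure set T -> \bar R}).
Hypothesis fin : fin_num_fun m.

Definition measure_copy : set T -> \bar R := m.

#[local] HB.instance Definition _ := Measure.copy measure_copy m.
#[local] HB.instance Definition _ := @Measure_isFinite.Build _ _ _ measure_copy fin.

Lemma finite_measure_of :
  exists q : {finite_measure set T -> \bar R}, forall E, q E = m E.
Proof. by exists measure_copy. Qed.

End finite_measure_of.

Section finite_measures.
Context d (T : measurableType d) (R : realType).
Implicit Types (P N : {finite_measure set T -> \bar R}) (f : T -> R).

Lemma finite_measure_sum (s : seq {finite_measure set T -> \bar R}) :
  exists mu : {finite_measure set T -> \bar R}, forall f, bounded_measurable f ->
    \sum_(m <- s) \int[m]_x `|f x| = \int[mu]_x `|f x|.
Proof.
elim: s => [|m s [mu hmu]].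
  have [||mu [_ hmu]] := @dominated_functional_measure _ _ R (mzero : {finite_measure set T -> \bar R}) (fun=> 0) 0 _ (lexx _).
  - by move=> a f g _ _; rewrite mulr0 addr0.
  - by move=> f _; rewrite normr0 mul0r.
  exists mu => f [mf [M hM]]; rewrite big_nil hmu ?add0r ?mul0r //.
  by split; [exact: measurableT_comp|exists M => x; rewrite normr_id].
have fin : fin_num_fun (measure_add m mu).
  by move=> E mE; rewrite measure_addE fin_numD !fin_num_measure.
have [nu nuE] := @finite_measure_of _ _ _ (measure_add m mu) fin.
exists nu => f bf; rewrite big_cons hmu //.
have [mf _] := bf; have mnf : measurable_fun setT (fun x => `|f x|%:E).
  by apply/measurable_EFinP; exact: measurableT_comp.
apply: EFin_inj; rewrite EFinD !EFin_Rint;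
  try by apply: summ_norm; exact: bounded_measurable_summ.
rewrite -(ge0_integral_measure_add m mu measurableT) //.
by apply: eq_measure_integral => E mE _; exact: (esym (nuE E)).
Qed.

Lemma finite_measure_scale (a : R) P : 0 <= a ->
  exists Q : {finite_measure set T -> \bar R}, forall f, bounded_measurable f ->
    \int[Q]_x f x = a * \int[P]_x f x.
Proof.
move=> a0.
have [||Q [_ hQ]] := @dominated_functional_measure _ _ R P (fun=> 0) a _ a0.
- by move=> b f g _ _; rewrite mulr0 addr0.
- by move=> f _; rewrite normr0 mulr_ge0 // Rint_ge0.
by exists Q => f bf; rewrite hQ // add0r.
Qed.

End finite_measures.

(** * The pairing of a field with a function of bounded A-variation *)

Section translated_smooth.
Context {R : realType} {n : nat}.
Local Notation X := 'rV[R]_n.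

Lemma partial_translate (j : 'I_n) (f : X -> R) (a x : X) :
  partial j (fun y => f (y - a)) x = partial j f (x - a).
Proof.
have E : (fun h : R => h^-1 *: (((fun y => f (y - a)) \o shift x)
      (h *: (delta_mx 0 j : X)) - f (x - a))) =
    (fun h => h^-1 *: ((f \o shift (x - a)) (h *: (delta_mx 0 j : X)) - f (x - a))).
  by apply/funext => h /=; rewrite addrA.
by rewrite /partial /derive E.
Qed.

Lemma smooth_translate (f : X -> R) (a : X) : smooth f -> smooth (fun x => f (x - a)).
Proof.
move=> sf; have := smooth_reflect 0 (smooth_reflect (- a) sf).
by congr smooth; apply/funext => x /=; rewrite sub0r opprK addrC.
Qed.

Lemma test_bounded_measurable (Omega : set X) (phi : X -> R) :
  test_function Omega phi -> @bounded_measurable _ X R phi.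
Proof.
move=> h; split; first exact: smooth_measurable (test_smooth h).
by have [M [_ hM]] := test_bounded h; exists M.
Qed.

(** Not normalised: the mass of the kernel is carried through the estimates and cancelled at the
    end. *)
Definition kernel (d : R) : X -> R := plateau 0 (d / 2).

Section kernel.
Variable d : R.
Hypothesis d0 : 0 < d.
Let d20 : 0 < d / 2. Proof. by rewrite divr_gt0. Qed.

Lemma kernel01 x : 0 <= kernel d x <= 1.
Proof. by rewrite plateau_ge0 plateau_le1. Qed.

Lemma kernel_even x : kernel d (- x) = kernel d x.
Proof. exact: plateau_even. Qed.

Lemma kernel_support x : ~ ball 0 d x -> kernel d x = 0.
Proof. by move=> nb; apply: plateau_eq0 => //; rewrite mulrC divfK. Qed.

Lemma kernel_test : test_function setT (kernel d).
Proof. by apply: plateau_test. Qed.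

Lemma kernel_mass_gt0 : 0 < \int[leb n]_x kernel d x.
Proof.
pose B : set X := ball (0 : X) (d / 2).
have mB : measurable B by exact: measurable_fun_ballrV.
have sI : summ (leb n) (\1_B : X -> R) by apply: summ_indic => //; exact: leb_ball_fin.
apply: (@lt_le_trans _ _ (\int[leb n]_x (\1_B x : R))).
  rewrite /Rintegral integral_indic // setIT leb_ball //= exprn_gt0 //.
  by rewrite mulr_gt0.
apply: le_Rint => //; first exact: test_summ kernel_test.
move=> x; have /andP[k0 _] := kernel01 x.
have [xB|xB] := pselect (B x); last by rewrite indicE memNset.
by rewrite /kernel plateau_eq1 // indicE; case: (_ \in _).
Qed.

End kernel.

End translated_smooth.

Lemma closed_ball_compact (R : realType) (n : nat) (a : 'rV[R]_n) (r : R) :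
  0 < r -> compact (closed_ball a r).
Proof.
move=> r0; apply: bounded_closed_compact; last exact: closed_ball_closed.
exists (`|a| + r); split; first exact: num_real.
move=> N hN x; rewrite closed_ballE // => hx.
apply: le_trans (ltW hN); rewrite -[x in X in X <= _](subrK a) addrC.
by rewrite (le_trans (ler_normD _ _)) // lerD2l distrC.
Qed.

Lemma compact_uniform_ball (R : realType) (n : nat) (K U : set 'rV[R]_n) :
  compact K -> open U -> K `<=` U ->
  exists2 a, 0 < a & forall x, K x -> ball x a `<=` U.
Proof.
move=> /compact_near_coveringP cK oU KU.
have := cK R (0 : R)^'+ (fun a x => ball x a `<=` U) _.
move=> /(_ _ _)[].
  move=> x Kx; have /nbhs_ballP[e /= e0 xe] : nbhs x U by apply: open_nbhs_nbhs; split=> //; exact: KU.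
  exists (ball x (e / 2), [set r | r < e / 2]); first split => /=.
  - by apply: nbhsx_ballx; rewrite divr_gt0.
  - by apply: nbhs_right_lt; rewrite divr_gt0.
  - move=> [y r] /= [xy re] t yt; apply: xe.
    apply: (@le_ball _ _ _ (e / 2 + r)); first by rewrite [leRHS]splitr lerD2l ltW.
    exact: ball_triangle xy yt.
move=> a /= a0 h; exists (a / 2); first by rewrite divr_gt0.
move=> x Kx; apply: (h (a / 2) _ _ x Kx); last by rewrite divr_gt0.
by rewrite /= sub0r normrN ger0_norm ?divr_ge0 ?(ltW a0) // ltr_pdivrMr // ltr_pMr // ltr1n.
Qed.

Lemma finite_common_radius (R : realType) (I : finType) (P : I -> R -> Prop) :
  (forall i a b, P i a -> 0 < b <= a -> P i b) ->
  (forall i, exists2 a, 0 < a & P i a) -> exists2 a, 0 < a & forall i, P i a.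
Proof.
move=> mono H; have /choice[a ha] i : exists a, 0 < a /\ P i a.
  by have [a a0 Pa] := H i; exists a.
exists (\big[Num.min/1]_i a i).
  by elim/big_ind : _ => // [x y x0 y0|i _]; [rewrite lt_min x0|have [] := ha i].
move=> i; have [ai Pi] := ha i; apply: (mono i (a i)) => //.
apply/andP; split; last exact: bigmin_le_cond.
by elim/big_ind : _ => // [x y x0 y0|k _]; [rewrite lt_min x0|have [] := ha k].
Qed.

Section pairing.
Context {R : realType} {m n : nat}.
Local Notation X := 'rV[R]_n.
Local Notation leb := (leb n).
Variable Omega : set X.
Hypotheses (oO : open Omega) (bO : bounded_set Omega).
Implicit Types (d w : 'I_m -> X -> R) (z : 'I_m -> 'I_n -> X -> R).

(** The test functions live on the set parameter, the integrals on the whole space. For fields that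
    vanish off the domain, taking the parameter to be [setT] expresses a zero normal trace as
    well. *)
Definition weak_divc z d := forall psi, test_function Omega psi -> forall i,
  \int[leb]_x (\sum_j z i j x * partial j psi x) = - \int[leb]_x (d i x * psi x).

Definition pairc z d w (phi : X -> R) : R :=
  - \int[leb]_x (\sum_i phi x * d i x * w i x +
                 \sum_i \sum_j partial j phi x * z i j x * w i x).

Definition vanish_outside (f : X -> R) := forall x, ~ Omega x -> f x = 0.

(** On a ball that contains [Omega], [|f|] is at most [f ^+ 2 + 1]. *)
Lemma vanish_sqsumm_summ f : sqsumm leb f -> vanish_outside f -> summ leb f.
Proof.
move=> [mf sf] vf; have [r [r0 Or]] := bounded_set_ball bO.
have mB : measurable (ball (0 : X) r) by exact: measurable_fun_ballrV.
apply: (le_summ (g := fun x => f x ^+ 2 + \1_(ball (0 : X) r) x)) => //.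
  move=> x; have [xO|xO] := pselect (Omega x).
    rewrite indicE mem_set; last exact: Or.
    have [h|h] := leP `|f x| 1.
      by rewrite (le_trans h) // lerDr sqr_ge0.
    rewrite -real_normK ?num_real // ler_wpDr // expr2 ler_peMr //; exact: ltW.
  by rewrite vf // normr0 expr0n add0r.
by apply: summD => //; apply: summ_indic => //; exact: leb_ball_fin.
Qed.

Lemma vanish_bounded_sqsumm f : bounded_measurable f -> vanish_outside f -> sqsumm leb f.
Proof.
move=> [mf [M hM]] vf; split => //.
have [r [r0 Or]] := bounded_set_ball bO.
apply: (@summ_bounded_support _ _ (M ^+ 2) r).
- exact: measurable_funX.
- by move=> x; rewrite normrX lerXn2r ?nnegrE // (le_trans _ (hM x)).
- by move=> x nx; rewrite vf ?expr0n // => /Or.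
Qed.

Section fixed_fields.
Variables (z : 'I_m -> 'I_n -> X -> R) (d w : 'I_m -> X -> R) (M : R).
Hypotheses (mz : forall i j, measurable_fun setT (z i j))
  (zM : forall i j x, `|z i j x| <= M) (vz : forall i j, vanish_outside (z i j))
  (sd : forall i, sqsumm leb (d i)) (vd : forall i, vanish_outside (d i))
  (sw : forall i, sqsumm leb (w i)) (vw : forall i, vanish_outside (w i))
  (zd : weak_divc z d).

Let sz i j : sqsumm leb (z i j).
Proof. by apply: vanish_bounded_sqsumm => //; split=> //; exists M. Qed.

Let sz1 i j : summ leb (z i j).
Proof. exact: vanish_sqsumm_summ. Qed.

Let sd1 i : summ leb (d i).
Proof. exact: vanish_sqsumm_summ. Qed.

Let sphiw phi i : test_function setT phi -> sqsumm leb (fun x => w i x * phi x).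
Proof.
move=> /test_bounded_measurable[mphi [N hN]]; exact: sqsummM_bounded hN _.
Qed.

Let sphiw1 phi i : test_function setT phi -> summ leb (fun x => w i x * phi x).
Proof.
move=> tp; apply: vanish_sqsumm_summ; first exact: sphiw.
by move=> x nx; rewrite vw // mul0r.
Qed.

Definition weak_partial (f : X -> R) (j : 'I_n) (phi : X -> R) : R :=
  - \int[leb]_x (f x * partial j phi x).

(** For each [y], the constant matrix [z y] is contracted with the gradient of [w] tested against
    one scalar function. If [A] fixes [z y], only the A-part of the gradient enters, and that part
    is a measure. Integration over [y] gives back the pairing, up to the mass of [rho] and a small
    error. *)
Definition mollified_pairing (phi rho : X -> R) (y : X) : R :=
  \sum_i \sum_j z i j y * weak_partial (w i) j (fun x => phi x * rho (x - y)).

Lemma pairc_expand phi : test_function setT phi ->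
  pairc z d w phi = - \sum_i \int[leb]_x (w i x * phi x * d i x) -
    \sum_i \sum_j \int[leb]_x (w i x * partial j phi x * z i j x).
Proof.
move=> tp.
have s1 i : summ leb (fun x => w i x * phi x * d i x) by apply: sqsummM => //; exact: sphiw.
have s2 i j : summ leb (fun x => w i x * partial j phi x * z i j x).
  by apply: sqsummM => //; apply: sphiw; exact: test_partial.
rewrite -opprD /pairc; congr (- _).
have -> : \sum_i \int[leb]_x (w i x * phi x * d i x) =
    \int[leb]_x (\sum_i w i x * phi x * d i x) by rewrite Rint_sum.
have -> : \sum_i \sum_j \int[leb]_x (w i x * partial j phi x * z i j x) =
    \int[leb]_x (\sum_i \sum_j w i x * partial j phi x * z i j x).
  rewrite Rint_sum; last by move=> i _; apply: summ_sum => j _; exact: s2.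
  by apply: eq_bigr => i _; rewrite Rint_sum.
rewrite -RintD; first last.
- by apply: summ_sum => i _; apply: summ_sum => j _; exact: s2.
- by apply: summ_sum => i _; exact: s1.
apply: eq_Rintegral => x _; congr (_ + _).
  by apply: eq_bigr => i _; ring.
by apply: eq_bigr => i _; apply: eq_bigr => j _; ring.
Qed.

(** The product rule splits the derivative of [phi x * rho (x - y)]. In the terms with the
    derivative of [rho], Fubini exposes [z] tested against [rho (x - y)] as a function of [y], and
    the weak divergence applies: where [phi x != 0], that function has its support in the closed
    [e]-ball about [x], hence in [Omega]. *)
Lemma mollified_pairingE phi rho e : test_function Omega phi ->
  test_function setT rho ->
  (forall x, ~ ball 0 e x -> rho x = 0) ->
  (forall x, phi x != 0 -> ball x (2 * e) `<=` Omega) -> 0 < e ->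
  (forall x, rho (- x) = rho x) ->
  summ leb (mollified_pairing phi rho) /\
  \int[leb]_y mollified_pairing phi rho y =
  - \sum_i \int[leb]_y (d i y * \int[leb]_x (w i x * phi x * rho (x - y))) -
    \sum_i \sum_j
      \int[leb]_y (z i j y * \int[leb]_x (w i x * partial j phi x * rho (x - y))).
Proof.
move=> tphi trho rho0 phiO e0 rhoN.
have tphiT := test_subset (@subsetT _ Omega) tphi.
have srho := test_smooth trho; have sphi := test_smooth tphi.
have mrho := smooth_measurable srho.
have [K [K0 rhoK]] := test_bounded trho.
have kern (h k r : X -> R) : summ leb h -> summ leb k -> test_function setT r ->
  [/\ summ leb (fun x => h x * \int[leb]_y (k y * r (x - y))),
      summ leb (fun y => k y * \int[leb]_x (h x * r (x - y))) &
  \int[leb]_x (h x * \int[leb]_y (k y * r (x - y))) =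
  \int[leb]_y (k y * \int[leb]_x (h x * r (x - y)))].
  move=> sh sk tr; have [N [_ hN]] := test_bounded tr.
  have mk := measurable_kernel (smooth_measurable (test_smooth tr)).
  exact: (@Rint_fubini_kernel _ _ h k (fun zz => r (zz.1 - zz.2)) N sh sk mk (fun zz => hN _)).
have zrho (k : X -> R) (j : 'I_n) x : summ leb k ->
    summ leb (fun y => k y * partial j rho (x - y)).
  move=> sk; have [N [_ hN]] := test_bounded (test_partial j trho).
  apply: (summM_bounded (M := N)) => // .
  exact: smooth_measurable (smooth_reflect x (smooth_partial j srho)).
have E1 i : \int[leb]_y (d i y * \int[leb]_x (w i x * phi x * rho (x - y))) =
    \sum_j \int[leb]_y (z i j y * \int[leb]_x (w i x * phi x * partial j rho (x - y))).
  have [_ _ <-] := kern _ _ _ (sphiw1 i tphiT) (sd1 i) trho.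
  have k2 j := kern _ _ _ (sphiw1 i tphiT) (sz1 i j) (test_partial j trho).
  transitivity (\sum_j \int[leb]_x (w i x * phi x *
      \int[leb]_y (z i j y * partial j rho (x - y)))); last first.
    by apply: eq_bigr => j _; have [_ _ e3] := k2 j; exact: e3.
  transitivity (\int[leb]_x (\sum_j w i x * phi x *
      \int[leb]_y (z i j y * partial j rho (x - y)))); last first.
    by rewrite Rint_sum // => j _; have [] := k2 j.
  apply: eq_Rintegral => x _; rewrite -mulr_sumr.
  have [px|px] := eqVneq (phi x) 0; first by rewrite px mulr0 !mul0r.
  congr (_ * _).
  have tpsi : test_function Omega (fun y => rho (x - y)).
    apply/test_functionP; split; first exact: smooth_reflect.
    exists (closed_ball x e); split; first exact: closed_ball_compact.
    - apply: subset_trans (phiO x px) => y; rewrite closed_ballE // => xy.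
      rewrite -ball_normE /=; apply: (le_lt_trans xy).
      by rewrite ltr_pMl // ltr1n.
    - move=> y ny; apply: rho0 => xy; apply: ny; apply: subset_closed_ball.
      move: xy; rewrite -!ball_normE /= sub0r normrN; exact.
  have := zd tpsi i => /eqP; rewrite eq_sym eqr_oppLR => /eqP ->.
  rewrite -RintN; last first.
    apply: summ_sum => j _; have := summN (zrho _ j x (sz1 i j)).
    apply: eq_summ => y; rewrite partial_reflect ?mulrN //.
    exact: smooth_derivable.
  transitivity (\int[leb]_y (\sum_j z i j y * partial j rho (x - y))); last first.
    by rewrite Rint_sum // => j _; exact: zrho.
  apply: eq_Rintegral => y _; rewrite -sumrN; apply: eq_bigr => j _.
  rewrite partial_reflect ?mulrN ?opprK //; exact: smooth_derivable.
pose A i j y := z i j y * \int[leb]_x (w i x * phi x * partial j rho (x - y)).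
pose B i j y := z i j y * \int[leb]_x (w i x * partial j phi x * rho (x - y)).
have sA i j : summ leb (A i j).
  by have [] := kern _ _ _ (sphiw1 i tphiT) (sz1 i j) (test_partial j trho).
have sB i j : summ leb (B i j).
  by have [] := kern _ _ _ (sphiw1 i (test_partial j tphiT)) (sz1 i j) trho.
have ME y : mollified_pairing phi rho y = \sum_i \sum_j - (A i j y + B i j y).
  apply: eq_bigr => i _; apply: eq_bigr => j _.
  rewrite /A /B -mulrDr -mulrN; congr (_ * - _).
  have mtr (r : X -> R) : test_function setT r -> measurable_fun setT (fun x : X => r (x - y)).
    by move=> tr; exact: smooth_measurable (smooth_translate y (test_smooth tr)).
  have [N [_ hN]] := test_bounded (test_partial j trho).
  rewrite -RintD; first last.
  - apply: (summM_bounded (M := K)) => //; first exact: mtr.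
    exact: sphiw1 (test_partial j tphiT).
  - apply: (summM_bounded (M := N)) => //; first exact: mtr (test_partial j trho).
    exact: sphiw1 tphiT.
  apply: eq_Rintegral => x _.
  rewrite partialM; first by rewrite partial_translate; ring.
    exact: smooth_derivable.
  exact: smooth_derivable (smooth_translate y srho).
split.
  apply: (eq_summ (fun y => esym (ME y))).
  by apply: summ_sum => i _; apply: summ_sum => j _; apply: summN; exact: summD.
under eq_Rintegral do rewrite ME.
rewrite Rint_sum; last first.
  by move=> i _; apply: summ_sum => j _; apply: summN; exact: summD.
rewrite -!sumrN -big_split /=; apply: eq_bigr => i _.
rewrite E1 -!sumrN -big_split Rint_sum /=; last by move=> j _; apply: summN; exact: summD.
by apply: eq_bigr => j _; rewrite RintN ?RintD ?opprD //; exact: summD.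
Qed.

Lemma mollified_pairing_approx phi e : test_function Omega phi -> 0 < e ->
  exists2 r0, 0 < r0 & forall r, 0 < r <= r0 ->
  summ leb (mollified_pairing phi (kernel r)) /\
  `|\int[leb]_y mollified_pairing phi (kernel r) y -
     (\int[leb]_x kernel r x) * pairc z d w phi| <= e * \int[leb]_x kernel r x.
Proof.
move=> tphi e0.
have tphiT := test_subset (@subsetT _ Omega) tphi.
have [sphi [K [cK KO Kphi]]] := (test_functionP _ _).1 tphi.
have [a0 a00 Ka0] := compact_uniform_ball cK oO KO.
(* One share for each of the [m] divergence terms and the [m * n] terms with a derivative of
   [phi]. *)
pose e' := e / (m + m * n).+1%:R.
have e'0 : 0 < e' by rewrite divr_gt0.
pose P (h g : X -> R) (r : R) := forall y, ball 0 r y ->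
  `|translate_pair h g y - translate_pair h g 0| <= e'.
have HP h g : sqsumm leb h -> sqsumm leb g -> summ leb g -> exists2 r, 0 < r & P h g r.
  move=> qh qg sg; have cv (y : nat -> X) : y k @[k --> \oo] --> (0 : X) ->
    translate_pair h g (y k) @[k --> \oo] --> translate_pair h g 0.
    move=> y0; rewrite /translate_pair; under [in X in _ --> X]eq_Rintegral do rewrite add0r.
    exact: translate_L2_cvg.
  by have [r r0 hr] := seq_continuous_at0 cv e'0; exists r.
have mono h g a b : P h g a -> 0 < b <= a -> P h g b.
  by move=> H /andP[b0 ba] y yb; apply: H; exact: le_ball yb.
have [r1 r10 H1] : exists2 a, 0 < a & forall i, P (fun x => w i x * phi x) (d i) a.
  apply: finite_common_radius; first by move=> i a b; exact: mono.
  by move=> i; apply: HP => //; exact: sphiw.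
have [r2 r20 H2] : exists2 a, 0 < a & forall ij : 'I_m * 'I_n,
    P (fun x => w ij.1 x * partial ij.2 phi x) (z ij.1 ij.2) a.
  apply: finite_common_radius; first by move=> i a b; exact: mono.
  by move=> i; apply: HP => //; apply: sphiw; exact: test_partial.
exists (Num.min (a0 / 2) (Num.min r1 r2)).
  by rewrite !lt_min r10 r20 divr_gt0.
move=> r /andP[r0]; rewrite !le_min => /and3P[ra rr1 rr2].
have tk := kernel_test (n := n) r0.
have [|s1 ->] := mollified_pairingE tphi tk (kernel_support r0) _ r0 (kernel_even r).
  move=> x px; have Kx : K x by apply: contrapT => nK; rewrite Kphi ?eqxx in px.
  by apply: subset_trans (Ka0 x Kx); apply: le_ball; rewrite mulrC -ler_pdivlMr.
split=> //; rewrite pairc_expand //.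
set c := \int[leb]_x kernel r x.
have key h g : sqsumm leb h -> sqsumm leb g -> summ leb h -> summ leb g -> P h g r ->
  `|\int[leb]_y (g y * \int[leb]_x (h x * kernel r (x - y))) -
     c * \int[leb]_x (h x * g x)| <= e' * c.
  move=> qh qg sh sg HPr.
  have := @mollify_approx _ _ h g (kernel r) 1 r e' sh sg _ (test_summ tk)
   (kernel01 r) (kernel_even r) (kernel_support r0) HPr.
  rewrite /translate_pair; under [X in _ - _ * X]eq_Rintegral do rewrite add0r.
  apply=> y; apply: sqsummM => //; split.
    by apply: measurable_translate; case: qg.
  by apply: (@summ_translate _ _ y (fun x => g x ^+ 2)); case: qg.
have -> : - \sum_i \int[leb]_y (d i y * \int[leb]_x (w i x * phi x * kernel r (x - y))) -
    \sum_i \sum_j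
      \int[leb]_y (z i j y * \int[leb]_x (w i x * partial j phi x * kernel r (x - y))) -
   c * (- \sum_i \int[leb]_x (w i x * phi x * d i x) -
    \sum_i \sum_j \int[leb]_x (w i x * partial j phi x * z i j x)) =
  - (\sum_i (\int[leb]_y (d i y * \int[leb]_x (w i x * phi x * kernel r (x - y))) -
       c * \int[leb]_x (w i x * phi x * d i x)) + \sum_i \sum_j
      (\int[leb]_y (z i j y * \int[leb]_x (w i x * partial j phi x * kernel r (x - y)))
      - c * \int[leb]_x (w i x * partial j phi x * z i j x))).
  rewrite [in RHS]sumrB -mulr_sumr.
  under [in X in - (_ + X)]eq_bigr do rewrite sumrB -mulr_sumr.
  by rewrite sumrB -mulr_sumr; ring.
rewrite normrN; apply: (le_trans (ler_normD _ _)).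
apply: (@le_trans _ _ (\sum_(i < m) e' * c + \sum_(i < m) \sum_(j < n) e' * c)).
  apply: lerD.
    apply: (le_trans (ler_norm_sum _ _ _)); apply: ler_sum => i _; apply: key => //.
    + exact: sphiw.
    + exact: sphiw1.
    + by apply: mono (H1 i) _; rewrite r0.
  apply: (le_trans (ler_norm_sum _ _ _)); apply: ler_sum => i _.
  apply: (le_trans (ler_norm_sum _ _ _)); apply: ler_sum => j _; apply: key => //.
  - by apply: sphiw; exact: test_partial.
  - by apply: sphiw1; exact: test_partial.
  - by apply: mono (H2 (i, j)) _; rewrite r0.
have c0 : 0 <= c by apply: Rint_ge0 => x; have /andP[] := kernel01 r x.
rewrite !sumr_const !card_ord -mulrnA -mulrnDr -mulr_natr mulrAC ler_wpM2r //.
rewrite /e' mulrAC ler_pdivrMr // ler_wpM2l ?(ltW e0) // ler_nat mulnC.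
exact: leqnSn.
Qed.

End fixed_fields.

End pairing.

(** Integrating over the translations first gives the mass of [rho] at every [x], whatever the
    measure [P] is. *)
Lemma kernel_tonelli (R : realType) (n : nat)
    (P : {finite_measure set 'rV[R]_n -> \bar R}) (phi rho : 'rV[R]_n -> R) (M K : R) :
  measurable_fun setT phi -> (forall x, 0 <= phi x <= M) ->
  measurable_fun setT rho -> (forall x, 0 <= rho x <= K) -> summ (leb n) rho ->
  (forall x, rho (- x) = rho x) ->
  summ (leb n) (fun y => \int[P]_x (phi x * rho (x - y))) /\
  \int[leb n]_y \int[P]_x (phi x * rho (x - y)) =
    \int[P]_x phi x * \int[leb n]_y rho y.
Proof.
move=> mphi phiM mrho rhoK srho rhoN.
have phi0 x : 0 <= phi x by have /andP[] := phiM x.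
have rho0 x : 0 <= rho x by have /andP[] := rhoK x.
pose F (z : 'rV[R]_n * 'rV[R]_n) := (phi z.1 * rho (z.1 - z.2))%:E.
have mF : measurable_fun setT F.
  apply/measurable_EFinP; apply: measurable_funM.
    exact: (measurableT_comp mphi).
  exact: (measurable_kernel mrho).
have F0 z : (0 <= F z)%E by rewrite lee_fin mulr_ge0.
have sphi : summ P phi.
  apply: bounded_measurable_summ; split => //; exists M => x.
  by rewrite ger0_norm //; have /andP[] := phiM x.
have s1 y : summ P (fun x => phi x * rho (x - y)).
  apply: bounded_measurable_summ; split.
    apply: measurable_funM => //.
    exact: (measurableT_comp (measurable_kernel mrho) (measurable_pair2 y)).
  exists (M * K) => x; have /andP[a b] := phiM x; have /andP[c e] := rhoK (x - y).
  by rewrite normrM !ger0_norm // ler_pM.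
have E : (\int[leb n]_y (\int[P]_x (phi x * rho (x - y)))%:E =
    (\int[P]_x phi x * \int[leb n]_y rho y)%:E)%E.
  transitivity (\int[@sfleb R n]_y \int[P]_x F (x, y))%E.
    by apply: eq_integral => y _; rewrite EFin_Rint.
  rewrite -(@fubini_tonelli _ _ _ _ _ P (@sfleb R n) F mF F0).
  transitivity (\int[P]_x ((phi x)%:E * (\int[leb n]_y rho y)%:E))%E.
    apply: eq_integral => x _; rewrite /F /=.
    have sx : summ (leb n) (fun y => rho (x - y)).
      apply: eq_summ (summ_translate (- x) srho) => y /=.
      by rewrite -rhoN opprD opprK.
    have -> : \int[leb n]_y rho y = \int[leb n]_y rho (x - y).
      rewrite -(Rint_translate (- x) mrho); apply: eq_Rintegral => y _.
      by rewrite -rhoN opprD opprK.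
    rewrite -EFinM -RintZ // EFin_Rint //; exact: summZ.
  have -> : (\int[P]_x phi x * \int[leb n]_y rho y = \int[P]_x (\int[leb n]_y rho y * phi x))%R.
    by rewrite RintZ // mulrC.
  rewrite (EFin_Rint (summZ _ sphi)).
  by apply: eq_integral => x _; rewrite -EFinM mulrC.
have S : summ (leb n) (fun y => \int[P]_x (phi x * rho (x - y))).
  have mG := @measurable_fun_fubini_tonelli_G _ _ _ _ _ P _ mF F0.
  apply/integrableP; split.
    apply: eq_measurable_fun mG => y _ /=.
    by rewrite /fubini_G EFin_Rint.
  rewrite (eq_integral (fun y : 'rV[R]_n => (\int[P]_x (phi x * rho (x - y)))%:E)).
    by rewrite E ltry.
  by move=> y _ /=; rewrite ger0_norm //; apply: Rint_ge0 => x; exact: mulr_ge0.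
split=> //; apply: EFin_inj; rewrite EFin_Rint //.
Qed.

(** * Two limits of the mollified pairing *)

Section pairing_estimates.
Context {R : realType} {m n : nat}.
Local Notation X := 'rV[R]_n.
Local Notation leb := (leb n).
Variable Omega : set X.
Hypotheses (oO : open Omega) (bO : bounded_set Omega).
Variables (z : 'I_m -> 'I_n -> X -> R) (d w : 'I_m -> X -> R) (M : R).
Hypotheses (mz : forall i j, measurable_fun setT (z i j))
  (zM : forall i j x, `|z i j x| <= M) (vz : forall i j, vanish_outside Omega (z i j))
  (sd : forall i, sqsumm leb (d i)) (vd : forall i, vanish_outside Omega (d i))
  (sw : forall i, sqsumm leb (w i)) (vw : forall i, vanish_outside Omega (w i))
  (zd : weak_divc Omega z d).

Let approx phi e tphi e0 := @mollified_pairing_approx R m n Omega oO bO z d w M mz zM vz sd vd sw vw zd phi e tphi e0.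

(** In the mollified pairing the gradient may be replaced by the measures, and by Tonelli mollifying
    [|phi|] only multiplies its integral against a measure by the mass of the kernel. The bound thus
    does not deteriorate as the kernel shrinks, and the mass cancels. *)
Lemma pairc_bound (P N : 'I_m -> 'I_n -> {finite_measure set X -> \bar R}) phi :
  (forall psi, test_function Omega psi -> forall y,
    \sum_i \sum_j z i j y * weak_partial (w i) j psi =
    \sum_i \sum_j z i j y * (\int[P i j]_x psi x - \int[N i j]_x psi x)) ->
  test_function Omega phi ->
  `|pairc z d w phi| <=
    M * \sum_i \sum_j (\int[P i j]_x `|phi x| + \int[N i j]_x `|phi x|).
Proof.
move=> H tphi; set S := \sum_i _.
apply/ler_addgt0Pr => e e0; have [r r0 /(_ r)[]] := approx tphi e0.
  by rewrite r0 lexx.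
set I := \int[leb]_y _; set c := \int[leb]_x _ => sI hI.
have c0 : 0 < c by exact: kernel_mass_gt0.
rewrite -(ler_pM2l c0) -[X in X * `|_|](gtr0_norm c0) -normrM.
have -> : c * pairc z d w phi = I - (I - c * pairc z d w phi) by rewrite opprB addrC subrK.
apply: (le_trans (ler_normB _ _)); rewrite mulrDr; apply: lerD; last by rewrite [leRHS]mulrC.
have [K [K0 hK]] := test_bounded tphi.
have mphi := smooth_measurable (test_smooth tphi).
have tk := kernel_test (n := n) r0.
have mk := smooth_measurable (test_smooth tk).
pose G (Q : {finite_measure set X -> \bar R}) y := \int[Q]_x (`|phi x| * kernel r (x - y)).
have GP Q : summ leb (G Q) /\ \int[leb]_y G Q y = \int[Q]_x `|phi x| * c.
  apply: (@kernel_tonelli _ _ Q (fun x => `|phi x|) (kernel r) K 1) => //.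
  - exact: measurableT_comp.
  - by move=> x; rewrite normr_ge0 hK.
  - exact: kernel01.
  - exact: test_summ tk.
  - exact: kernel_even.
have tpk y : test_function Omega (fun x => phi x * kernel r (x - y)).
  by apply: testM => //; exact: smooth_translate (test_smooth tk).
have GI (Q : {finite_measure set X -> \bar R}) (y : X) : `|\int[Q]_x (phi x * kernel r (x - y))| <= G Q y.
  apply: le_normr_Rint.
  - by apply: bounded_measurable_summ; exact: test_bounded_measurable (tpk y).
  - apply: eq_summ (summ_norm (bounded_measurable_summ Q (test_bounded_measurable (tpk y)))) => x.
    by rewrite normrM [X in _ * X]ger0_norm //; have /andP[] := kernel01 r (x - y).
  - by move=> x; rewrite normrM [X in _ * X]ger0_norm //; have /andP[] := kernel01 r (x - y).
apply: (@le_trans _ _ (\int[leb]_y (\sum_i \sum_j M * (G (P i j) y + G (N i j) y)))).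
  apply: le_normr_Rint => //.
    apply: summ_sum => i _; apply: summ_sum => j _; apply: summZ; apply: summD.
      by have [] := GP (P i j).
    by have [] := GP (N i j).
  move=> y; rewrite /mollified_pairing H //.
  apply: (le_trans (ler_norm_sum _ _ _)); apply: ler_sum => i _.
  apply: (le_trans (ler_norm_sum _ _ _)); apply: ler_sum => j _.
  rewrite normrM ler_pM //.
  by apply: (le_trans (ler_normB _ _)); apply: lerD.
have sG i j : summ leb (fun y => M * (G (P i j) y + G (N i j) y)).
  by apply: summZ; apply: summD; [have [] := GP (P i j)|have [] := GP (N i j)].
rewrite Rint_sum; last by move=> i _; exact: summ_sum.
rewrite mulrCA mulr_sumr le_eqVlt; apply/orP; left; apply/eqP.
rewrite mulr_sumr; apply: eq_bigr => i _.
rewrite Rint_sum // !mulr_sumr; apply: eq_bigr => j _.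
have [s1 e1] := GP (P i j); have [s2 e2] := GP (N i j).
by rewrite RintZ ?RintD ?e1 ?e2 //; [ring | exact: summD].
Qed.

(** When the gradient is an L^1 function, the mollified pairing can also be evaluated by continuity
    of translation in L^1; the two limits must agree. *)
Lemma pairc_weak_gradient (G : 'I_m -> 'I_n -> X -> R) phi :
  (forall i j, summ leb (G i j)) ->
  (forall psi, test_function Omega psi -> forall i j,
    weak_partial (w i) j psi = \int[leb]_x (G i j x * psi x)) ->
  test_function Omega phi ->
  pairc z d w phi = \sum_i \sum_j \int[leb]_x (G i j x * phi x * z i j x).
Proof.
move=> sG H tphi.
have [K [K0 hK]] := test_bounded tphi.
have mphi := smooth_measurable (test_smooth tphi).
have sGp i j : summ leb (fun x => G i j x * phi x) by exact: summM_bounded hK _.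
have sz i j : summ leb (z i j).
  apply: (vanish_sqsumm_summ bO _ (vz i j)).
  by apply: (vanish_bounded_sqsumm bO _ (vz i j)); split=> //; exists M.
have szt i j y : summ leb (fun x => G i j x * phi x * z i j (y + x)).
  by apply: (@summM_bounded _ _ _ _ M) => //; exact: measurable_translate.
have radius e : 0 < e -> exists2 a, 0 < a & forall ij : 'I_m * 'I_n,
    forall y, ball 0 a y ->
   `|translate_pair (fun x => G ij.1 ij.2 x * phi x) (z ij.1 ij.2) y -
     translate_pair (fun x => G ij.1 ij.2 x * phi x) (z ij.1 ij.2) 0| <= e.
  move=> e0; apply: finite_common_radius.
    by move=> ij a b h /andP[b0 ba] y yb; apply: h; exact: le_ball yb.
  move=> [i j] /=.
  set h := fun x => G i j x * phi x.
  have cv (y : nat -> X) : y k @[k --> \oo] --> (0 : X) ->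
    translate_pair h (z i j) (y k) @[k --> \oo] --> translate_pair h (z i j) 0.
    move=> y0; rewrite /translate_pair; under [in X in _ --> X]eq_Rintegral do rewrite add0r.
    exact: (translate_L1_cvg y0 (sGp i j) (mz i j) (zM i j)).
  by have [r r0 hr] := seq_continuous_at0 cv e0; exists r.
set J := RHS.
suff key e : 0 < e -> `|pairc z d w phi - J| <= e.
  by apply/eqP; rewrite -subr_eq0 -normr_le0; apply/ler_addgt0Pr => e e0; rewrite add0r key.
move=> e0.
(* One share for the approximation of the pairing, and one for each of the [m * n] products. *)
pose e' := e / (1 + m * n)%:R.
have e'0 : 0 < e' by rewrite divr_gt0.
have [r1 r10 h1] := approx tphi e'0.
have [r2 r20 h2] := radius e' e'0.
pose r := Num.min r1 r2.
have r0 : 0 < r by rewrite lt_min r10.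
have [|sI hI] := h1 r; first by rewrite r0 /r ge_min lexx.
set I := \int[leb]_y _ in hI; set c := \int[leb]_x _ in hI.
have c0 : 0 < c by exact: kernel_mass_gt0.
rewrite -(ler_pM2l c0) -[X in X * `|_|](gtr0_norm c0) -normrM.
have -> : c * (pairc z d w phi - J) = (I - c * J) - (I - c * pairc z d w phi) by ring.
apply: (le_trans (ler_normB _ _)).
have tk := kernel_test (n := n) r0.
have [K' [_ hK']] := test_bounded tk.
have mk := measurable_kernel (smooth_measurable (test_smooth tk)).
have kern i j : summ leb (fun y => z i j y * \int[leb]_x (G i j x * phi x * kernel r (x - y))).
  by have [] := @Rint_fubini_kernel _ _ _ _ (fun zz => kernel r (zz.1 - zz.2)) K' (sGp i j) (sz i j) mk (fun zz => hK' _).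
have EI : I = \sum_i \sum_j \int[leb]_y (z i j y * \int[leb]_x (G i j x * phi x * kernel r (x - y))).
  rewrite /I.
  transitivity (\int[leb]_y (\sum_i \sum_j z i j y * \int[leb]_x (G i j x * phi x * kernel r (x - y)))).
    apply: eq_Rintegral => y _; apply: eq_bigr => i _; apply: eq_bigr => j _.
    congr (_ * _); rewrite H; last first.
      by apply: testM => //; exact: smooth_translate (test_smooth tk).
    by apply: eq_Rintegral => x _; rewrite mulrA.
  rewrite Rint_sum; last by move=> i _; exact: summ_sum.
  by apply: eq_bigr => i _; rewrite Rint_sum.
have step : `|I - c * J| <= \sum_(i < m) \sum_(j < n) e' * c.
  rewrite EI /J mulr_sumr -sumrB; apply: (le_trans (ler_norm_sum _ _ _)).
  apply: ler_sum => i _; rewrite mulr_sumr -sumrB.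
  apply: (le_trans (ler_norm_sum _ _ _)); apply: ler_sum => j _.
  have := @mollify_approx _ _ (fun x => G i j x * phi x) (z i j) (kernel r) 1 r e'
    (sGp i j) (sz i j) (szt i j) (test_summ tk) (kernel01 r) (kernel_even r) (kernel_support r0).
  rewrite /translate_pair; under [X in _ - _ * X]eq_Rintegral do rewrite add0r.
  apply=> y yr; apply: (h2 (i, j)); apply: le_ball yr.
  by rewrite /r ge_min lexx orbT.
apply: (le_trans (lerD step hI)).
rewrite !sumr_const !card_ord -mulrnA -mulrSr -mulr_natr [leRHS]mulrC mulrAC ler_wpM2r ?(ltW c0) //.
rewrite /e' mulrAC ler_pdivrMr // ler_wpM2l ?(ltW e0) // ler_nat mulnC.
by rewrite add1n.
Qed.

End pairing_estimates.

(** * Fields and functions of bounded A-variation *)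

Section fields.
Context {R : realType} {m n : nat}.
Local Notation X := 'rV[R]_n.
Local Notation leb := (leb n).
Variable Omega : set X.
Hypotheses (oO : open Omega) (bO : bounded_set Omega).
Variable A : {linear 'M[R]_(m, n) -> 'M[R]_(m, n)}.
Implicit Types (z : 'I_m -> 'I_n -> X -> R) (d w : 'I_m -> X -> R).
Implicit Types (P N : 'I_m -> 'I_n -> {finite_measure set X -> \bar R}).

Definition field_mx z (x : X) : 'M[R]_(m, n) := \matrix_(i, j) z i j x.

(** The bound and [A z = z] are required at every point, which a change on a null set achieves; the
    estimates can then be made pointwise in [y]. *)
Record field (U : set X) z d : Prop := Field {
  field_measurable : forall i j, measurable_fun setT (z i j);
  field_bounded : exists M : R, forall i j x, `|z i j x| <= M;
  field_vanish : forall i j, vanish_outside Omega (z i j);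
  field_fixed : forall x, A (field_mx z x) = field_mx z x;
  field_sqsumm : forall i, sqsumm leb (d i);
  field_div_vanish : forall i, vanish_outside Omega (d i);
  field_div : weak_divc U z d }.

(** Only contractions with matrices fixed by [A] are represented by measures, since the full
    gradient of [w] need not be one. *)
Record bva w P N : Prop := Bva {
  bva_sqsumm : forall i, sqsumm leb (w i);
  bva_vanish : forall i, vanish_outside Omega (w i);
  bva_measures : forall y, A y = y -> forall psi, test_function Omega psi ->
    \sum_i \sum_j y i j * weak_partial (w i) j psi =
    \sum_i \sum_j y i j * (\int[P i j]_x psi x - \int[N i j]_x psi x) }.

Lemma field_subset (U V : set X) z d : V `<=` U -> field U z d -> field V z d.
Proof.
by move=> VU [h1 h2 h3 h4 h5 h6 h7]; split=> // psi t i; apply: h7; exact: test_subset t.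
Qed.

(** The sum of all [P i j] and [N i j]. It is chosen before [w] and [z], and so gives all translates
    of a field the same bound. *)
Lemma bva_total_measure P N :
  exists mu : {finite_measure set X -> \bar R},
  forall w, bva w P N -> forall z d M, field Omega z d ->
  (forall i j x, `|z i j x| <= M) ->
  forall phi, test_function Omega phi ->
  `|pairc z d w phi| <= M * \int[mu]_x `|phi x|.
Proof.
have [mu hmu] := finite_measure_sum
  ([seq P ij.1 ij.2 | ij <- index_enum ('I_m * 'I_n)%type] ++ [seq N ij.1 ij.2 | ij <- index_enum ('I_m * 'I_n)%type]).
exists mu => w [sw vw wPN] z d M [h1 _ h3 h4 h5 h6 h7] zM phi tphi.
rewrite -hmu; last exact: test_bounded_measurable tphi.
have -> : \sum_(q <- [seq P ij.1 ij.2 | ij <- index_enum ('I_m * 'I_n)%type] ++ [seq N ij.1 ij.2 | ij <- index_enum ('I_m * 'I_n)%type])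
    \int[q]_x `|phi x| =
  \sum_i \sum_j (\int[P i j]_x `|phi x| + \int[N i j]_x `|phi x|).
  rewrite big_cat !big_map /= pair_big /= -big_split /=.
  by apply: eq_bigr => ij _.
apply: (pairc_bound oO bO h1 zM h3 h5 h6 sw vw h7) => //.
move=> psi tpsi y; have := wPN (field_mx z y) (h4 y) psi tpsi.
under eq_bigr do under eq_bigr do rewrite mxE.
by under [RHS]eq_bigr do under eq_bigr do rewrite mxE.
Qed.

Lemma pairc_linear z d w : field Omega z d -> (forall i, sqsumm leb (w i)) ->
  (forall i, vanish_outside Omega (w i)) ->
  forall a phi psi, test_function Omega phi -> test_function Omega psi ->
  pairc z d w (fun x => a * phi x + psi x) = a * pairc z d w phi + pairc z d w psi.
Proof.
move=> [h1 [M h2] h3 h4 h5 h6 h7] sw vw a phi psi tp ts.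
have TT q : test_function Omega q -> test_function setT q.
  exact: test_subset (@subsetT _ _).
rewrite !(pairc_expand bO h1 h2 h3 h5 sw) //; try exact: TT; last first.
  by apply: TT; apply: testD => //; exact: testZ.
have sw' q i : test_function Omega q -> sqsumm leb (fun x => w i x * q x).
  move=> /TT /test_bounded_measurable[mq [K hK]]; exact: sqsummM_bounded hK _.
have sz i j : sqsumm leb (z i j).
  by apply: (vanish_bounded_sqsumm bO _ (h3 i j)); split=> //; exists M.
have s1 q i : test_function Omega q -> summ leb (fun x => w i x * q x * d i x).
  by move=> tq; apply: sqsummM => //; exact: sw'.
have s2 q i j : test_function Omega q -> summ leb (fun x => w i x * partial j q x * z i j x).
  by move=> tq; apply: sqsummM => //; apply: sw'; exact: test_partial.
have E1 i : \int[leb]_x (w i x * (a * phi x + psi x) * d i x) =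
    a * \int[leb]_x (w i x * phi x * d i x) + \int[leb]_x (w i x * psi x * d i x).
  rewrite -RintZ; last exact: s1.
  rewrite -RintD; [|by apply: summZ; exact: s1|exact: s1].
  by apply: eq_Rintegral => x _; ring.
have E2 i j : \int[leb]_x (w i x * partial j (fun x => a * phi x + psi x) x * z i j x) =
    a * \int[leb]_x (w i x * partial j phi x * z i j x) +
    \int[leb]_x (w i x * partial j psi x * z i j x).
  rewrite -RintZ; last exact: s2.
  rewrite -RintD; [|by apply: summZ; exact: s2|exact: s2].
  apply: eq_Rintegral => x _; rewrite partialD.
  - by rewrite partialZ; [ring|exact: smooth_derivable (test_smooth tp)].
  - by apply: smooth_derivable; exact: test_smooth (testZ a tp).
  - exact: smooth_derivable (test_smooth ts).
have S1 : \sum_i \int[leb]_x (w i x * (a * phi x + psi x) * d i x) =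
    a * (\sum_i \int[leb]_x (w i x * phi x * d i x)) +
    \sum_i \int[leb]_x (w i x * psi x * d i x).
  by rewrite mulr_sumr -big_split; apply: eq_bigr => i _; exact: E1.
have S2 : \sum_i \sum_j \int[leb]_x (w i x * partial j (fun x => a * phi x + psi x) x * z i j x) =
    a * (\sum_i \sum_j \int[leb]_x (w i x * partial j phi x * z i j x)) +
    \sum_i \sum_j \int[leb]_x (w i x * partial j psi x * z i j x).
  rewrite mulr_sumr -big_split; apply: eq_bigr => i _.
  by rewrite mulr_sumr -big_split; apply: eq_bigr => j _; exact: E2.
have comb (p q r p' q' r' : R) : p = a * q + r -> p' = a * q' + r' ->
    - p - p' = a * (- q - q') + (- r - r') by move=> -> ->; ring.
exact: comb S1 S2.
Qed.

(** The bound by [mu] lets Hahn-Banach extend the pairing from test functions to bounded measurable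
    functions, where a functional dominated by [mu] is a difference of two measures. *)
Lemma pairc_measures z d w P N : field Omega z d -> bva w P N ->
  exists P' N' : {finite_measure set X -> \bar R},
    forall phi, test_function Omega phi ->
      pairc z d w phi = \int[P']_x phi x - \int[N']_x phi x.
Proof.
move=> fz bw; have [h1 [M h2] h3 h4 h5 h6 h7] := fz.
have [mu hmu] := bva_total_measure P N.
(* If [m] or [n] is 0 the bound on [z] is vacuous, and [M] may be negative. *)
pose K := Num.max M 0.
have K0 : 0 <= K by rewrite le_max lexx orbT.
have MK : M <= K by rewrite le_max lexx.
have lin := pairc_linear fz (bva_sqsumm bw) (bva_vanish bw).
pose D := @bounded_measurable _ X R.
have sD : is_subspace D by exact: bounded_measurable_subspace.
have [|||||g [lg gp gF]] := @hahn_banach_dominated _ _ D (test_function Omega)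
  (fun f => K * \int[mu]_x `|f x|) (pairc z d w) sD.
- by split=> [|a f g tf tg]; [exact: test0|apply: testD => //; exact: testZ].
- by move=> f; exact: test_bounded_measurable.
- move=> t f g bf bg /andP[t0 t1].
  have sf : summ mu (fun x => `|f x|) by apply: summ_norm; exact: bounded_measurable_summ.
  have sg : summ mu (fun x => `|g x|) by apply: summ_norm; exact: bounded_measurable_summ.
  rewrite !(mulrCA _ K) -mulrDr ler_wpM2l // -!RintZ // -RintD; try exact: summZ.
  apply: le_Rint.
  + apply: summ_norm; apply: summD; apply: summZ; exact: bounded_measurable_summ.
  + by apply: summD; exact: summZ.
  + move=> x; apply: (le_trans (ler_normD _ _)).
    by rewrite !normrM (ger0_norm t0) (@ger0_norm _ (1 - t)) // subr_ge0.
- by move=> a f g tf tg; exact: lin.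
- move=> f tf; apply: (le_trans (ler_norm _)).
  apply: (le_trans (hmu w bw z d M fz h2 f tf)).
  by rewrite ler_wpM2r // Rint_ge0.
have [|P' [N' h]] := dominated_functional_signed (mu := mu) lg K0.
  move=> f bf; rewrite ler_norml; apply/andP; split; last exact: gp.
  rewrite lerNl; have := gp _ (subspaceZ (- 1) sD bf).
  rewrite (linear_onZ _ sD lg bf) mulN1r => /le_trans; apply.
  rewrite ler_wpM2l //; apply: le_Rint.
  - by apply: summ_norm; apply: summZ; exact: bounded_measurable_summ.
  - by apply: summ_norm; exact: bounded_measurable_summ.
  - by move=> x; rewrite normrM normrN1 mul1r.
exists P', N' => phi tphi; rewrite -h ?gF //; exact: test_bounded_measurable tphi.
Qed.

End fields.

Lemma partial_eq_on (R : realType) (n : nat) (W : set 'rV[R]_n) (f g : 'rV[R]_n -> R) j x :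
  open W -> smooth f -> smooth g -> (forall y, W y -> f y = g y) -> W x ->
  partial j f x = partial j g x.
Proof.
move=> oW sf sg fg Wx; apply/eqP; rewrite -subr_eq0.
have <- : partial j (fun y => f y + (-1) * g y) x = partial j f x - partial j g x.
  rewrite partialD ?partialZ ?mulN1r //; try exact: smooth_derivable.
  exact: smooth_derivable (smoothZ _ sg).
apply/eqP; apply: (@partial_eq0 _ _ (~` W)).
- by rewrite closedC.
- by move=> y /contrapT /fg ->; rewrite mulN1r subrr.
- by move=> /(_ Wx).
Qed.

(** * Total masses as limits along exhaustions *)

Section exhaustion_limits.
Context {R : realType} {n : nat}.
Local Notation X := 'rV[R]_n.
Variables (Omega : set X) (theta : nat -> X -> R).

Definition is_exhaustion := [/\ forall k, test_function Omega (theta k),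
  forall k x, 0 <= theta k x <= 1 &
  forall x, Omega x -> exists N, forall k, (N <= k)%N -> theta k x = 1].

Hypothesis ex : is_exhaustion.

Lemma exhaustion_cvg x : theta k x @[k --> \oo] --> (\1_Omega x : R).
Proof.
have [h1 h2 h3] := ex; have [xO|xO] := pselect (Omega x).
  have [N hN] := h3 x xO; rewrite indicE mem_set //.
  apply: (@cvg_trans _ (1 @[_ --> \oo])); last exact: cvg_cst.
  by apply: near_eq_cvg; exists N => // k /= Nk; rewrite hN.
rewrite indicE memNset //.
apply: (@cvg_trans _ (0 @[_ --> \oo])); last exact: cvg_cst.
apply: near_eq_cvg; apply: nearW => k /=.
by have [_ [K [_ KO hK]]] := (test_functionP _ _).1 (h1 k); rewrite hK // => /KO.
Qed.

Lemma exhaustion_Rint_cvg (mu : {measure set X -> \bar R}) (g : X -> R) :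
  open Omega -> summ mu g ->
  \int[mu]_x (g x * theta k x) @[k --> \oo] --> \int[mu]_x (g x * \1_Omega x).
Proof.
move=> oO sg; have [h1 h2 h3] := ex.
have mg := summ_measurable sg.
apply: (Rint_dominated (g := fun x => `|g x|)).
- by move=> k; apply: measurable_funM => //; exact: smooth_measurable (test_smooth (h1 k)).
- apply: measurable_funM => //; apply: measurable_indic; exact: open_measurable_rV.
- by move=> x; apply: cvgM; [exact: cvg_cst|exact: exhaustion_cvg].
- exact: summ_norm.
- move=> k x; have /andP[t0 t1] := h2 k x; rewrite normrM (ger0_norm t0).
  exact: ler_piMr.
Qed.

(** Hence the total mass on [Omega] depends only on the values on test functions, not on the
    representing pair of measures. *)
Lemma exhaustion_mass_cvg (P N : {finite_measure set X -> \bar R}) : open Omega ->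
  \int[P]_x theta k x - \int[N]_x theta k x @[k --> \oo] --> fine (P Omega) - fine (N Omega).
Proof.
move=> oO; have mO := open_measurable_rV oO.
have H (Q : {finite_measure set X -> \bar R}) :
    \int[Q]_x theta k x @[k --> \oo] --> fine (Q Omega).
  have s1 : summ Q (fun=> 1 : R) by apply: bounded_measurable_summ; split=> //; exists 1 => x; rewrite normr1.
  have -> : fine (Q Omega) = \int[Q]_x (1 * \1_Omega x : R).
    under eq_Rintegral do rewrite mul1r.
    by rewrite /Rintegral integral_indic // setIT.
  under eq_fun do (under eq_Rintegral do rewrite -[theta _ _]mul1r).
  exact: exhaustion_Rint_cvg.
by apply: cvgB.
Qed.

End exhaustion_limits.

Lemma paircE (R : realType) (m n : nat) (z : 'I_m -> 'I_n -> 'rV[R]_n -> R)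
    (d w : 'I_m -> 'rV[R]_n -> R) (phi : 'rV[R]_n -> R) :
  pairc z d w phi = - \int[leb n]_x (\sum_i phi x * d i x * w i x +
                 \sum_i \sum_j partial j phi x * z i j x * w i x).
Proof. by []. Qed.

(* Otherwise unification unfolds the pairings and compares their integrands. *)
Opaque pairc.

(** * The flux through the boundary *)

Section flux.
Context {R : realType} {m n : nat}.
Local Notation X := 'rV[R]_n.
Local Notation leb := (leb n).
Variable Omega : set X.
Hypotheses (oO : open Omega) (bO : bounded_set Omega).
Variable A : {linear 'M[R]_(m, n) -> 'M[R]_(m, n)}.
Local Notation field := (field Omega A).
Local Notation bva := (bva Omega A).
Variables (w : 'I_m -> X -> R) (P N : 'I_m -> 'I_n -> {finite_measure set X -> \bar R}).
Hypothesis bw : bva w P N.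
Implicit Types (z : 'I_m -> 'I_n -> X -> R) (d : 'I_m -> X -> R).

Lemma eq_pairc_on (K : set X) z d phi psi :
  (forall i j, vanish_outside K (z i j)) -> (forall i, vanish_outside K (d i)) ->
  (forall x, K x -> phi x = psi x /\ forall j, partial j phi x = partial j psi x) ->
  pairc z d w phi = pairc z d w psi.
Proof.
move=> vz vd h; rewrite !paircE; apply: congr1; apply: eq_Rintegral => x _.
have [Kx|nKx] := pselect (K x).
  have [e h'] := h x Kx; apply: (congr2 +%R).
    by apply: eq_bigr => i _; rewrite e.
  by apply: eq_bigr => i _; apply: eq_bigr => j _; rewrite h'.
apply: (congr2 +%R); first by apply: eq_bigr => i _; rewrite vd // !mulr0 !mul0r.
by apply: eq_bigr => i _; apply: eq_bigr => j _; rewrite vz // !mulr0 !mul0r.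
Qed.

(** Let [eta] be a cutoff equal to 1 near [K]. Its derivatives vanish on the support of [z], so the
    pairing at [eta] is minus the divergence term, while the pairing does not distinguish [theta]
    from [theta * eta]. What remains is the pairing at [theta * eta - eta], bounded by the mass that
    [theta] leaves uncovered. Neither [K] nor [eta] appears in the bound. *)
Lemma flux_compact_bound (mu : {finite_measure set X -> \bar R}) z d (K : set X) M theta :
  (forall phi, test_function Omega phi -> `|pairc z d w phi| <= M * \int[mu]_x `|phi x|) ->
  field setT z d -> 0 <= M ->
  compact K -> K `<=` Omega ->
  (forall i j, vanish_outside K (z i j)) -> (forall i, vanish_outside K (d i)) ->
  test_function Omega theta -> (forall x, 0 <= theta x <= 1) ->
  `|pairc z d w theta + \int[leb]_x (\sum_i d i x * w i x)| <=
     M * \int[mu]_x `|\1_Omega x - theta x|.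
Proof.
move=> bound fz M0 cK KO vz vd tt t01.
have fO := field_subset (@subsetT _ Omega) fz.
have [eta [W [te e01 oW KW eW]]] := cutoff cK oO KO.
have se := test_smooth te; have st := test_smooth tt.
have tte : test_function Omega (fun x => theta x * eta x) by exact: testM.
have E1 : pairc z d w theta = pairc z d w (fun x => theta x * eta x).
  have H y : W y -> theta y = theta y * eta y by move=> Wy; rewrite (eW y Wy) mulr1.
  apply: (eq_pairc_on vz vd) => x /KW Wx; split; first exact: H.
  move=> j; exact: (@partial_eq_on _ _ W _ _ j x oW st (test_smooth tte) H Wx).
have E2 : pairc z d w eta = - \int[leb]_x (\sum_i d i x * w i x).
  rewrite paircE; apply: congr1; apply: eq_Rintegral => x _.
  have [Kx|nKx] := pselect (K x); last first.
    have e1 : \sum_i eta x * d i x * w i x = 0.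
      by apply: big1 => i _; rewrite (vd i x nKx) mulr0 mul0r.
    have e2 : \sum_i \sum_j partial j eta x * z i j x * w i x = 0.
      by apply: big1 => i _; apply: big1 => j _; rewrite (vz i j x nKx) mulr0 mul0r.
    have e3 : \sum_i d i x * w i x = 0.
      by apply: big1 => i _; rewrite (vd i x nKx) mul0r.
    exact: (etrans (congr2 +%R e1 e2) (etrans (addr0 0) (esym e3))).
  have e1 : \sum_i eta x * d i x * w i x = \sum_i d i x * w i x.
    by apply: eq_bigr => i _; rewrite (eW x (KW x Kx)) mul1r.
  have e2 : \sum_i \sum_j partial j eta x * z i j x * w i x = 0.
    apply: big1 => i _; apply: big1 => j _.
    have -> : partial j eta x = 0.
      rewrite -[RHS](congr1 (fun h => h x) (partial_cst (n := n) j (1 : R))).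
      exact: (@partial_eq_on _ _ W _ _ j x oW se (smooth_cst 1) eW (KW x Kx)).
    by rewrite !mul0r.
  exact: (etrans (congr2 +%R e1 e2) (addr0 _)).
have L := pairc_linear bO fO (bva_sqsumm bw) (bva_vanish bw) (-1) te tte.
have E3 : pairc z d w theta + \int[leb]_x (\sum_i d i x * w i x) =
    pairc z d w (fun x => (-1) * eta x + theta x * eta x).
  apply: etrans (esym L).
  have comb (p q r s : R) : p = q -> r = - s -> p + s = (-1) * r + q.
    by move=> -> ->; ring.
  exact: comb E1 E2.
have td : test_function Omega (fun x => (-1) * eta x + theta x * eta x).
  exact: testD (testZ (-1) te) tte.
apply: (le_trans (eq_ind_r (fun t => `|t| <= _) (bound _ td) E3)).
(* [done] tries [discriminate] on these equations, which normalises the integrals *)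
clear E1 E2 L E3.
apply: ler_wpM2l; first exact: M0.
apply: le_Rint.
- by apply: summ_norm; apply: bounded_measurable_summ; exact: test_bounded_measurable td.
- apply: summ_norm; apply: summB.
    apply: summ_indic; first exact: open_measurable_rV.
    by rewrite -ge0_fin_numE // fin_num_measure //; exact: open_measurable_rV.
  by apply: bounded_measurable_summ; exact: test_bounded_measurable tt.
- move=> x; have [xO|xO] := pselect (Omega x); last first.
    have [_ [K' [_ K'O hK']]] := (test_functionP _ _).1 te.
    by rewrite hK' ?mulr0 ?addr0 ?normr0 // => /K'O.
  have /andP[t0 t1] := t01 x; have /andP[e0 e1] := e01 x.
  rewrite indicE mem_set // -mulrDl normrM mulrC distrC addrC.
  by apply: ler_piMl => //; rewrite ger0_norm.
Qed.

End flux.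

Lemma snocZ1 (R : realType) (n : nat) (t : R) : t *: snoc (0 : 'rV[R]_n, 1) = snoc (0, t).
Proof.
apply/rowP => i; rewrite !mxE /=.
by case: (unlift _ _) => [j|] /=; rewrite ?mxE ?mulr0 ?mulr1.
Qed.

(** Compares the Euclidean norm of the charts with the sup norm of the topology; dividing by [n.+2]
    rather than [n.+1] leaves the inequality strict. *)
Lemma fnorm_lt_ball (R : realType) (n : nat) (p : 'rV[R]_n.+1) (rho : R) : 0 < rho ->
  exists2 e, 0 < e & forall y, ball p e y -> fnorm (y - p) < rho.
Proof.
move=> r0; exists (rho / n.+2%:R); first by rewrite divr_gt0.
move=> y /ball_rVE /(_ _) h; rewrite /fnorm -(gtr0_norm r0) -sqrtr_sqr.
rewrite ltr_sqrt ?exprn_gt0 // /frob big_ord1.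
have {}h := h (divr_gt0 r0 (ltr0Sn _ _)).
apply: (@le_lt_trans _ _ (\sum_(j < n.+1) (rho / n.+2%:R) ^+ 2)).
  apply: ler_sum => j _; rewrite -expr2 !mxE -real_normK ?num_real //.
  rewrite lerXn2r ?nnegrE // ?divr_ge0 ?(ltW r0) //.
  by rewrite distrC; exact: ltW (h j).
rewrite sumr_const card_ord expr_div_n -[X in X < _]mulr_natr -mulrA gtr_pMr ?exprn_gt0 //.
rewrite mulrC ltr_pdivrMr ?exprn_gt0 // mul1r -natrX ltr_nat.
by rewrite expnS expn1 mulSn ltn_addr.
Qed.

Lemma coord_le_norm (R : realType) (n : nat) (x : 'rV[R]_n) j : `|x 0 j| <= `|x|.
Proof. by rewrite [`|x|]mx_normrE (le_bigmax _ (fun i => `|x i.1 i.2|) (0, j)). Qed.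

(** In the rotated coordinates a point of the closure lies on or above the graph, because [g] is
    continuous. Moving it along the last axis, whose image under the rotation is [tau], puts it
    strictly above. *)
Lemma chart_shift (R : realType) (n : nat) (Omega : set 'rV[R]_n.+1) (p : 'rV[R]_n.+1) :
  lipschitz_boundary Omega -> bd Omega p ->
  exists e : R, exists tau : 'rV[R]_n.+1, 0 < e /\
    forall x, closure Omega x -> ball p e x -> forall t, 0 < t < e -> Omega (x + t *: tau).
Proof.
move=> hl hp; have [Q [g [rho [QQ lg rho0 chart]]]] := hl p hp.
have QQ' : Q^T *m Q = 1%:M by exact: mulmx1C.
have [e e0 he] := fnorm_lt_ball p rho0.
pose tau := snoc (0 : 'rV[R]_n, 1) *m Q.
pose c := `|tau| + 1; have c0 : 0 < c by rewrite ltr_wpDl.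
exists (Num.min (e / 2) (e / 2 / c)), tau; split.
  by rewrite lt_min !divr_gt0.
move=> x xO; rewrite -ball_normE /= => xp t /andP[t0].
rewrite lt_min => /andP[_ te].
have {}xp : `|p - x| < e / 2 by rewrite (lt_le_trans xp) // ge_min lexx.
pose V (y : 'rV[R]_n.+1) : 'rV[R]_n := \row_j (y *m Q^T) 0 (lift ord_max j).
pose S (y : 'rV[R]_n.+1) := (y *m Q^T) 0 ord_max.
have VS y : y = snoc (V y, S y) *m Q.
  by rewrite -(snoc_surj (y *m Q^T)) -mulmxA QQ' mulmx1.
have lin (j : 'I_n.+1) (a b : 'rV[R]_n.+1) : `|(a *m Q^T) 0 j - (b *m Q^T) 0 j| <=
   (\sum_k `|Q j k|) * `|a - b|.
  have -> : (a *m Q^T) 0 j - (b *m Q^T) 0 j = ((a - b) *m Q^T) 0 j.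
    by rewrite mulmxBl !mxE.
  rewrite mxE mulr_suml; apply: (le_trans (ler_norm_sum _ _ _)); apply: ler_sum => k _.
  rewrite normrM mulrC !mxE ler_wpM2l //.
  by have := coord_le_norm (a - b) k; rewrite !mxE.
have gs : g (V x) <= S x.
  rewrite leNgt; apply/negP => lt; pose dl := g (V x) - S x.
  have dl0 : 0 < dl by rewrite subr_gt0.
  have [K K0 hK] : exists2 K, 0 < K & forall a b, `|g a - g b| <= K * `|a - b|.
    have [K [K0 hK]] := pinfty_ex_gt0 lg; exists K => // a b; exact: (hK (a, b)).
  pose C : R := (\sum_j \sum_k `|Q j k|) + 1.
  have C0 : 0 < C by rewrite ltr_wpDl // sumr_ge0 // => j _; exact: sumr_ge0.
  have jC j : \sum_k `|Q j k| <= C.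
    apply: (@le_trans _ _ (\sum_j \sum_k `|Q j k|)); last by rewrite /C lerDl.
    rewrite [leRHS](bigD1 j) //= lerDl sumr_ge0 // => i _.
    exact: sumr_ge0.
  (* A point of [Omega] this close to [x] is still in the chart, and neither the rotation, with
     constant [C], nor the graph, with constant [K], can bridge the gap [dl] over that distance. *)
  pose eta := Num.min (e / 2) (dl / ((K + 1) * C)).
  have eta0 : 0 < eta by rewrite lt_min !divr_gt0 // mulr_gt0 // addr_gt0.
  have [y [yO xy]] := xO _ (nbhsx_ballx x eta eta0).
  have nxy : `|y - x| < eta by move: xy; rewrite -ball_normE /= distrC.
  have Vy : `|V y - V x| < C * eta.
    suff : ball (V x) (C * eta) (V y) by rewrite -ball_normE /= distrC.
    apply/ball_rVE; first by rewrite mulr_gt0.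
    move=> j; rewrite distrC [V y 0 j]mxE [V x 0 j]mxE.
    apply: le_lt_trans (lin (lift ord_max j) y x) _.
    apply: (@le_lt_trans _ _ (C * `|y - x|)); first by rewrite ler_wpM2r.
    by rewrite ltr_pM2l.
  have Sy : S y - S x < C * eta.
    apply: le_lt_trans (ler_norm _) _; apply: le_lt_trans (lin ord_max y x) _.
    apply: (@le_lt_trans _ _ (C * `|y - x|)); first by rewrite ler_wpM2r.
    by rewrite ltr_pM2l.
  have gy : g (V x) - g (V y) <= K * (C * eta).
    apply: le_trans (ler_norm _) _; apply: le_trans (hK _ _) _.
    by rewrite ler_wpM2l ?(ltW K0) // distrC ltW.
  have eb : (K + 1) * C * eta <= dl.
    have h : eta <= dl / ((K + 1) * C) by rewrite /eta ge_min lexx orbT.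
    by rewrite mulrC -ler_pdivlMr // mulr_gt0 // addr_gt0.
  have gS : g (V y) < S y.
    apply/chart; rewrite -?VS //; apply: he.
    rewrite -ball_normE /= -(subrK x p) -addrA; apply: (le_lt_trans (ler_normD _ _)).
    rewrite [ltRHS]splitr ltrD //; rewrite distrC (lt_le_trans nxy) //.
    by rewrite /eta ge_min lexx.
  by move: gS Sy gy eb; rewrite /dl; lra.
have E : x + t *: tau = snoc (V x, S x + t) *m Q.
  by rewrite {1}(VS x) /tau scalemxAl snocZ1 -mulmxDl snocD addr0.
rewrite E; apply/chart; last by rewrite (le_lt_trans gs) // ltrDl.
rewrite -E; apply: he; rewrite -ball_normE /= opprD addrA.
apply: (le_lt_trans (ler_normB _ _)); rewrite [ltRHS]splitr ltrD //.
rewrite normrZ gtr0_norm //.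
move: te; rewrite ltr_pdivlMr // => te; apply: le_lt_trans te.
by rewrite ler_wpM2l ?ltW // /c ltrDl.
Qed.

Lemma cvgn_sum (R : realType) (I : Type) (s : seq I) (f : I -> nat -> R) (l : I -> R) :
  (forall i, f i k @[k --> \oo] --> l i) ->
  \sum_(i <- s) f i k @[k --> \oo] --> \sum_(i <- s) l i.
Proof.
move=> h; elim: s => [|i s IH].
  by rewrite big_nil; under eq_fun do rewrite big_nil; exact: cvg_cst.
by rewrite big_cons; under eq_fun do rewrite big_cons; exact: (cvgD (h i) IH).
Qed.

Lemma sqsumm_sum d (T : measurableType d) (R : realType) (mu : {measure set T -> \bar R})
    (I : Type) (s : seq I) (F : I -> T -> R) :
  (forall i, sqsumm mu (F i)) -> sqsumm mu (fun x => \sum_(i <- s) F i x).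
Proof.
move=> h; elim: s => [|i s IH].
  split; first by under eq_fun do rewrite big_nil; exact: measurable_cst.
  by apply: eq_summ (summ0 mu) => x; rewrite big_nil expr0n.
have [m1 s1] := sqsummD (h i) IH.
by split; [apply: eq_measurable_fun m1 => x _|apply: eq_summ s1 => x]; rewrite big_cons.
Qed.

(** * The Gauss-Green formula *)

Section flux_theorem.
Context {R : realType} {m n : nat}.
Local Notation X := 'rV[R]_n.
Local Notation leb := (leb n).
Variable Omega : set X.
Hypotheses (oO : open Omega) (bO : bounded_set Omega).
Variable A : {linear 'M[R]_(m, n) -> 'M[R]_(m, n)}.
Local Notation field := (field Omega A setT).
Variables (w : 'I_m -> X -> R) (P N : 'I_m -> 'I_n -> {finite_measure set X -> \bar R}).
Hypothesis bw : bva Omega A w P N.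
Implicit Types (z : 'I_m -> 'I_n -> X -> R) (d : 'I_m -> X -> R).
Variable theta : nat -> X -> R.
Hypothesis ex : is_exhaustion Omega theta.

Let TT k : test_function setT (theta k).
Proof. by have [h _ _] := ex; exact: test_subset (h k). Qed.

Let mult q i : test_function setT q -> sqsumm leb (fun x => w i x * q x).
Proof.
move=> /test_bounded_measurable[mq [K hK]].
exact: sqsummM_bounded hK (bva_sqsumm bw i).
Qed.

Let field_sq z d i j : field z d -> sqsumm leb (z i j).
Proof.
move=> fz; have [M zM] := field_bounded fz.
apply: (vanish_bounded_sqsumm bO _ (field_vanish fz i j)).
by split; [exact: field_measurable fz i j|exists M].
Qed.

Let field_summ z d i j : field z d -> summ leb (z i j).
Proof.
by move=> fz; apply: (vanish_sqsumm_summ bO _ (field_vanish fz i j)); exact: field_sq fz.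
Qed.

Let field_div_summ z d i : field z d -> summ leb (d i).
Proof.
move=> fz; apply: (vanish_sqsumm_summ bO _ (field_div_vanish fz i)).
exact: field_sqsumm fz i.
Qed.

Let expand z d phi : field z d -> test_function setT phi ->
  pairc z d w phi = - \sum_i \int[leb]_x (w i x * phi x * d i x) -
    \sum_i \sum_j \int[leb]_x (w i x * partial j phi x * z i j x).
Proof.
move=> fz tp; have [M zM] := field_bounded fz.
exact: (pairc_expand bO (field_measurable fz) zM (field_vanish fz) (field_sqsumm fz)
  (bva_sqsumm bw) tp).
Qed.

Definition div_term d := \sum_i \int[leb]_x (w i x * d i x).

Let div_termE z d : field z d -> \int[leb]_x (\sum_i d i x * w i x) = div_term d.
Proof.
move=> fz; rewrite Rint_sum; last first.
  by move=> i _; apply: sqsummM; [exact: field_sqsumm fz i|exact: bva_sqsumm bw i].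
by apply: eq_bigr => i _; apply: eq_Rintegral => x _; exact: mulrC.
Qed.

(** The left-hand side tends to the total mass of the pairing, so this is Gauss-Green for [z]
    without boundary term, stated without reference to representing measures. *)
Definition flux_ok z d := pairc z d w (theta k) @[k --> \oo] --> - div_term d.

Let eps_cvg (mu : {finite_measure set X -> \bar R}) :
  \int[mu]_x `|\1_Omega x - theta k x| @[k --> \oo] --> (0 : R).
Proof.
have [h1 h2 _] := ex.
have -> : (0 : R) = \int[mu]_x (0 : R) by rewrite Rint0.
have mO := open_measurable_rV oO.
apply: (Rint_dominated (g := fun=> 1)).
- move=> k; apply: measurableT_comp => //; apply: measurable_funB.
    exact: measurable_indic.
  exact: smooth_measurable (test_smooth (h1 k)).
- exact: measurable_cst.
- move=> x; rewrite -(normr0 R) -(subrr (\1_Omega x : R)).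
  apply: cvg_norm; apply: cvgB; [exact: cvg_cst|exact: exhaustion_cvg].
- by apply: bounded_measurable_summ; split=> //; exists 1 => x; rewrite normr1.
- move=> k x; rewrite normr_id; have /andP[t0 t1] := h2 k x.
  rewrite indicE; case: (_ \in _) => /=.
    by rewrite ger0_norm ?subr_ge0 // lerBlDr lerDl.
  by rewrite sub0r normrN ger0_norm.
Qed.

Lemma cvg_squeeze0 (u v : nat -> R) (l : R) : (forall k, `|u k - l| <= v k) ->
  v k @[k --> \oo] --> (0 : R) -> u k @[k --> \oo] --> l.
Proof.
move=> uv v0; apply/cvgrPdist_le => e e0.
have /cvgrPdist_le /(_ e e0) := v0; apply: filterS => k.
rewrite sub0r normrN => h; rewrite distrC; apply: (le_trans (uv k)).
exact: le_trans (ler_norm _) h.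
Qed.

Let flux_bound (mu : {finite_measure set X -> \bar R}) z d (K : set X) M k :
  (forall phi, test_function Omega phi -> `|pairc z d w phi| <= M * \int[mu]_x `|phi x|) ->
  field z d -> 0 <= M -> compact K -> K `<=` Omega ->
  (forall i j, vanish_outside K (z i j)) -> (forall i, vanish_outside K (d i)) ->
  `|pairc z d w (theta k) - - div_term d| <= M * \int[mu]_x `|\1_Omega x - theta k x|.
Proof.
have [h1 h2 _] := ex.
move=> bound fz M0 cK KO vz vd; rewrite opprK -(div_termE fz).
exact: (flux_compact_bound oO bO bw bound fz M0 cK KO vz vd (h1 k) (h2 k)).
Qed.

Lemma flux_compact z d (K : set X) : field z d -> compact K -> K `<=` Omega ->
  (forall i j, vanish_outside K (z i j)) -> (forall i, vanish_outside K (d i)) ->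
  flux_ok z d.
Proof.
move=> fz cK KO vz vd.
have [mu hmu] := bva_total_measure oO bO A P N.
have [M zM] := field_bounded fz.
pose M' := Num.max M 0; have M0 : 0 <= M' by rewrite le_max lexx orbT.
have zM' i j x : `|z i j x| <= M' by rewrite le_max zM.
have bd := hmu w bw z d M' (field_subset (@subsetT _ Omega) fz) zM'.
apply: (@cvg_squeeze0 _ (fun k => M' * \int[mu]_x `|\1_Omega x - theta k x|)).
  by move=> k; exact: flux_bound bd fz M0 cK KO vz vd.
by rewrite -(mulr0 M'); apply: cvgM; [exact: cvg_cst|exact: eps_cvg].
Qed.

Definition shift2 z (y : X) : 'I_m -> 'I_n -> X -> R := fun i j x => z i j (y + x).
Definition shift1 d (y : X) : 'I_m -> X -> R := fun i x => d i (y + x).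

(* The defect bound for compactly supported fields is uniform over the translates,
   so at each fixed cutoff it passes to the limit in the translation. *)
Lemma flux_shift z d (y : nat -> X) (K : nat -> set X) : field z d ->
  y l @[l --> \oo] --> (0 : X) ->
  (forall l, compact (K l) /\ K l `<=` Omega) ->
  (forall l x, ~ K l x -> (forall i j, z i j (y l + x) = 0) /\ (forall i, d i (y l + x) = 0)) ->
  flux_ok z d.
Proof.
move=> fz y0 hK vK.
have [mu hmu] := bva_total_measure oO bO A P N.
have [M zM] := field_bounded fz.
pose M' := Num.max M 0; have M0 : 0 <= M' by rewrite le_max lexx orbT.
have zM' i j x : `|z i j x| <= M' by rewrite le_max zM.
have fs l : field (shift2 z (y l)) (shift1 d (y l)).
  split.
  - by move=> i j; apply: measurable_translate; exact: field_measurable fz i j.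
  - by exists M => i j x; exact: zM.
  - by move=> i j x nO; apply: (vK l x _).1 => Kx; apply: nO; exact: (hK l).2.
  - move=> x; have := field_fixed fz (y l + x); rewrite /field_mx; exact.
  - move=> i; have [md sd] := field_sqsumm fz i; split; first exact: measurable_translate.
    exact: (@summ_translate _ _ (y l) (fun x => d i x ^+ 2)).
  - by move=> i x nO; apply: (vK l x _).2 => Kx; apply: nO; exact: (hK l).2.
  (* The divergence of a translated field is tested by translating the test function back; this is
     legitimate because test functions range over the whole space. *)
  - move=> psi tpsi i.
    have tpsi' : test_function setT (fun x => psi (x - y l)).
      have [sp [K' [cK' _ hK']]] := (test_functionP _ _).1 tpsi.
      have [r [r0 hr]] := test_support_ball tpsi.
      apply/test_functionP; split; first exact: smooth_translate.
      exists (closed_ball (y l) r); split=> //; first exact: closed_ball_compact.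
      move=> x nx; apply: hr => h; apply: nx; apply: subset_closed_ball.
      by move: h; rewrite -!ball_normE /= sub0r normrN distrC.
    have := field_div fz tpsi' i.
    have -> : \int[leb]_x (\sum_j z i j x * partial j (fun x => psi (x - y l)) x) =
        \int[leb]_x (\sum_j shift2 z (y l) i j x * partial j psi x).
      rewrite -(Rint_translate (y l)).
        apply: eq_Rintegral => x _; apply: eq_bigr => j _.
        by rewrite partial_translate addrAC subrr add0r.
      apply: measurable_sum => j; apply: measurable_funM; first exact: field_measurable fz i j.
      exact: smooth_measurable (smooth_partial j (test_smooth tpsi')).
    have -> : \int[leb]_x (d i x * psi (x - y l)) =
        \int[leb]_x (shift1 d (y l) i x * psi x).
      rewrite -(Rint_translate (y l)).
        by apply: eq_Rintegral => x _; rewrite addrAC subrr add0r.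
      apply: measurable_funM; first by case: (field_sqsumm fz i).
      exact: smooth_measurable (test_smooth tpsi').
    exact.
have bd l : forall phi, test_function Omega phi ->
    `|pairc (shift2 z (y l)) (shift1 d (y l)) w phi| <= M' * \int[mu]_x `|phi x|.
  apply: (hmu w bw _ _ M' (field_subset (@subsetT _ Omega) (fs l))).
  by move=> i j x; exact: zM'.
have cv1 q i g : test_function setT q -> sqsumm leb g -> summ leb g ->
    \int[leb]_x (w i x * q x * g (y l + x)) @[l --> \oo] --> \int[leb]_x (w i x * q x * g x).
  by move=> tq sg sg1; apply: translate_L2_cvg => //; exact: mult.
have cvp k : pairc (shift2 z (y l)) (shift1 d (y l)) w (theta k) @[l --> \oo] -->
    pairc z d w (theta k).
  rewrite (expand fz (TT k)).
  under eq_fun do rewrite (expand (fs _) (TT k)).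
  apply: cvgB.
    apply: cvgN; refine (@cvgn_sum R 'I_m _ _ _ (fun i => _)).
    exact: (cv1 _ i _ (TT k) (field_sqsumm fz i) (field_div_summ i fz)).
  refine (@cvgn_sum R 'I_m _ _ _ (fun i => _)).
  refine (@cvgn_sum R 'I_n _ _ _ (fun j => _)).
  exact: (cv1 _ i _ (test_partial j (TT k)) (field_sq i j fz) (field_summ i j fz)).
have cvd : div_term (shift1 d (y l)) @[l --> \oo] --> div_term d.
  refine (@cvgn_sum R 'I_m _ _ _ (fun i => _)).
  exact: (translate_L2_cvg y0 (bva_sqsumm bw i) (field_sqsumm fz i) (field_div_summ i fz)).
apply: (@cvg_squeeze0 _ (fun k => M' * \int[mu]_x `|\1_Omega x - theta k x|)); last first.
  by rewrite -(mulr0 M'); apply: cvgM; [exact: cvg_cst|exact: eps_cvg].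
move=> k; set b := M' * _.
have cvn : `|pairc (shift2 z (y l)) (shift1 d (y l)) w (theta k) -
    - div_term (shift1 d (y l))| @[l --> \oo] --> `|pairc z d w (theta k) - - div_term d|.
  by apply: cvg_norm; apply: cvgB => //; exact: cvgN.
apply: (closed_cvg (fun t : R => t <= b) _ _ _ cvn); first exact: closed_le.
apply: nearW => l; have [cK KO] := hK l.
apply: (flux_bound _ (bd l) (fs l) M0 cK KO).
  by move=> i j x nx; apply: (vK l x nx).1.
by move=> i x nx; apply: (vK l x nx).2.
Qed.

Definition mul2 (psi : X -> R) z : 'I_m -> 'I_n -> X -> R := fun i j x => psi x * z i j x.
Definition mul_div (psi : X -> R) z d : 'I_m -> X -> R :=
  fun i x => psi x * d i x + \sum_j partial j psi x * z i j x.

Lemma field_mul psi z d : test_function setT psi -> field z d ->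
  field (mul2 psi z) (mul_div psi z d).
Proof.
move=> tpsi fz; have [K [K0 psiK]] := test_bounded tpsi.
have spsi := test_smooth tpsi; have mpsi := smooth_measurable spsi.
have [M zM] := field_bounded fz.
have sq i j : sqsumm leb (fun x => partial j psi x * z i j x).
  have [K' [_ hK']] := test_bounded (test_partial j tpsi).
  have [m1 s1] := sqsummM_bounded (smooth_measurable (smooth_partial j spsi)) hK' (field_sq i j fz).
  split; first by apply: measurable_funM => //; [exact: smooth_measurable (smooth_partial j spsi)|exact: field_measurable fz i j].
  by apply: eq_summ s1 => x; rewrite mulrC.
have sqs i : sqsumm leb (fun x => \sum_j partial j psi x * z i j x).
  exact: sqsumm_sum.
split.
- by move=> i j; apply: measurable_funM => //; exact: field_measurable fz i j.
- exists (K * M) => i j x; rewrite normrM ler_pM //.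
- by move=> i j x nx; rewrite /mul2 (field_vanish fz i j nx) mulr0.
- move=> x.
  have -> : field_mx (mul2 psi z) x = psi x *: field_mx z x by apply/matrixP => i j; rewrite !mxE.
  by rewrite linearZ /= (field_fixed fz).
- move=> i; apply: sqsummD => //.
  have [m1 s1] := sqsummM_bounded mpsi psiK (field_sqsumm fz i).
  split; first by apply: measurable_funM => //; case: (field_sqsumm fz i).
  by apply: eq_summ s1 => x; rewrite mulrC.
- move=> i x nx; rewrite /mul_div (field_div_vanish fz i nx) mulr0 add0r big1 // => j _.
  by rewrite (field_vanish fz i j nx) mulr0.
- move=> eta teta i.
  have tpe : test_function setT (fun x => psi x * eta x) by exact: testM tpsi (test_smooth teta).
  have [B [_ hB]] := test_bounded teta; have meta := smooth_measurable (test_smooth teta).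
  have s1 j : summ leb (fun x => z i j x * partial j (fun x => psi x * eta x) x).
    have [B' [_ hB']] := test_bounded (test_partial j tpe).
    exact: summM_bounded (smooth_measurable (smooth_partial j (test_smooth tpe))) hB' (field_summ i j fz).
  have s2 : summ leb (fun x => d i x * (psi x * eta x)).
    have [B' [_ hB']] := test_bounded tpe.
    exact: summM_bounded (smooth_measurable (test_smooth tpe)) hB' (field_div_summ i fz).
  have s3 : summ leb (fun x => (\sum_j partial j psi x * z i j x) * eta x).
    apply: (summM_bounded meta hB).
    apply: summ_sum => j _; have [B' [_ hB']] := test_bounded (test_partial j tpsi).
    apply: eq_summ (summM_bounded (smooth_measurable (smooth_partial j spsi)) hB' (field_summ i j fz)) => x.
    exact: mulrC.
  have h := field_div fz tpe i.
  transitivity (\int[leb]_x (\sum_j z i j x * partial j (fun x => psi x * eta x) x -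
      (\sum_j partial j psi x * z i j x) * eta x)).
    apply: eq_Rintegral => x _; rewrite mulr_suml -sumrB; apply: eq_bigr => j _.
    rewrite (partialM (@smooth_derivable _ _ psi j x spsi) (@smooth_derivable _ _ eta j x (test_smooth teta))).
    by rewrite /mul2; ring.
  rewrite RintB //; last by apply: summ_sum => j _; exact: s1.
  rewrite h; clear h.
  rewrite -RintN // -RintB //; last exact: summN.
  rewrite -RintN; last first.
    by apply: eq_summ (summD s2 s3) => x; rewrite /mul_div; ring.
  by apply: eq_Rintegral => x _; rewrite /mul_div; ring.
Qed.

Lemma field_sub z d z' d' : field z d -> field z' d' ->
  field (fun i j x => z i j x - z' i j x) (fun i x => d i x - d' i x).
Proof.
move=> fz fz'; have [M zM] := field_bounded fz; have [M' zM'] := field_bounded fz'.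
split.
- move=> i j; apply: measurable_funB; [exact: field_measurable fz i j|exact: field_measurable fz' i j].
- by exists (M + M') => i j x; apply: (le_trans (ler_normB _ _)); exact: lerD.
- by move=> i j x nx; rewrite (field_vanish fz i j nx) (field_vanish fz' i j nx) subrr.
- move=> x.
  have -> : field_mx (fun i j x => z i j x - z' i j x) x = field_mx z x - field_mx z' x.
    by apply/matrixP => i j; rewrite !mxE.
  by rewrite linearB /= (field_fixed fz) (field_fixed fz').
- move=> i; have := sqsummD (field_sqsumm fz i) (sqsummZ (-1) (field_sqsumm fz' i)).
  by move=> [m1 s1]; split; [apply: eq_measurable_fun m1 => x _|apply: eq_summ s1 => x];
    rewrite mulN1r.
- by move=> i x nx; rewrite (field_div_vanish fz i nx) (field_div_vanish fz' i nx) subrr.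
- move=> eta teta i; have [B [_ hB]] := test_bounded teta.
  have meta := smooth_measurable (test_smooth teta).
  have s1 z'' d'' j : field z'' d'' -> summ leb (fun x => z'' i j x * partial j eta x).
    move=> f; have [B' [_ hB']] := test_bounded (test_partial j teta).
    exact: summM_bounded (smooth_measurable (smooth_partial j (test_smooth teta))) hB' (field_summ i j f).
  have s2 z'' d'' : field z'' d'' -> summ leb (fun x => d'' i x * eta x).
    move=> f; exact: summM_bounded meta hB (field_div_summ i f).
  transitivity (\int[leb]_x (\sum_j z i j x * partial j eta x - \sum_j z' i j x * partial j eta x)).
    by apply: eq_Rintegral => x _; rewrite -sumrB; apply: eq_bigr => j _; rewrite mulrBl.
  rewrite RintB; first last.
  + by apply: summ_sum => j _; exact: s1 fz'.
  + by apply: summ_sum => j _; exact: s1 fz.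
  rewrite (field_div fz teta i) (field_div fz' teta i) -opprD; congr (- _).
  rewrite -[- _ in LHS]RintN; last exact: s2 fz'.
  rewrite -RintD; [|exact: s2 fz|by apply: summN; exact: s2 fz'].
  by apply: eq_Rintegral => x _; rewrite mulrBl.
Qed.

Lemma flux_add z d z' d' : field z d -> field z' d' ->
  flux_ok z' d' -> flux_ok (fun i j x => z i j x - z' i j x) (fun i x => d i x - d' i x) ->
  flux_ok z d.
Proof.
move=> fz fz' h h'; have fs := field_sub fz fz'.
have E k : pairc z d w (theta k) = pairc z' d' w (theta k) +
   pairc (fun i j x => z i j x - z' i j x) (fun i x => d i x - d' i x) w (theta k).
  rewrite (expand fz (TT k)) (expand fz' (TT k)) (expand fs (TT k)).
  have s1 z'' d'' i : field z'' d'' -> summ leb (fun x => w i x * theta k x * d'' i x).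
    by move=> f; apply: sqsummM; [exact: mult (TT k)|exact: field_sqsumm f i].
  have s2 z'' d'' i j : field z'' d'' -> summ leb (fun x => w i x * partial j (theta k) x * z'' i j x).
    by move=> f; apply: sqsummM; [exact: mult (test_partial j (TT k))|exact: field_sq f].
  have S1 : \sum_i \int[leb]_x (w i x * theta k x * (d i x - d' i x)) =
      \sum_i \int[leb]_x (w i x * theta k x * d i x) - \sum_i \int[leb]_x (w i x * theta k x * d' i x).
    rewrite -sumrB; apply: eq_bigr => i _; rewrite -RintB; [|exact: s1 fz|exact: s1 fz'].
    by apply: eq_Rintegral => x _; rewrite mulrBr.
  have S2 : \sum_i \sum_j \int[leb]_x (w i x * partial j (theta k) x * (z i j x - z' i j x)) =
      \sum_i \sum_j \int[leb]_x (w i x * partial j (theta k) x * z i j x) -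
      \sum_i \sum_j \int[leb]_x (w i x * partial j (theta k) x * z' i j x).
    rewrite -sumrB; apply: eq_bigr => i _; rewrite -sumrB; apply: eq_bigr => j _.
    rewrite -RintB; [|exact: s2 fz|exact: s2 fz'].
    by apply: eq_Rintegral => x _; rewrite mulrBr.
  have comb (a b a' b' s t : R) : s = a - a' -> t = b - b' ->
    - a - b = (- a' - b') + (- s - t) by move=> -> ->; ring.
  exact: comb S1 S2.
rewrite /flux_ok; under eq_fun do rewrite E.
have -> : - div_term d = - div_term d' - div_term (fun i x => d i x - d' i x).
  have S : div_term (fun i x => d i x - d' i x) = div_term d - div_term d'.
    have s1 z'' d'' i : field z'' d'' -> summ leb (fun x => w i x * d'' i x).
      by move=> f; apply: sqsummM; [exact: bva_sqsumm bw i|exact: field_sqsumm f i].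
    rewrite /div_term -sumrB; apply: eq_bigr => i _; rewrite -RintB; [|exact: s1 fz|exact: s1 fz'].
    by apply: eq_Rintegral => x _; rewrite mulrBr.
  by rewrite S; ring.
exact: cvgD h h'.
Qed.

(* The only consequence of the Lipschitz boundary that is used: near [p], moving in
   the direction [tau] pushes the closure of [Omega] into [Omega]. *)
Definition shiftable (p : X) := exists e : R, exists tau : X, 0 < e /\
    forall x, closure Omega x -> ball p e x -> forall t, 0 < t < e -> Omega (x + t *: tau).

Hypothesis shift_bd : forall p, bd Omega p -> shiftable p.

Lemma closure_compact : compact (closure Omega).
Proof.
apply: bounded_closed_compact; last exact: closed_closure.
have [r [r0 Or]] := bounded_set_ball bO.
have sub : closure Omega `<=` closed_ball (0 : X) r by apply: closure_subset.
apply: (bounded_subset sub).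
exact: (compact_bounded (closed_ball_compact r0)).
Qed.

(** Induction on the cover. For a boundary point [p], split [z] into [psi * z], with [psi] a plateau
    at [p], and a remainder that vanishes where [psi] is 1. The first piece is pushed into [Omega]
    along the direction at [p]; the second vanishes on [V] enlarged by a ball about [p]. Once [V]
    contains the whole boundary, [z] has compact support in [Omega]. *)
Lemma flux_partition (e : X -> R) (s : seq X) :
  (forall p, bd Omega p -> 0 < e p /\ exists tau : X,
    forall x, closure Omega x -> ball p (e p) x -> forall t, 0 < t < e p -> Omega (x + t *: tau)) ->
  (forall p, p \in s -> bd Omega p) ->
  forall z d (V : set X), field z d -> open V ->
  (forall x, V x -> (forall i j, z i j x = 0) /\ (forall i, d i x = 0)) ->
  (forall x, bd Omega x -> V x \/ exists2 p, p \in s & ball p (e p / 4) x) ->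
  flux_ok z d.
Proof.
move=> he; elim: s => [_|p s IH sb] z d V fz oV zV cov.
  apply: (@flux_compact z d (closure Omega `\` V)) => //.
  - by apply: compact_closedI; [exact: closure_compact|exact: open_closedC].
  - move=> x [xc nV]; apply: contrapT => nO.
    have [//|[p]] : V x \/ exists2 p, p \in [::] & ball p (e p / 4) x.
      by apply: cov; split=> // /interior_subset.
    by rewrite in_nil.
  - move=> i j x nx; have [Vx|nV] := pselect (V x); first by have [h _] := zV x Vx.
    apply: (field_vanish fz) => xO; apply: nx; split=> //; exact: subset_closure.
  - move=> i x nx; have [Vx|nV] := pselect (V x); first by have [_ h] := zV x Vx.
    apply: (field_div_vanish fz) => xO; apply: nx; split=> //; exact: subset_closure.
have bp : bd Omega p by apply: sb; rewrite inE eqxx.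
have [e0 [tau htau]] := he p bp.
have e40 : 0 < e p / 4 by rewrite divr_gt0.
pose psi := plateau p (e p / 4).
have tpsi : test_function setT psi by exact: plateau_test.
have f1 := field_mul tpsi fz.
apply: (flux_add fz f1).
  pose C := closure Omega `&` closed_ball p (e p / 2).
  (* The lengths stay below [e p], as the shift at [p] demands, and tend to 0. *)
  pose c l : X := (e p / 2 * l.+1%:R^-1) *: tau.
  have e20 : 0 < e p / 2 by rewrite divr_gt0.
  apply: (@flux_shift _ _ (fun l => - c l) (fun l => [set y + c l | y in C])) => //.
  - rewrite -oppr0 -(scale0r tau); apply: cvgN; apply: cvgZr_tmp.
    rewrite -(mulr0 (e p / 2)); apply: cvgM; [exact: cvg_cst|exact: cvg_harmonic].
  - move=> l; split.
      apply: continuous_compact.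
        apply: continuous_subspaceT => y; exact: (@continuousD _ _ _ id (fun=> c l) y (@cvg_id _ _) (@cst_continuous _ _ (c l) y)).
      by apply: compact_closedI; [exact: closure_compact|exact: closed_ball_closed].
    move=> _ [y [yc yb] <-]; apply: htau => //.
      move: yb; rewrite closed_ballE // -ball_normE /= => /le_lt_trans; apply.
      by rewrite ltr_pdivrMr // ltr_pMr // ltr1n.
    rewrite mulr_gt0 ?invr_gt0 //= (@le_lt_trans _ _ (e p / 2)) //.
      by rewrite ler_piMr ?(ltW e20) // invf_le1 // ler1n.
    by rewrite ltr_pdivrMr // ltr_pMr // ltr1n.
  - move=> l x nx; have [yc|nyc] := pselect (Omega (- c l + x)); last first.
      split=> [i j|i]; first by rewrite /mul2 (field_vanish fz i j nyc) mulr0.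
      rewrite /mul_div (field_div_vanish fz i nyc) mulr0 add0r big1 // => j _.
      by rewrite (field_vanish fz i j nyc) mulr0.
    have nb : ~ closed_ball p (e p / 2) (- c l + x).
      move=> h; apply: nx; exists (- c l + x); first by split=> //; exact: subset_closure.
      by rewrite addrAC addNr add0r.
    have ps0 y : ~ closed_ball p (e p / 2) y -> psi y = 0.
      move=> ny; apply: plateau_eq0 => // hy; apply: ny; apply: subset_closed_ball.
      have -> : e p / 2 = 2 * (e p / 4) by field.
      exact: hy.
    have dp0 j : partial j psi (- c l + x) = 0.
      apply: (@partial_eq0 _ _ (closed_ball p (e p / 2)) psi j (- c l + x)) => //.
      exact: closed_ball_closed.
    split=> [i j|i]; first by rewrite /mul2 ps0 // mul0r.
    by rewrite /mul_div ps0 // mul0r add0r big1 // => j _; rewrite dp0 mul0r.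
apply: (IH _ _ _ (V `|` ball p (e p / 4))).
- by move=> q qs; apply: sb; rewrite inE qs orbT.
- exact: field_sub.
- by apply: openU => //; exact: ball_open.
- move=> x [Vx|px].
    have [h1 h2] := zV x Vx; split=> [i j|i].
      by rewrite /mul2 h1 mulr0 subrr.
    by rewrite /mul_div h2 mulr0 big1 ?addr0 ?subr0 // => j _; rewrite h1 mulr0.
  have psi1 y : ball p (e p / 4) y -> psi y = 1 by exact: plateau_eq1.
  have dpsi j : partial j psi x = 0.
    rewrite -[RHS](congr1 (fun h => h x) (partial_cst (n := n) j (1 : R))).
    apply: (@partial_eq_on R n (ball p (e p / 4)) psi (fun=> 1) j x);
      [exact: ball_open|exact: test_smooth tpsi|exact: smooth_cst|exact: psi1|exact: px].
  split=> [i j|i]; first by rewrite /mul2 psi1 // mul1r subrr.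
  rewrite /mul_div psi1 // mul1r big1 ?addr0 ?subrr // => j _.
  by rewrite dpsi mul0r.
- move=> x /cov[Vx|[q]]; first by left; left.
  by rewrite inE => /orP[/eqP ->|qs] qx; [left; right|right; exists q].
Qed.

Lemma flux_theorem z d : field z d -> flux_ok z d.
Proof.
move=> fz.
have /choice[e he] p : exists e : R, bd Omega p -> 0 < e /\ exists tau : X,
    forall x, closure Omega x -> ball p e x -> forall t, 0 < t < e -> Omega (x + t *: tau).
  have [bp|nb] := pselect (bd Omega p); last by exists 0.
  by have [e [tau [e0 h]]] := shift_bd bp; exists e => _; split=> //; exists tau.
have cb : compact (bd Omega).
  rewrite /bd setDE; apply: compact_closedI; first exact: closure_compact.
  by apply: open_closedC; exact: open_interior.
move: cb; rewrite compact_cover => /(_ X (bd Omega) (fun p => ball p (e p / 4))).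
case=> [p bp|p bp|D' DK KD].
- exact: ball_open.
- by exists p => //; apply: ballxx; rewrite divr_gt0 //; have [] := he p bp.
apply: (@flux_partition e (finmap.enum_fset D') he _ z d set0) => //.
- by move=> p pD; have := DK p pD; rewrite inE.
- by move=> x /KD[p pD px]; right; exists p.
Qed.

End flux_theorem.

(** * Finite measures with a density *)

Section density.
Context {R : realType} {n : nat}.
Local Notation X := 'rV[R]_n.
Variable g : X -> R.
Hypotheses (sg : summ (leb n) g) (g0 : forall x, 0 <= g x).

Definition density_measure (E : set X) : \bar R := (\int[@sfleb R n]_(x in E) (g x)%:E)%E.

Let mg : measurable_fun setT (EFin \o g).
Proof. by apply/measurable_EFinP; exact: summ_measurable sg. Qed.

Let d0 : density_measure set0 = 0%E.
Proof. by rewrite /density_measure integral_set0. Qed.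

Let dge0 E : (0 <= density_measure E)%E.
Proof. by apply: integral_ge0 => x _; rewrite lee_fin. Qed.

Let dsig : semi_sigma_additive density_measure.
Proof.
apply: (@semi_sigma_additive_nng_induced _ _ _ (@sfleb R n) (EFin \o g) mg).
by move=> x; rewrite lee_fin.
Qed.

#[local] HB.instance Definition _ := isMeasure.Build _ _ _ density_measure d0 dge0 dsig.

Let dfin : fin_num_fun density_measure.
Proof.
move=> E mE; apply: integrable_fin_num => //.
exact: (@integrableS _ _ _ (@sfleb R n) setT E _ measurableT mE (@subsetT _ _) sg).
Qed.

#[local] HB.instance Definition _ := @Measure_isFinite.Build _ _ _ density_measure dfin.

(** The Radon-Nikodym derivative of the measure with density [g] is [g] almost everywhere, since
    both have the same integral on every measurable set; the change of variables for the derivative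
    then gives the formula. *)
Lemma density_measureP : exists Q : {finite_measure set X -> \bar R},
  forall f, bounded_measurable f -> \int[Q]_x f x = \int[leb n]_x (f x * g x).
Proof.
pose Q : {finite_measure set X -> \bar R} := density_measure.
exists Q => f bf.
pose mu : {sigma_finite_measure set X -> \bar R} := @sfleb R n.
have dom : Q `<< mu.
  apply/null_content_dominatesP => E mE muE0.
  apply: (@null_set_integral _ _ _ mu E (EFin \o g)) => //.
  exact: measurable_funTS.
have mh : mu.-integrable setT (Radon_Nikodym (charge_of_finite_measure Q) mu).
  exact: Radon_Nikodym_integrable.
have ae : ae_eq mu setT (Radon_Nikodym (charge_of_finite_measure Q) mu) (EFin \o g).
  apply: integral_ae_eq => //.
  by move=> E _ mE; rewrite -Radon_Nikodym_integral.
have := @Radon_Nikodym_change_of_variables _ _ _ Q mu dom (EFin \o f) setT measurableT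
  (bounded_measurable_summ Q bf).
rewrite /Rintegral => <-; congr fine; apply: ae_eq_integral => //.
- have [mf _] := bf; apply: emeasurable_funM; first exact/measurable_EFinP.
  exact: measurable_int mh.
- have [mf _] := bf; apply/measurable_EFinP; apply: measurable_funM => //.
  exact: summ_measurable sg.
- by apply: filterS ae => x /= h /h ->.
Qed.

End density.

Section Lfun_bounded.
Context d (T : measurableType d) (R : realType) (mu : {measure set T -> \bar R}).

Lemma Lfuny_bounded (f : T -> R) : f \in Lfun mu +oo%E ->
  measurable_fun setT f /\ exists M : R, {ae mu, forall x, `|f x| <= M}.
Proof.
move=> hf; have mf : measurable_fun setT f by move: hf; rewrite inE => /andP[/[!inE]/= mf _].
split=> //; move: hf; rewrite inE => /andP[_]; rewrite inE /= /finite_norm unlock; case: ifPn => [mu0|]; last first.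
  rewrite -leNgt => /(conj (measure_ge0 mu setT)) /andP; rewrite -eq_le eq_sym => /eqP mu0 _.
  by exists 0; exists setT; split.
move=> fin; exists (fine (ess_sup_inf.ess_sup mu (abse \o (EFin \o f)))).
have := ess_sup_inf.ess_sup_ge mu (abse \o (EFin \o f)); apply: filterS => x /=.
case: (ess_sup_inf.ess_sup _ _) fin => [s|//|//] _; by rewrite lee_fin.
Qed.

Lemma bounded_Lfuny (f : T -> R) M : measurable_fun setT f -> (forall x, `|f x| <= M) ->
  f \in Lfun mu +oo%E.
Proof.
move=> mf fM; rewrite inE; apply/andP; split; first by rewrite inE.
rewrite inE /= /finite_norm unlock; case: ifPn => // _.
apply: (@le_lt_trans _ _ M%:E); last exact: ltry.
by apply/ess_sup_inf.ess_supP; apply: nearW => x /=; rewrite lee_fin.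
Qed.

End Lfun_bounded.

(** * Components extended by zero, and good representatives *)

Section components.
Context {R : realType} {m n : nat}.
Local Notation X := 'rV[R]_n.
Local Notation leb := (leb n).
Variable Omega : set X.
Hypotheses (oO : open Omega) (bO : bounded_set Omega).
Variable A : {linear 'M[R]_(m, n) -> 'M[R]_(m, n)}.
Implicit Types (u w : X -> 'rV[R]_m) (z : X -> 'M[R]_(m, n)).

Lemma patch_in (f : X -> R) x : Omega x -> (f \_ Omega) x = f x.
Proof. by move=> h; rewrite patchE mem_set. Qed.

Lemma patch_out (f : X -> R) : vanish_outside Omega (f \_ Omega).
Proof. by move=> x h; rewrite patchE memNset. Qed.

Lemma Rint_restrict (mu : {measure set X -> \bar R}) (h k : X -> R) :
  (forall x, Omega x -> h x = k x) -> vanish_outside Omega k ->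
  \int[mu]_(x in Omega) h x = \int[mu]_x k x.
Proof.
move=> hk k0; rewrite Rintegral_mkcond; apply: eq_Rintegral => x _.
rewrite patchE; case: ifPn => xO; first by apply: hk; rewrite inE in xO.
by rewrite k0 // => Ox; move: xO; rewrite mem_set.
Qed.

Definition comp1 u (i : 'I_m) : X -> R := (fun x => u x 0 i) \_ Omega.
Definition comp2 z (i : 'I_m) (j : 'I_n) : X -> R := (fun x => z x i j) \_ Omega.

Lemma comp1_sqsumm u : Lp Omega 2%:E u -> forall i, sqsumm leb (comp1 u i).
Proof. by move=> h i; apply: Lfun2_sqsumm; exact: (h 0 i). Qed.

Lemma comp1_vanish u i : vanish_outside Omega (comp1 u i).
Proof. exact: patch_out. Qed.

Lemma test_vanish phi : test_function Omega phi -> vanish_outside Omega phi.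
Proof. by move=> /test_functionP[_ [K [_ KO h]]] x nx; apply: h => /KO. Qed.

Lemma frob_symmetric_fixed : (forall y y', frob (A y) y' = frob y (A y')) ->
  forall y, A y = y -> forall D, frob y (A D) = frob y D.
Proof. by move=> As y yA D; rewrite -As yA. Qed.

Hypothesis A_symmetric : forall y y', frob (A y) y' = frob y (A y').

(** For [A y = y], symmetry of [A] makes the contraction of [y] with [A D w] equal to that with
    [D w]; hence the measures of [A D w] represent the latter. *)
Lemma BVA_bva w : Lp Omega 2%:E w -> BVA Omega A w ->
  exists P N, bva Omega A (comp1 w) P N.
Proof.
move=> w2 [_ [P [N hPN]]]; exists P, N; split.
- exact: comp1_sqsumm.
- exact: comp1_vanish.
move=> y yA psi tpsi.
pose D : 'M[R]_(m, n) := \matrix_(i, j) weak_partial (comp1 w i) j psi.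
have DE : A_gradient Omega A w psi = A D.
  congr (A _); apply/matrixP => i j; rewrite !mxE; congr (- _).
  apply: Rint_restrict => x xO; first by rewrite [comp1 _ _ _]patch_in.
  by rewrite comp1_vanish // mul0r.
have := frob_symmetric_fixed A_symmetric yA D.
rewrite /frob -DE => h.
transitivity (\sum_i \sum_j y i j * D i j).
  by apply: eq_bigr => i _; apply: eq_bigr => j _; rewrite mxE.
rewrite -h; apply: eq_bigr => i _; apply: eq_bigr => j _; congr (_ * _).
rewrite hPN // /signed_int; congr (_ - _); apply: Rint_restrict => //; exact: test_vanish.
Qed.

(** The positive and negative parts of the entries of [A G] are the densities of the two
    measures. *)
Lemma BVA_weak_gradient w (G : X -> 'M[R]_(m, n)) :
  Lp Omega 1%:E w -> Lp Omega 1%:E G -> is_weak_gradient Omega w G -> BVA Omega A w.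
Proof.
move=> w1 G1 wG; split=> //.
have sG i j : summ leb (comp2 G i j) by apply: Lfun1_summ; exact: (G1 i j).
pose H i j x := (A (\matrix_(k, l) comp2 G k l x)) i j.
have sH i j : summ leb (H i j).
  have E : H i j =1 (fun x => \sum_k \sum_l comp2 G k l x * (A (delta_mx k l)) i j).
    move=> x; rewrite /H (matrix_sum_delta (\matrix_(k, l) comp2 G k l x)).
    rewrite linear_sum summxE; apply: eq_bigr => k _.
    rewrite linear_sum summxE; apply: eq_bigr => l _.
    by rewrite linearZ !mxE.
  apply: (eq_summ (fun x => esym (E x))).
  apply: summ_sum => k _; apply: summ_sum => l _.
  by apply: eq_summ (summZ (A (delta_mx k l) i j) (sG k l)) => x; rewrite mulrC.
have mH i j := summ_measurable (sH i j).
pose Hp i j x := (`|H i j x| + H i j x) / 2; pose Hn i j x := (`|H i j x| - H i j x) / 2.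
have Hp0 i j x : 0 <= Hp i j x by rewrite divr_ge0 // -normrN -lerBlDr sub0r ler_norm.
have Hn0 i j x : 0 <= Hn i j x by rewrite divr_ge0 // subr_ge0 ler_norm.
have sHp i j : summ leb (Hp i j).
  apply: eq_summ (summZ 2^-1 (summD (summ_norm (sH i j)) (sH i j))) => x; exact: mulrC.
have sHn i j : summ leb (Hn i j).
  apply: eq_summ (summZ 2^-1 (summB (summ_norm (sH i j)) (sH i j))) => x; exact: mulrC.
have /choice[P hP] (ij : 'I_m * 'I_n) := density_measureP (sHp ij.1 ij.2) (Hp0 ij.1 ij.2).
have /choice[N hN] (ij : 'I_m * 'I_n) := density_measureP (sHn ij.1 ij.2) (Hn0 ij.1 ij.2).
exists (fun i j => P (i, j)), (fun i j => N (i, j)) => psi tpsi i j.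
have [K [_ psiK]] := test_bounded tpsi.
have mpsi := smooth_measurable (test_smooth tpsi).
have bpsi := test_bounded_measurable tpsi.
have vpsi := test_vanish tpsi.
have -> : signed_int Omega (P (i, j)) (N (i, j)) psi = \int[leb]_x (psi x * H i j x).
  rewrite /signed_int !(@Rint_restrict _ psi psi (fun _ _ => erefl) vpsi) hP // hN // -RintB; first last.
  - by apply: eq_summ (summM_bounded mpsi psiK (sHn i j)) => x; exact: mulrC.
  - by apply: eq_summ (summM_bounded mpsi psiK (sHp i j)) => x; exact: mulrC.
  by apply: eq_Rintegral => x _; rewrite /Hp /Hn /=; field.
rewrite /A_gradient.
have -> : (\matrix_(k, l) - \int[leb]_(x in Omega) (w x 0 k * partial l psi x)) =
    \sum_k \sum_l (\int[leb]_x (comp2 G k l x * psi x)) *: (delta_mx k l : 'M[R]_(m, n)).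
  rewrite (matrix_sum_delta (\matrix_(k, l) - \int[leb]_(x in Omega) (w x 0 k * partial l psi x))).
  apply: eq_bigr => k _; apply: eq_bigr => l _; rewrite mxE wG // opprK; congr (_ *: _).
  apply: Rint_restrict => x xO; first by rewrite [comp2 _ _ _ _]patch_in.
  by rewrite vpsi // mulr0.
have sGp k l : summ leb (fun x => comp2 G k l x * psi x) by exact: summM_bounded mpsi psiK (sG k l).
rewrite linear_sum summxE.
transitivity (\sum_k \sum_l \int[leb]_x (A (delta_mx k l) i j * (comp2 G k l x * psi x))).
  apply: eq_bigr => k _; rewrite linear_sum summxE; apply: eq_bigr => l _.
  by rewrite linearZ mxE RintZ // mulrC.
transitivity (\int[leb]_x (\sum_k \sum_l A (delta_mx k l) i j * (comp2 G k l x * psi x))).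
  rewrite Rint_sum; last by move=> k _; apply: summ_sum => l _; exact: summZ.
  by apply: eq_bigr => k _; rewrite Rint_sum // => l _; exact: summZ.
apply: eq_Rintegral => x _; rewrite /H (matrix_sum_delta (\matrix_(k, l) comp2 G k l x)).
rewrite linear_sum summxE mulr_sumr; apply: eq_bigr => k _.
rewrite linear_sum summxE mulr_sumr; apply: eq_bigr => l _.
by rewrite linearZ !mxE; ring.
Qed.

Lemma X2_weak_div z : X2 Omega A z ->
  Lp Omega 2%:E (weak_div Omega z) /\ is_weak_div Omega z (weak_div Omega z).
Proof. by move=> [_ _ h]; exact: (xgetPex (fun=> 0) h). Qed.

Lemma field_mx_comp2 z x : Omega x -> field_mx (comp2 z) x = z x.
Proof. by move=> xO; apply/matrixP => i j; rewrite mxE [comp2 _ _ _ _]patch_in. Qed.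

(** The field is set to 0 on a null set off which the bound and [A z = z] hold. [U] is left free so
    that one representative serves both [Omega] and, when the normal trace vanishes, [setT]. *)
Lemma X2_version z : X2 Omega A z -> exists Z,
  (forall i j, {ae leb, forall x, comp2 z i j x = Z i j x}) /\
  forall U, weak_divc U (comp2 z) (comp1 (weak_div Omega z)) ->
    field Omega A U Z (comp1 (weak_div Omega z)).
Proof.
move=> Xz; have [zi zA _] := Xz; have [d2 dz] := X2_weak_div Xz.
have mz i j : measurable_fun setT (comp2 z i j) by have [] := Lfuny_bounded (zi i j).
have /choice[M0 hM0] (ij : 'I_m * 'I_n) : exists M : R,
    {ae leb, forall x, `|comp2 z ij.1 ij.2 x| <= M}.
  by have [] := Lfuny_bounded (zi ij.1 ij.2).
pose M := \sum_ij `|M0 ij|.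
have hM : {ae leb, forall x ij, `|comp2 z ij.1 ij.2 x| <= M}.
  apply: filter_forall => ij; apply: filterS (hM0 ij) => x /le_trans; apply.
  by apply: (le_trans (ler_norm _)); rewrite /M (bigD1 ij) //= lerDl sumr_ge0.
have [B [mB B0 hB]] : {ae leb, forall x, (forall ij, `|comp2 z ij.1 ij.2 x| <= M) /\
    A (field_mx (comp2 z) x) = field_mx (comp2 z) x}.
  apply: filterS2 hM zA => x h1 h2; split=> //.
  have [xO|nxO] := pselect (Omega x); first by rewrite field_mx_comp2 // h2.
  have -> : field_mx (comp2 z) x = 0.
    by apply/matrixP => i j; rewrite !mxE [comp2 _ _ _ _]patch_out.
  by rewrite linear0.
pose Z i j x := comp2 z i j x * \1_(~` B) x.
have ZB i j x : B x -> Z i j x = 0 by move=> Bx; rewrite /Z indicE memNset ?mulr0 //; apply.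
have ZnB i j x : ~ B x -> Z i j x = comp2 z i j x.
  by move=> Bx; rewrite /Z indicE mem_set ?mulr1.
have good x : ~ B x -> (forall ij, `|comp2 z ij.1 ij.2 x| <= M) /\
    A (field_mx (comp2 z) x) = field_mx (comp2 z) x.
  by move=> nB; apply: contrapT => h; exact/nB/hB.
have aeZ i j : {ae leb, forall x, comp2 z i j x = Z i j x}.
  by exists B; split=> // x /= h; apply: contrapT => nB; apply: h; rewrite ZnB.
have mZ i j : measurable_fun setT (Z i j).
  by apply: measurable_funM => //; apply: measurable_indic; exact: measurableC.
exists Z; split=> // U hU; split=> //.
- exists M => i j x; have [Bx|nB] := pselect (B x).
    by rewrite ZB // normr0 sumr_ge0.
  by rewrite ZnB //; have [h _] := good x nB; exact: (h (i, j)).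
- by move=> i j x nx; rewrite /Z [comp2 _ _ _ _]patch_out // mul0r.
- move=> x; have [Bx|nB] := pselect (B x).
    have -> : field_mx Z x = 0 by apply/matrixP => i j; rewrite !mxE ZB.
    by rewrite linear0.
  have -> : field_mx Z x = field_mx (comp2 z) x by apply/matrixP => i j; rewrite !mxE ZnB.
  by have [] := good x nB.
- exact: comp1_sqsumm.
- exact: comp1_vanish.
- move=> psi tpsi i; rewrite -(hU psi tpsi i).
  have mp j := smooth_measurable (smooth_partial j (test_smooth tpsi)).
  apply: ae_eq_Rint.
  + by apply: measurable_sum => j; apply: measurable_funM => //; exact: mp.
  + by apply: measurable_sum => j; apply: measurable_funM => //; exact: mp.
  have : {ae leb, forall x j, comp2 z i j x = Z i j x} by apply: filter_forall => j; exact: aeZ.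
  by apply: filterS => x h; apply: eq_bigr => j _; rewrite h.
Qed.

Lemma is_weak_divc z d : is_weak_div Omega z d -> weak_divc Omega (comp2 z) (comp1 d).
Proof.
move=> h psi tpsi i; have := h psi tpsi i.
rewrite (@Rint_restrict _ _ (fun x => \sum_j comp2 z i j x * partial j psi x)); first last.
- by move=> x nx; rewrite big1 // => j _; rewrite [comp2 _ _ _ _]patch_out // mul0r.
- by move=> x xO; apply: eq_bigr => j _; rewrite [comp2 _ _ _ _]patch_in.
move=> ->; congr (- _); apply: Rint_restrict.
- by move=> x xO; rewrite [comp1 _ _ _]patch_in.
- by move=> x nx; rewrite comp1_vanish // mul0r.
Qed.

Lemma pairing_pairc z u Z phi : X2 Omega A z -> Lp Omega 2%:E u ->
  (forall i j, measurable_fun setT (Z i j)) ->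
  (forall i j, {ae leb, forall x, comp2 z i j x = Z i j x}) ->
  test_function Omega phi ->
  pairing Omega z u phi = pairc Z (comp1 (weak_div Omega z)) (comp1 u) phi.
Proof.
move=> Xz u2 mZ aeZ tphi; have [zi _ _] := Xz; have [d2 _] := X2_weak_div Xz.
have mz i j : measurable_fun setT (comp2 z i j) by have [] := Lfuny_bounded (zi i j).
rewrite paircE /pairing; apply: congr1.
have md i : measurable_fun setT (comp1 (weak_div Omega z) i) by have [] := comp1_sqsumm d2 i.
have mu i : measurable_fun setT (comp1 u i) by have [] := comp1_sqsumm u2 i.
have mphi := smooth_measurable (test_smooth tphi).
have mp j := smooth_measurable (smooth_partial j (test_smooth tphi)).
have meas (Y : 'I_m -> 'I_n -> X -> R) : (forall i j, measurable_fun setT (Y i j)) ->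
    measurable_fun setT (fun x => \sum_i phi x * comp1 (weak_div Omega z) i x * comp1 u i x +
      \sum_i \sum_j partial j phi x * Y i j x * comp1 u i x).
  move=> mY; apply: measurable_funD; apply: measurable_sum => i.
    by apply: measurable_funM => //; exact: measurable_funM.
  apply: measurable_sum => j; apply: measurable_funM => //; apply: measurable_funM => //; exact: mp.
apply: etrans (ae_eq_Rint (meas _ mz) (meas _ mZ) _).
  apply: Rint_restrict => x xO.
    congr (_ + _); apply: eq_bigr => i _; first by rewrite ![comp1 _ _ _]patch_in.
    by apply: eq_bigr => j _; rewrite [comp1 _ _ _]patch_in // [comp2 _ _ _ _]patch_in.
  have u0 i : comp1 u i x = 0 by exact: comp1_vanish.
  have e1 : \sum_i phi x * comp1 (weak_div Omega z) i x * comp1 u i x = 0.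
    by apply: big1 => i _; rewrite u0 mulr0.
  have e2 : \sum_i \sum_j partial j phi x * comp2 z i j x * comp1 u i x = 0.
    by apply: big1 => i _; apply: big1 => j _; rewrite u0 mulr0.
  exact: (etrans (congr2 +%R e1 e2) (addr0 0)).
have : {ae leb, forall x (ij : 'I_m * 'I_n), comp2 z ij.1 ij.2 x = Z ij.1 ij.2 x}.
  by apply: filter_forall => ij; exact: aeZ.
apply: filterS => x h; congr (_ + _); apply: eq_bigr => i _; apply: eq_bigr => j _.
by rewrite (h (i, j)).
Qed.

End components.

(** * Masses of pairings *)

Section masses.
Context {R : realType} {m n : nat}.
Local Notation X := 'rV[R]_n.
Local Notation leb := (leb n).
Variable Omega : set X.
Hypotheses (oO : open Omega) (bO : bounded_set Omega).
Variable A : {linear 'M[R]_(m, n) -> 'M[R]_(m, n)}.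
Hypothesis A_symmetric : forall y y', frob (A y) y' = frob y (A y').
Implicit Types (u w : X -> 'rV[R]_m) (z : X -> 'M[R]_(m, n)).

Lemma comp1_in u i x : Omega x -> comp1 Omega u i x = u x 0 i.
Proof. exact: patch_in. Qed.

Lemma comp2_in z i j x : Omega x -> comp2 Omega z i j x = z x i j.
Proof. exact: patch_in. Qed.

Lemma comp2_out z i j x : ~ Omega x -> comp2 Omega z i j x = 0.
Proof. exact: patch_out. Qed.

Local Notation X2 := (X2 Omega A).
Local Notation BVA := (BVA Omega A).
Local Notation wd := (weak_div Omega).
Local Notation comp1 := (comp1 Omega).
Local Notation comp2 := (comp2 Omega).

Lemma X2_representative z : X2 z -> exists Z,
  [/\ forall i j, {ae leb, forall x, comp2 z i j x = Z i j x},
      field Omega A Omega Z (comp1 (wd z)) &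
      weak_divc setT (comp2 z) (comp1 (wd z)) -> field Omega A setT Z (comp1 (wd z))].
Proof.
move=> Xz; have [Z [aeZ fZ]] := X2_version Xz; exists Z; split=> //; last exact: fZ.
by apply: fZ; apply: is_weak_divc; have [] := X2_weak_div Xz.
Qed.

(** Existence of representing measures makes the choice in [pairing_mass] effective, and whichever
    pair is chosen, its mass is the limit along the exhaustion. Masses are computed through this
    limit below. *)
Lemma pairing_mass_cvg z w theta : is_exhaustion Omega theta ->
  X2 z -> Lp Omega 2%:E w -> BVA w ->
  pairing Omega z w (theta k) @[k --> \oo] --> pairing_mass Omega z w.
Proof.
move=> ex Xz w2 bw; have [h1 _ _] := ex.
have [Z [aeZ fZ _]] := X2_representative Xz.
have [P [N bPN]] := BVA_bva A_symmetric w2 bw.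
have [P1 [N1 H1]] := pairc_measures oO bO fZ bPN.
have sig (Q1 Q2 : {finite_measure set X -> \bar R}) phi : test_function Omega phi ->
    signed_int Omega Q1 Q2 phi = \int[Q1]_x phi x - \int[Q2]_x phi x.
  by move=> /test_vanish tv; rewrite /signed_int !(@Rint_restrict _ _ _ _ phi phi (fun _ _ => erefl) tv).
have [|P' [N' [H' EM]]] := @xgetPex _ 0 [set c | exists P N : {finite_measure set X -> \bar R},
    (forall phi, test_function Omega phi ->
       pairing Omega z w phi = signed_int Omega P N phi) /\
    c = fine (P Omega) - fine (N Omega)].
  exists (fine (P1 Omega) - fine (N1 Omega)), P1, N1; split=> // phi tphi.
  rewrite sig // -H1 //; apply: (pairing_pairc Xz w2 _ aeZ tphi).
  exact: field_measurable fZ.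
have E k : pairing Omega z w (theta k) = \int[P']_x theta k x - \int[N']_x theta k x.
  by rewrite H' // sig.
under eq_fun do rewrite E.
have -> : pairing_mass Omega z w = fine (P' Omega) - fine (N' Omega) by exact: EM.
exact: (@exhaustion_mass_cvg _ _ _ _ ex P' N' oO).
Qed.

Lemma pairing_mass_unique z w theta l : is_exhaustion Omega theta ->
  X2 z -> Lp Omega 2%:E w -> BVA w ->
  pairing Omega z w (theta k) @[k --> \oo] --> l -> pairing_mass Omega z w = l.
Proof.
move=> ex Xz w2 bw h; apply: (cvg_unique _ _ h); first exact: Rhausdorff.
exact: pairing_mass_cvg.
Qed.

Lemma exhaustion_exists : exists theta, is_exhaustion Omega theta.
Proof. by have [theta [h1 h2 h3]] := exhaustion bO oO; exists theta. Qed.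

Lemma mass_scale (t : R) z w : X2 z -> Lp Omega 2%:E w -> BVA w ->
  Lp Omega 2%:E (fun x => t *: w x) -> BVA (fun x => t *: w x) ->
  pairing_mass Omega z (fun x => t *: w x) = t * pairing_mass Omega z w.
Proof.
move=> Xz w2 bw tw2 btw; have [theta ex] := exhaustion_exists; have [h1 _ _] := ex.
apply: (pairing_mass_unique ex Xz tw2 btw).
have [Z [aeZ fZ _]] := X2_representative Xz.
have [M ZM] := field_bounded fZ.
suff E k : pairing Omega z (fun x => t *: w x) (theta k) = t * pairing Omega z w (theta k).
  under eq_fun do rewrite E; apply: cvgM; first exact: cvg_cst.
  exact: pairing_mass_cvg.
have tk := h1 k; have tT := test_subset (@subsetT _ Omega) tk.
rewrite !(pairing_pairc Xz _ (field_measurable fZ) aeZ tk) //.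
have ex1 v : Lp Omega 2%:E v -> pairc Z (comp1 (wd z)) (comp1 v) (theta k) =
  - \sum_i \int[leb]_x (comp1 v i x * theta k x * comp1 (wd z) i x) -
    \sum_i \sum_j \int[leb]_x (comp1 v i x * partial j (theta k) x * Z i j x).
  move=> v2; apply: (pairc_expand bO (field_measurable fZ) ZM (field_vanish fZ) (field_sqsumm fZ) _ tT).
  exact: comp1_sqsumm v2.
rewrite (ex1 _ tw2) (ex1 _ w2).
have sq q i : test_function setT q -> sqsumm leb (fun x => comp1 w i x * q x).
  move=> /test_bounded_measurable[mq [K hK]]; exact: sqsummM_bounded hK (comp1_sqsumm w2 i).
have sZ i j : sqsumm leb (Z i j).
  apply: (vanish_bounded_sqsumm bO _ (field_vanish fZ i j)).
  by split; [exact: field_measurable fZ i j|exists M].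
have C i x : comp1 (fun x => t *: w x) i x = t * comp1 w i x.
  have [xO|nO] := pselect (Omega x); first by rewrite !comp1_in // mxE.
  by rewrite !comp1_vanish // mulr0.
have S1 : \sum_i \int[leb]_x (comp1 (fun x => t *: w x) i x * theta k x * comp1 (wd z) i x) =
    t * \sum_i \int[leb]_x (comp1 w i x * theta k x * comp1 (wd z) i x).
  rewrite mulr_sumr; apply: eq_bigr => i _; rewrite -RintZ; last first.
    by apply: sqsummM; [exact: sq|exact: field_sqsumm fZ i].
  by apply: eq_Rintegral => x _; rewrite C !mulrA.
have S2 : \sum_i \sum_j \int[leb]_x (comp1 (fun x => t *: w x) i x * partial j (theta k) x * Z i j x) =
    t * \sum_i \sum_j \int[leb]_x (comp1 w i x * partial j (theta k) x * Z i j x).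
  rewrite mulr_sumr; apply: eq_bigr => i _; rewrite mulr_sumr; apply: eq_bigr => j _.
  rewrite -RintZ; last by apply: sqsummM => //; apply: sq; exact: test_partial.
  by apply: eq_Rintegral => x _; rewrite C !mulrA.
have comb (p q p' q' : R) : p = t * q -> p' = t * q' -> - p - p' = t * (- q - q').
  by move=> -> ->; ring.
exact: comb S1 S2.
Qed.

Lemma Lp_scale (p : R) (t : R) w : 1 <= p -> Lp Omega p%:E w -> Lp Omega p%:E (fun x => t *: w x).
Proof.
move=> p1 h i j; have := h i j.
have -> : (fun x => (t *: w x) i j) \_ Omega = t *: ((fun x => w x i j) \_ Omega : X -> R).
  apply/funext => x; rewrite fctE !patchE; case: ifP => _; first by rewrite mxE.
  by rewrite scaler0.
have p1' : (1 <= p%:E)%E by rewrite lee_fin.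
have [_ cl] := @Lfun_submod_closed _ _ R leb p%:E p1'.
have [c0 _] := @Lfun_submod_closed _ _ R leb p%:E p1'.
by move=> hf; rewrite -[_ *: _]addr0; exact: cl.
Qed.

Lemma BVA_scale (t : R) w : BVA w -> BVA (fun x => t *: w x).
Proof.
move=> [w1 [P [N hPN]]]; split; first exact: Lp_scale.
have sc (a : R) (Q : {finite_measure set X -> \bar R}) := finite_measure_scale Q (normr_ge0 a).
(* A negative factor exchanges the two measures, which are then scaled by its absolute value. *)
have /choice[P' hP'] (ij : 'I_m * 'I_n) := sc t (if 0 <= t then P ij.1 ij.2 else N ij.1 ij.2).
have /choice[N' hN'] (ij : 'I_m * 'I_n) := sc t (if 0 <= t then N ij.1 ij.2 else P ij.1 ij.2).
exists (fun i j => P' (i, j)), (fun i j => N' (i, j)) => psi tpsi i j.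
have [K [_ psiK]] := test_bounded (test_partial j tpsi).
have bpsi := test_bounded_measurable tpsi; have vpsi := test_vanish tpsi.
have E : A_gradient Omega A (fun x => t *: w x) psi = t *: A_gradient Omega A w psi.
  rewrite /A_gradient -linearZ; congr (A _); apply/matrixP => k l; rewrite !mxE mulrN; congr (- _).
  have [K' [_ psiK']] := test_bounded (test_partial l tpsi).
  have mp := smooth_measurable (smooth_partial l (test_smooth tpsi)).
  have s1 : summ leb (fun x => comp1 w k x * partial l psi x).
    by apply: summM_bounded psiK' _ => //; apply: Lfun1_summ; exact: (w1 0 k).
  rewrite (@Rint_restrict _ _ Omega leb _ (fun x => t * (comp1 w k x * partial l psi x))); first last.
  - by move=> x nx; rewrite comp1_vanish // mul0r mulr0.
  - by move=> x xO; rewrite mxE comp1_in // mulrA.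
  rewrite RintZ //; congr (_ * _); apply/esym; apply: Rint_restrict => x xO.
    by rewrite comp1_in.
  by rewrite comp1_vanish // mul0r.
rewrite E mxE hPN // /signed_int !(@Rint_restrict _ _ Omega _ psi psi (fun _ _ => erefl) vpsi).
rewrite hP' // hN' //; case: (lerP 0 t) => [t0|t0]; first by rewrite ger0_norm //= mulrBr.
by rewrite ltr0_norm //=; ring.
Qed.

Lemma mass_flux z w : (forall p, bd Omega p -> shiftable Omega p) ->
  X2 z -> weak_divc setT (comp2 z) (comp1 (wd z)) ->
  Lp Omega 2%:E w -> BVA w ->
  pairing_mass Omega z w = - \int[leb]_(x in Omega) frob (wd z x) (w x).
Proof.
move=> sh Xz zT w2 bw; have [theta ex] := exhaustion_exists; have [h1 _ _] := ex.
have [Z [aeZ fO fT]] := X2_representative Xz.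
have {fT} fZ := fT zT.
have [P [N bPN]] := BVA_bva A_symmetric w2 bw.
apply: (pairing_mass_unique ex Xz w2 bw).
have F := flux_theorem oO bO bPN ex sh fZ; rewrite /flux_ok in F.
have -> : \int[leb]_(x in Omega) frob (wd z x) (w x) = div_term (comp1 w) (comp1 (wd z)).
  have d2 := field_sqsumm fZ.
  transitivity (\int[leb]_x (\sum_i comp1 w i x * comp1 (wd z) i x)).
    apply: Rint_restrict => x xO.
      rewrite /frob big_ord1; apply: eq_bigr => i _.
      by rewrite !comp1_in // mulrC.
    by apply: big1 => i _; rewrite comp1_vanish // mul0r.
  rewrite Rint_sum // => i _; apply: sqsummM; [exact: comp1_sqsumm w2 i|exact: d2].
have E k : pairing Omega z w (theta k) = pairc Z (comp1 (wd z)) (comp1 w) (theta k).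
  exact: (pairing_pairc Xz w2 (field_measurable fZ) aeZ (h1 k)).
by under eq_fun do rewrite E.
Qed.

(** For smooth fields this links the mass to the energy; for W^{1,1} functions it links the mass to
    the identity that defines the normal trace. *)
Lemma mass_gradient z w (G : X -> 'M[R]_(m, n)) : X2 z ->
  Lp Omega 2%:E w -> Lp Omega 1%:E w -> Lp Omega 1%:E G -> is_weak_gradient Omega w G ->
  summ leb (fun x => \sum_i \sum_j comp2 G i j x * comp2 z i j x) /\
  pairing_mass Omega z w = \int[leb]_(x in Omega) frob (z x) (G x).
Proof.
move=> Xz w2 w1 G1 wG; have [theta ex] := exhaustion_exists; have [h1 _ _] := ex.
have [Z [aeZ fZ _]] := X2_representative Xz.
have [M ZM] := field_bounded fZ.
have bw := @BVA_weak_gradient _ _ _ Omega A _ _ w1 G1 wG.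
have sG i j : summ leb (comp2 G i j) by apply: Lfun1_summ; exact: (G1 i j).
have sGZ i j : summ leb (fun x => comp2 G i j x * Z i j x).
  exact: summM_bounded (field_measurable fZ i j) (ZM i j) (sG i j).
have [zi _ _] := Xz.
have mz i j : measurable_fun setT (comp2 z i j) by have [] := Lfuny_bounded (zi i j).
have mG i j := summ_measurable (sG i j).
have ae : {ae leb, forall x, \sum_i \sum_j comp2 G i j x * Z i j x =
    \sum_i \sum_j comp2 G i j x * comp2 z i j x}.
  have : {ae leb, forall x (ij : 'I_m * 'I_n), comp2 z ij.1 ij.2 x = Z ij.1 ij.2 x}.
    by apply: filter_forall => ij; exact: aeZ.
  apply: filterS => x h; apply: eq_bigr => i _; apply: eq_bigr => j _.
  by rewrite (h (i, j)).
have mzz : measurable_fun setT (fun x => \sum_i \sum_j comp2 G i j x * comp2 z i j x).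
  by apply: measurable_sum => i; apply: measurable_sum => j; exact: measurable_funM.
have sS : summ leb (fun x => \sum_i \sum_j comp2 G i j x * Z i j x).
  by apply: summ_sum => i _; apply: summ_sum => j _; exact: sGZ.
split; first exact: ae_eq_summ mzz ae sS.
apply: (pairing_mass_unique ex Xz w2 bw).
have wp psi : test_function Omega psi -> forall i j,
    weak_partial (comp1 w i) j psi = \int[leb]_x (comp2 G i j x * psi x).
  move=> tpsi i j; have vpsi := test_vanish tpsi.
  have -> : \int[leb]_x (comp2 G i j x * psi x) = \int[leb]_(x in Omega) (G x i j * psi x).
    apply/esym; apply: Rint_restrict => x xO; first by rewrite comp2_in.
    by rewrite vpsi // mulr0.
  rewrite -[RHS]opprK -(wG psi tpsi i j) /weak_partial; congr (- _); apply/esym.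
  apply: Rint_restrict => x xO; first by rewrite comp1_in.
  by rewrite comp1_vanish // mul0r.
have E k : pairing Omega z w (theta k) =
    \sum_i \sum_j \int[leb]_x (comp2 G i j x * Z i j x * theta k x).
  rewrite (pairing_pairc Xz w2 (field_measurable fZ) aeZ (h1 k)).
  rewrite (pairc_weak_gradient oO bO (field_measurable fZ) ZM (field_vanish fZ) (field_sqsumm fZ)
    (field_div_vanish fZ) (comp1_sqsumm w2) (comp1_vanish (Omega := Omega) w) (field_div fZ) sG wp (h1 k)).
  by apply: eq_bigr => i _; apply: eq_bigr => j _; apply: eq_Rintegral => x _; rewrite mulrAC.
have -> : \int[leb]_(x in Omega) frob (z x) (G x) =
    \sum_i \sum_j \int[leb]_x (comp2 G i j x * Z i j x * \1_Omega x).
  transitivity (\int[leb]_x (\sum_i \sum_j comp2 G i j x * comp2 z i j x)).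
    apply: Rint_restrict => x xO.
      apply: eq_bigr => i _; apply: eq_bigr => j _.
      by rewrite !comp2_in // mulrC.
    by apply: big1 => i _; apply: big1 => j _; rewrite comp2_out // mul0r.
  rewrite -(ae_eq_Rint (summ_measurable sS) mzz ae).
  rewrite Rint_sum; last by move=> i _; apply: summ_sum => j _; exact: sGZ.
  apply: eq_bigr => i _; rewrite Rint_sum //; apply: eq_bigr => j _.
  apply: eq_Rintegral => x _; have [xO|nO] := pselect (Omega x).
    by rewrite indicE mem_set // mulr1.
  by rewrite (field_vanish fZ) // mulr0 mul0r.
under eq_fun do rewrite E.
refine (@cvgn_sum R 'I_m _ _ _ (fun i => _)).
refine (@cvgn_sum R 'I_n _ _ _ (fun j => _)).
exact: (exhaustion_Rint_cvg ex oO (sGZ i j)).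
Qed.

End masses.

(** * Duality for the integral functional *)

Section matrix_norm1.
Context {R : realType} {m n : nat}.
Implicit Types y : 'M[R]_(m, n).

(** The entrywise norm dominates the Frobenius norm, so the upper growth bound carries over to it,
    and its estimates are plain sums. *)
Definition norm1 y : R := \sum_i \sum_j `|y i j|.

Lemma norm1_ge0 y : 0 <= norm1 y.
Proof. by apply: sumr_ge0 => i _; apply: sumr_ge0. Qed.

Lemma norm1D y y' : norm1 (y + y') <= norm1 y + norm1 y'.
Proof.
rewrite -big_split; apply: ler_sum => i _; rewrite -big_split; apply: ler_sum => j _.
by rewrite mxE ler_normD.
Qed.

Lemma norm1Z t y : norm1 (t *: y) = `|t| * norm1 y.
Proof.
rewrite mulr_sumr; apply: eq_bigr => i _; rewrite mulr_sumr; apply: eq_bigr => j _.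
by rewrite mxE normrM.
Qed.

Lemma norm1_sum I (s : seq I) (F : I -> 'M[R]_(m, n)) :
  norm1 (\sum_(i <- s) F i) <= \sum_(i <- s) norm1 (F i).
Proof.
elim/big_rec2 : _ => [|i a b _ h]; last by apply: le_trans (norm1D _ _) _; rewrite lerD2l.
by rewrite /norm1 big1 // => i _; rewrite big1 // => j _; rewrite mxE normr0.
Qed.

Lemma coord_le_norm1 y i j : `|y i j| <= norm1 y.
Proof.
rewrite /norm1 (bigD1 i) //= (bigD1 j) //= -addrA lerDl addr_ge0 //; first exact: sumr_ge0.
by apply: sumr_ge0 => k _; apply: sumr_ge0.
Qed.

Lemma fnorm_le_norm1 y : fnorm y <= norm1 y.
Proof.
rewrite /fnorm -(ger0_norm (norm1_ge0 y)) -sqrtr_sqr ler_sqrt ?sqr_ge0 //.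
rewrite expr2 {1}/norm1 mulr_suml; apply: ler_sum => i _; rewrite mulr_suml.
apply: ler_sum => j _; rewrite -expr2 -real_normK ?num_real // expr2 ler_wpM2l //.
exact: coord_le_norm1.
Qed.

Lemma norm1_linear (A : {linear 'M[R]_(m, n) -> 'M[R]_(m, n)}) :
  exists2 K, 0 <= K & forall y, norm1 (A y) <= K * norm1 y.
Proof.
exists (\sum_i \sum_j norm1 (A (delta_mx i j))).
  by apply: sumr_ge0 => i _; apply: sumr_ge0 => j _; exact: norm1_ge0.
move=> y; rewrite {1}(matrix_sum_delta y) linear_sum.
apply: (le_trans (norm1_sum _ _)); rewrite mulr_suml; apply: ler_sum => i _.
rewrite linear_sum; apply: (le_trans (norm1_sum _ _)); rewrite mulr_suml.
apply: ler_sum => j _; rewrite linearZ norm1Z mulrC ler_wpM2l ?norm1_ge0 //.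
exact: coord_le_norm1.
Qed.

End matrix_norm1.

Lemma measurable_mx (R : realType) (m n k : nat) (Y : 'rV[R]_k -> 'M[R]_(m, n)) :
  (forall i j, measurable_fun setT (fun x => Y x i j)) -> measurable_fun setT Y.
Proof.
move=> mY.
have mv : measurable_fun setT (fun x => mxvec (Y x)).
  apply: measurable_rV => l; case/mxvec_indexP: l => i j.
  by under eq_fun do rewrite mxvecE; exact: mY.
have mvec : measurable_fun setT (@vec_mx R m n).
  apply: (@measurability _ _ _ _ _ _ (@open 'M[R]_(m, n))) => //.
  move=> _ [U oU <-]; rewrite setTI; apply: open_measurable_rV.
  apply: open_comp => // v _ V /nbhs_ballP[e /= e0 eV].
  suff : nbhs v (@vec_mx R m n @^-1` V) by [].
  apply: filterS (nbhsx_ballx v e e0) => v' [_ h]; apply: eV; split=> // i j.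
  by rewrite !mxE; exact: h.
have -> : Y = @vec_mx R m n \o (fun x => mxvec (Y x)) by apply/funext => x /=; rewrite mxvecK.
exact: measurableT_comp mvec mv.
Qed.

Lemma Rint_eq0_ae d (T : measurableType d) (R : realType) (mu : {measure set T -> \bar R})
    (k : T -> R) : summ mu k -> (forall x, 0 <= k x) -> \int[mu]_x k x = 0 ->
  {ae mu, forall x, k x = 0}.
Proof.
move=> sk k0 ik.
have : (\int[mu]_(x in setT) `|(EFin \o k) x| = 0)%E.
  rewrite -[RHS]/(0%:E) -ik EFin_Rint //; apply: eq_integral => x _ /=; by rewrite ger0_norm.
move=> /ae_eq_integral_abs => /(_ measurableT); case; first by apply/measurable_EFinP; exact: summ_measurable sk.
by move=> N [mN N0 hN]; exists N; split=> // x /= h; apply: hN => /= /(_ I) [].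
Qed.

Lemma bounded_multiples_eq0 (R : realType) (a b : R) : (forall t, t * a <= b) -> a = 0.
Proof.
move=> h; apply: contrapT => /eqP a0.
have := h ((b + 1) / a); rewrite divfK //; lra.
Qed.

(* [L + C * leb Omega] is positive, hence a measure, and Radon-Nikodym applies. *)
Lemma dominated_functional_density (R : realType) (n : nat) (Omega : set 'rV[R]_n)
    (L : ('rV[R]_n -> R) -> R) (C : R) :
  open Omega -> (leb n Omega < +oo)%E -> linear_on (@bounded_measurable _ _ R) L -> 0 <= C ->
  (forall h, bounded_measurable h -> `|L h| <= C * \int[leb n]_x (`|h x| * \1_Omega x)) ->
  exists z : 'rV[R]_n -> R, [/\ bounded_measurable z, vanish_outside Omega z &
    forall h, bounded_measurable h -> L h = \int[leb n]_x (h x * z x)].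
Proof.
move=> oO fO lL C0 LC; have mO := open_measurable_rV oO.
have sO : summ (leb n) (\1_Omega : 'rV[R]_n -> R) by exact: summ_indic.
have [mu hmu] := density_measureP sO (fun x => ler0n _ _).
have [|P [PC hP]] := @dominated_functional_measure _ _ R mu L C lL C0.
  move=> h bh; rewrite hmu; first exact: LC.
  have [mh [M hM]] := bh; split; [exact: measurableT_comp|exists M => x; by rewrite normr_id].
pose mu' : {sigma_finite_measure set 'rV[R]_n -> \bar R} := mu.
have dom : P `<< mu'.
  apply/null_content_dominatesP => E mE muE0.
  have := PC E mE; rewrite [X in (_ <= _ * X)%E]muE0 mule0 => h.
  by apply/eqP; rewrite eq_le h measure_ge0.
pose g := fine \o (Radon_Nikodym (charge_of_finite_measure P) mu').
have ig : mu'.-integrable setT (Radon_Nikodym (charge_of_finite_measure P) mu').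
  exact: Radon_Nikodym_integrable.
have gE x : (g x)%:E = Radon_Nikodym (charge_of_finite_measure P) mu' x.
  by rewrite /g /= fineK //; exact: Radon_Nikodym_fin_num.
have sg : summ mu g.
  have : mu'.-integrable setT (EFin \o g); last exact.
  by apply: eq_integrable ig => // x _; rewrite /= gE.
have mg := summ_measurable sg.
have Pg h : bounded_measurable h -> \int[P]_x h x = \int[mu]_x (h x * g x).
  move=> bh; rewrite /Rintegral; congr fine.
  have <- := @Radon_Nikodym_change_of_variables _ _ _ P mu' dom (EFin \o h) setT measurableT
    (bounded_measurable_summ P bh).
  by apply: eq_integral => x _ /=; rewrite EFinM gE.
have Lg h : bounded_measurable h -> L h = \int[mu]_x (h x * (g x - C)).
  move=> bh; have [mh [M hM]] := bh.
  have sh := bounded_measurable_summ mu bh.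
  have shg : summ mu (fun x => h x * g x).
    by apply: eq_summ (summM_bounded mh hM sg) => x; exact: mulrC.
  have := hP h bh; rewrite Pg //.
  have -> : \int[mu]_x (h x * (g x - C)) = \int[mu]_x (h x * g x) - C * \int[mu]_x h x.
    rewrite -RintZ // -RintB //; last exact: summZ.
    by apply: eq_Rintegral => x _; ring.
  by move=> ->; rewrite addrK.
(* Where the density [g - C] exceeds its bound. Testing [L] with the sign of the density on [E]
   bounds the integral of [|g - C|] over [E] by [C] times the measure of [E]; so [E] is null and the
   density may be cut off there. *)
pose E := [set x | `|g x - C| > C].
have mE : measurable E.
  rewrite -[E]setTI; apply: measurable_fun_ltr => //; apply: measurableT_comp => //.
  exact: measurable_funB.
pose s x : R := if 0 <= g x - C then 1 else - 1.
have ms : measurable_fun setT s.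
  have -> : s = fun x => 2 * \1_[set x | 0 <= g x - C] x - 1.
    apply/funext => x; rewrite /s indicE; have [h|/negP h] := boolP (0 <= g x - C).
      by rewrite mem_set //=; lra.
    by rewrite memNset //=; lra.
  apply: measurable_funB => //; apply: measurable_funM => //; apply: measurable_indic.
  rewrite -[X in measurable X]setTI; apply: measurable_fun_ler => //.
  exact: measurable_funB.
have E1 x : E x -> \1_E x = 1 :> R by move=> h; rewrite indicE mem_set.
have E0 x : ~ E x -> \1_E x = 0 :> R by move=> h; rewrite indicE memNset.
have C1 x : ~ E x -> \1_(~` E) x = 1 :> R by move=> h; rewrite indicE mem_set.
have C2 x : E x -> \1_(~` E) x = 0 :> R by move=> h; rewrite indicE memNset //; apply.
have pos x : 0 <= (`|g x - C| - C) * \1_E x.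
  have [h|h] := pselect (E x); last by rewrite E0 // mulr0.
  by rewrite E1 // mulr1 subr_ge0 ltW.
have bnd x : ~ E x -> `|g x - C| <= C by move=> h; rewrite leNgt; apply/negP.
have bs : bounded_measurable (fun x => s x * \1_E x).
  split; first by apply: measurable_funM => //; exact: measurable_indic.
  exists 1 => x; rewrite normrM /s; case: ifP; rewrite ?normrN normr1 mul1r indicE;
    by case: (_ \in _); rewrite ?normr1 ?normr0.
have aeE : {ae mu, forall x, (`|g x - C| - C) * \1_E x = 0}.
  have s1 : summ mu (fun x => (`|g x - C| - C) * \1_E x).
    apply: (@summM_bounded _ _ _ _ 1); first exact: measurable_indic.
      by move=> x; rewrite indicE; case: (_ \in _); rewrite ?normr1 ?normr0.
    have sC a : summ mu (fun=> a : R).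
      by apply: bounded_measurable_summ; split=> //; exists `|a|.
    by apply: summB => //; apply: summ_norm; apply: summB.
  apply: Rint_eq0_ae => //.
  apply/eqP; rewrite eq_le; apply/andP; split; last exact: Rint_ge0.
  have h1 := LC _ bs; have h2 := Lg _ bs.
  have e1 : \int[mu]_x (s x * \1_E x * (g x - C)) = \int[mu]_x (`|g x - C| * \1_E x).
    apply: eq_Rintegral => x _; rewrite mulrAC /s; congr (_ * _); case: ifP => h.
      by rewrite mul1r ger0_norm.
    by rewrite mulN1r ltr0_norm // ltNge h.
  have sE a : summ mu (fun x => a * \1_E x : R).
    by apply: summZ; apply: bounded_measurable_summ; exact: bounded_measurable_indic.
  have sgE : summ mu (fun x => `|g x - C| * \1_E x).
    by apply: eq_summ (summD s1 (sE C)) => x; ring.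
  have e2 : \int[leb n]_x (`|s x * \1_E x| * \1_Omega x) = \int[mu]_x (\1_E x : R).
    rewrite hmu; last exact: bounded_measurable_indic.
    apply: eq_Rintegral => x _; congr (_ * _); rewrite normrM /s.
    by case: ifP; rewrite ?normrN normr1 mul1r ger0_norm // indicE.
  rewrite e2 in h1; rewrite e1 in h2; clear e1 e2.
  have -> : \int[mu]_x ((`|g x - C| - C) * \1_E x) =
      \int[mu]_x (`|g x - C| * \1_E x) - C * \int[mu]_x (\1_E x : R).
    rewrite -RintZ; last by apply: bounded_measurable_summ; exact: bounded_measurable_indic.
    by rewrite -RintB //; apply: eq_Rintegral => x _; rewrite mulrBl.
  by rewrite -h2 subr_le0 (le_trans (ler_norm _)).
pose z x := (g x - C) * \1_(~` E `&` Omega) x.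
have mz : measurable_fun setT z.
  apply: measurable_funM; first exact: measurable_funB.
  by apply: measurable_indic; apply: measurableI => //; exact: measurableC.
exists z; split.
- split=> //; exists C => x; rewrite /z indicI /=.
  have [h|h] := pselect (E x); first by rewrite C2 // mul0r mulr0 normr0.
  rewrite C1 // mul1r normrM indicE; case: (_ \in _); first by rewrite normr1 mulr1 bnd.
  by rewrite normr0 mulr0.
- by move=> x nx; rewrite /z indicE memNset ?mulr0 // => -[].
- move=> h bh; have [mh [M hM]] := bh; rewrite Lg //.
  have bz : bounded_measurable (fun x => h x * ((g x - C) * \1_(~` E) x)).
    split; first by apply: measurable_funM => //; apply: measurable_funM;
      [exact: measurable_funB|apply: measurable_indic; exact: measurableC].
    exists (M * C) => x; rewrite normrM ler_pM //.
    have [h'|h'] := pselect (E x); first by rewrite C2 // mulr0 normr0.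
    by rewrite C1 // mulr1 bnd.
  transitivity (\int[mu]_x (h x * ((g x - C) * \1_(~` E) x))); last first.
    rewrite hmu //; apply: eq_Rintegral => x _; rewrite /z indicI /=; ring.
  apply: ae_eq_Rint; [by apply: measurable_funM => //; exact: measurable_funB|by case: bz|].
  apply: filterS aeE => x /= h0; have [h'|h'] := pselect (E x); last by rewrite C1 // mulr1.
  move: h0; rewrite E1 // mulr1 => /eqP; rewrite subr_eq0 => /eqP h2.
  by move: h'; rewrite /E /= h2 ltxx.
Qed.

(** * The integral functional and its conjugate *)

Section convex_duality.
Context {R : realType} {m n : nat}.
Local Notation X := 'rV[R]_n.
Local Notation leb := (leb n).
Local Notation M := 'M[R]_(m, n).
Variable Omega : set X.
Hypotheses (oO : open Omega) (bO : bounded_set Omega).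
Variable A : {linear M -> M}.
Hypothesis A_symmetric : forall y y', frob (A y) y' = frob y (A y').
Hypothesis A_idempotent : forall y, A (A y) = A y.
Variables (f : X -> M -> R) (C0 : R).
Hypothesis C00 : 0 <= C0.
Hypothesis f_borel : measurable_fun (closure Omega `*` [set: M]) (fun xy => f xy.1 xy.2).
Hypothesis f_growth : forall x y, Omega x -> 0 <= f x y <= C0 * (1 + norm1 (A y)).
Hypothesis f_convex : forall x, Omega x -> forall t y y', 0 <= t <= 1 ->
  f x (t *: y + (1 - t) *: y') <= t * f x y + (1 - t) * f x y'.
Implicit Types (Y Z : X -> M).

Definition bmx Y := forall i j, bounded_measurable (fun x => Y x i j).
Definition energy Y : X -> R := (fun x => f x (Y x)) \_ Omega.

Let mO : measurable Omega := open_measurable_rV oO.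

Let fO : (leb Omega < +oo)%E.
Proof.
have [r [r0 Or]] := bounded_set_ball bO.
apply: (@le_lt_trans _ _ (leb (ball (0 : X) r))); last exact: leb_ball_fin.
by apply: le_measure => //; rewrite inE //; exact: measurable_fun_ballrV.
Qed.

Let sO : summ leb (\1_Omega : X -> R).
Proof. exact: summ_indic. Qed.

(** A convex function of linear growth is Lipschitz with the growth constant: [y + h] is a convex
    combination of [y] and the remote point [y + s *: h], the latter with weight [s^-1]. The value
    of [s] makes the lower order part [C0 * (1 + norm1 (A y)) / s] at most [e]. *)
Lemma f_increment x y h : Omega x -> f x (y + h) <= f x y + C0 * norm1 (A h).
Proof.
move=> xO; apply/ler_addgt0Pr => e e0.
pose s := 1 + C0 * (1 + norm1 (A y)) / e.
have a0 : 0 <= C0 * (1 + norm1 (A y)) by rewrite mulr_ge0 // addr_ge0 // norm1_ge0.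
have s1 : 1 <= s by rewrite lerDl divr_ge0 // ltW.
have s0 : 0 < s by exact: lt_le_trans s1.
have si : 0 <= 1 - s^-1 <= 1.
  by rewrite subr_ge0 invf_le1 // s1 lerBlDr lerDl invr_ge0 ltW.
have := f_convex xO y (y + s *: h) si.
have -> : 1 - (1 - s^-1) = s^-1 by ring.
have -> : (1 - s^-1) *: y + s^-1 *: (y + s *: h) = y + h.
  by rewrite scalerDr scalerA mulVf ?gt_eqF // scale1r addrA -scalerDl subrK scale1r.
move=> /le_trans; apply.
have /andP[f0 _] := f_growth y xO; have /andP[_ f1] := f_growth (y + s *: h) xO.
rewrite -addrA; apply: lerD; first by rewrite ler_piMl //; have /andP[] := si.
apply: (@le_trans _ _ (s^-1 * (C0 * (1 + (norm1 (A y) + s * norm1 (A h)))))).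
  rewrite ler_wpM2l ?invr_ge0 ?(ltW s0) // (le_trans f1) // ler_wpM2l // lerD2l.
  rewrite linearD linearZ; apply: (le_trans (norm1D _ _)); by rewrite lerD2l norm1Z gtr0_norm.
have -> : s^-1 * (C0 * (1 + (norm1 (A y) + s * norm1 (A h)))) =
    C0 * norm1 (A h) + s^-1 * (C0 * (1 + norm1 (A y))).
  by field; rewrite gt_eqF.
rewrite lerD2l mulrC ler_pdivrMr // /s.
have -> : e * (1 + C0 * (1 + norm1 (A y)) / e) = e + C0 * (1 + norm1 (A y)).
  by field; rewrite gt_eqF.
by rewrite lerDr ltW.
Qed.

Lemma frob_le (y y' : M) : `|frob y y'| <= norm1 y * norm1 y'.
Proof.
apply: (le_trans (ler_norm_sum _ _ _)); rewrite mulr_suml; apply: ler_sum => i _.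
apply: (le_trans (ler_norm_sum _ _ _)); rewrite mulr_suml; apply: ler_sum => j _.
by rewrite normrM ler_wpM2l // coord_le_norm1.
Qed.

Lemma frobDr (y a b : M) : frob y (a + b) = frob y a + frob y b.
Proof.
rewrite -big_split; apply: eq_bigr => i _; rewrite -big_split; apply: eq_bigr => j _.
by rewrite mxE mulrDr.
Qed.

Lemma frobZr (t : R) (y a : M) : frob y (t *: a) = t * frob y a.
Proof.
rewrite mulr_sumr; apply: eq_bigr => i _; rewrite mulr_sumr; apply: eq_bigr => j _.
by rewrite mxE mulrCA.
Qed.

Lemma bmx_subspace : is_subspace bmx.
Proof.
split=> [i j|a Y Y' bY bY' i j].
  split; first exact: measurable_cst.
  by exists 0 => x; change (`|(0 : M) i j| <= 0); rewrite mxE normr0.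
have := (@bounded_measurable_subspace _ X R).2 a _ _ (bY i j) (bY' i j).
congr bounded_measurable; apply/funext => x.
by change (a * Y x i j + Y' x i j = (a *: Y x + Y' x) i j); rewrite !mxE.
Qed.

Lemma bmx_cst (y : M) : bmx (fun=> y).
Proof. by move=> i j; split=> //; exists `|y i j|. Qed.

Lemma bmx_norm1 Y : bmx Y -> exists2 K, 0 <= K & forall x, norm1 (Y x) <= K.
Proof.
move=> bY; have /choice[K hK] (ij : 'I_m * 'I_n) : exists K : R, forall x, `|Y x ij.1 ij.2| <= K.
  by have [_ [K hK]] := bY ij.1 ij.2; exists K.
exists (\sum_i \sum_j `|K (i, j)|); first by apply: sumr_ge0 => i _; apply: sumr_ge0.
move=> x; apply: ler_sum => i _; apply: ler_sum => j _.
by apply: le_trans (hK (i, j) x) _; exact: ler_norm.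
Qed.

Lemma energy_measurable Y : (forall i j, measurable_fun setT (fun x => Y x i j)) ->
  measurable_fun setT (energy Y).
Proof.
move=> mY; apply/(measurable_restrictT _ mO).
apply: (@measurable_comp _ _ _ _ _ _ (closure Omega `*` setT) (fun xy => f xy.1 xy.2) Omega
  (fun x => (x, Y x))) => //.
- by apply: measurableX => //; apply: closed_measurable_rV; exact: closed_closure.
- by move=> _ [x xO <-]; split=> //=; exact: subset_closure.
- apply: measurable_funTS; apply/measurable_fun_pairP; split; first exact: measurable_id.
  exact: measurable_mx.
Qed.

Lemma energy_ge0 Y x : 0 <= energy Y x.
Proof.
rewrite /energy patchE; case: ifP => // h; rewrite inE in h.
by have /andP[] := f_growth (Y x) h.
Qed.

Lemma energy_le Y x K : norm1 (A (Y x)) <= K -> energy Y x <= C0 * (1 + K) * \1_Omega x.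
Proof.
move=> h; have [xO|nO] := pselect (Omega x); last first.
  by rewrite /energy patch_out // indicE memNset // mulr0.
rewrite /energy patch_in // indicE mem_set // mulr1.
have /andP[_ h2] := f_growth (Y x) xO.
by apply: (le_trans h2); rewrite ler_wpM2l // lerD2l.
Qed.

Lemma energy_summ Y : bmx Y -> summ leb (energy Y).
Proof.
move=> bY; have [K K0 hK] := bmx_norm1 bY; have [KA KA0 hA] := norm1_linear A.
apply: (le_summ (g := fun x => C0 * (1 + KA * K) * \1_Omega x)); last exact: summZ.
  by apply: energy_measurable => i j; have [] := bY i j.
move=> x; rewrite ger0_norm ?energy_ge0 //; apply: energy_le.
by apply: (le_trans (hA _)); rewrite ler_wpM2l.
Qed.

Lemma energy_convex : convex_on bmx (fun Y => \int[leb]_x energy Y x).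
Proof.
move=> t Y Y' bY bY' /andP[t0 t1]; have sY := energy_summ bY; have sY' := energy_summ bY'.
rewrite -!RintZ // -RintD; try exact: summZ.
apply: le_Rint.
- apply: energy_summ.
  exact: (subspaceD bmx_subspace (subspaceZ t bmx_subspace bY) (subspaceZ (1 - t) bmx_subspace bY')).
- by apply: summD; exact: summZ.
- move=> x; have [xO|nO] := pselect (Omega x); last by rewrite /energy !patch_out // !mulr0 addr0.
  rewrite /energy !patch_in //; have := @f_convex x xO t (Y x) (Y' x); apply.
  by rewrite t0.
Qed.

Definition jac (w : 'I_m -> X -> R) : X -> M := fun x => \matrix_(i, j) partial j (w i) x.

Lemma jac_bmx w : (forall i, test_function setT (w i)) -> bmx (jac w).
Proof.
move=> tw i j; have := test_bounded_measurable (test_partial j (tw i)).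
by congr bounded_measurable; apply/funext => x; rewrite mxE.
Qed.

Lemma jac_linear a w w' : (forall i, test_function setT (w i)) ->
  (forall i, test_function setT (w' i)) ->
  jac (fun i x => a * w i x + w' i x) = a *: jac w + jac w'.
Proof.
move=> tw tw'; apply/funext => x; apply/matrixP => i j; rewrite !mxE.
have s := test_smooth (tw i); have s' := test_smooth (tw' i).
rewrite (partialD (@smooth_derivable _ _ _ j x (smoothZ a s)) (@smooth_derivable _ _ _ j x s')).
by rewrite (partialZ _ (@smooth_derivable _ _ _ j x s)).
Qed.

Section dual_field.
Variables (r : 'I_m -> X -> R) (c : R).
Hypothesis sr : forall i, summ leb (r i).

Definition work (w : 'I_m -> X -> R) : R := \sum_i \int[leb]_x (r i x * w i x).

Hypothesis work_le : forall w, (forall i, test_function setT (w i)) ->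
  work w <= \int[leb]_x energy (jac w) x + c.

Let tests w := forall i : 'I_m, test_function [set: X] (w i).

Let testsL a w w' : tests w -> tests w' -> tests (fun i x => a * w i x + w' i x).
Proof. by move=> tw tw' i; exact: testD (testZ a (tw i)) (tw' i). Qed.

Let workL a w w' : tests w -> tests w' ->
  work (fun i x => a * w i x + w' i x) = a * work w + work w'.
Proof.
move=> tw tw'; rewrite mulr_sumr -big_split; apply: eq_bigr => i _ /=.
have s1 v : tests v -> summ leb (fun x => r i x * v i x).
  move=> tv; have [K [_ hK]] := test_bounded (tv i).
  exact: summM_bounded (smooth_measurable (test_smooth (tv i))) hK (sr i).
rewrite -RintZ; last exact: s1.
rewrite -RintD; [|by apply: summZ; exact: s1|exact: s1].
by apply: eq_Rintegral => x _; rewrite mulrDr mulrCA.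
Qed.

(** If two fields have the same gradient, all multiples of their difference satisfy [work_le] with
    the same right-hand side, so the difference does no work. Thus the work is a function of the
    gradient, as the extension requires. *)
Let work_eq w w' : tests w -> tests w' -> jac w = jac w' -> work w = work w'.
Proof.
move=> tw tw' e; apply/eqP; rewrite -subr_eq0; apply/eqP.
pose v i x := (-1) * w' i x + w i x.
have tv : tests v by exact: testsL.
have t0 : tests (fun i x => 0) by move=> i; exact: test0.
have j0 : jac (fun i x => 0) = fun=> 0.
  by apply/funext => x; apply/matrixP => i j; rewrite !mxE (partial_cst (n := n) j (0 : R)).
have jv t : jac (fun i x => t * v i x + 0) = fun=> 0.
  have -> := jac_linear t tv t0; rewrite j0; have -> : jac v = (-1) *: jac w' + jac w by exact: jac_linear.
  rewrite e; apply/funext => x; change (t *: ((-1) *: jac w' x + jac w' x) + 0 = 0).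
  by rewrite scaleN1r addNr scaler0 addr0.
have <- : work v = work w - work w'.
  by rewrite addrC -mulN1r; exact: workL.
have work0 : work (fun i x => 0) = 0.
  by apply: big1 => i _; under eq_Rintegral do rewrite mulr0; exact: Rint0.
apply: (@bounded_multiples_eq0 _ _ (\int[leb]_x energy (fun=> 0) x + c)) => t.
have := work_le (testsL t tv t0); rewrite jv; apply: le_trans.
by have -> := workL t tv t0; rewrite work0 addr0.
Qed.

Lemma dominated_dual : exists L : (X -> M) -> R,
  [/\ linear_on bmx L, forall Y, bmx Y -> L Y <= \int[leb]_x energy Y x + c &
      forall w, (forall i, test_function setT (w i)) -> L (jac w) = work w].
Proof.
pose F := [set Y | exists w, tests w /\ Y = jac w].
pose g0 Y := xget 0 [set t | exists w, [/\ tests w, Y = jac w & t = work w]].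
have g0E w : tests w -> g0 (jac w) = work w.
  move=> tw; have [|w' [tw' e EM]] := @xgetPex _ 0 [set t | exists w', [/\ tests w', jac w = jac w' & t = work w']].
    by exists (work w), w.
  exact: etrans EM (work_eq tw' tw (esym e)).
have [|||||L [lL Lp LF]] := @hahn_banach_dominated _ _ bmx F
   (fun Y => \int[leb]_x energy Y x + c) g0 bmx_subspace.
- split; last first.
    move=> a _ _ [w [tw ->]] [w' [tw' ->]]; exists (fun i x => a * w i x + w' i x).
    by split; [exact: testsL|rewrite jac_linear].
  exists (fun i x => 0); split; first by move=> i; exact: test0.
  by apply/funext => x; apply/matrixP => i j; rewrite !mxE (partial_cst (n := n) j (0 : R)).
- by move=> _ [w [tw ->]]; exact: jac_bmx.
- move=> t Y Y' bY bY' t01; have := energy_convex bY bY' t01; rewrite /=; lra.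
- move=> a _ _ [w [tw ->]] [w' [tw' ->]].
  by rewrite -jac_linear // !g0E ?workL //; exact: testsL.
- by move=> _ [w [tw ->]]; rewrite g0E //; exact: work_le.
exists L; split=> // w tw; rewrite LF ?g0E //; by exists w.
Qed.

End dual_field.

Lemma frob_delta (y : M) k l : frob y (delta_mx k l) = y k l.
Proof.
rewrite /frob (bigD1 k) //= (bigD1 l) //= mxE !eqxx mulr1.
rewrite big1 ?addr0 => [|j /negPf jl]; last by rewrite mxE jl andbF mulr0.
rewrite big1 ?addr0 // => i /negPf ik; apply: big1 => j _; by rewrite mxE ik mulr0.
Qed.

Lemma bmx_scale (h : X -> R) (y : M) : bounded_measurable h -> bmx (fun x => h x *: y).
Proof.
move=> [mh [K hK]] i j; split.
  by under eq_fun do rewrite mxE; apply: measurable_funM.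
by exists (K * `|y i j|) => x; rewrite mxE normrM ler_wpM2r.
Qed.

Lemma bmx_frob Y (y : M) : bmx Y -> bounded_measurable (fun x => frob (Y x) y).
Proof.
move=> bY; split.
  apply: measurable_sum => i; apply: measurable_sum => j; apply: measurable_funM => //.
  by have [] := bY i j.
have [K K0 hK] := bmx_norm1 bY; exists (K * norm1 y) => x.
by apply: (le_trans (frob_le _ _)); rewrite ler_wpM2r ?norm1_ge0.
Qed.

(** Homogeneity removes the constants: the bound at [t *: Y], divided by a large [t], leaves [C0]
    times the integral of [norm1 (A Y)]. It follows that [L] ignores what [A] kills, and that in
    each matrix direction [L] has a bounded density. *)
Lemma dual_density (L : (X -> M) -> R) c : linear_on bmx L ->
  (forall Y, bmx Y -> L Y <= \int[leb]_x energy Y x + c) ->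
  exists Z, [/\ bmx Z, forall x, ~ Omega x -> Z x = 0, {ae leb, forall x, A (Z x) = Z x} &
    forall Y, bmx Y -> L Y = \int[leb]_x frob (Z x) (Y x)].
Proof.
move=> lL Lp; have sB := bmx_subspace; have [KA KA0 hA] := norm1_linear A.
pose V := \int[leb]_x (\1_Omega x : R).
have sN Y : bmx Y -> summ leb (fun x => norm1 (A (Y x)) * \1_Omega x).
  move=> bY; have [K K0 hK] := bmx_norm1 bY.
  apply: (le_summ (g := fun x => KA * K * \1_Omega x)); last exact: summZ.
    apply: measurable_funM; last exact: measurable_indic.
    apply: measurable_sum => i; apply: measurable_sum => j; apply: measurableT_comp => //.
    have -> : (fun x => A (Y x) i j) = (fun x => frob (Y x) (A (delta_mx i j))).
      by apply/funext => x; rewrite -A_symmetric frob_delta.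
    by have [] := bmx_frob (A (delta_mx i j)) bY.
  move=> x; rewrite ger0_norm ?mulr_ge0 ?norm1_ge0 // ler_wpM2r //.
  by apply: (le_trans (hA _)); rewrite ler_wpM2l.
have bound Y : bmx Y -> L Y <= C0 * \int[leb]_x (norm1 (A (Y x)) * \1_Omega x).
  move=> bY; set I := \int[leb]_x _.
  (* The constants add up to [C0 * V + c], which this [t] brings below [e] after division. *)
  apply/ler_addgt0Pr => e e0; pose t := (`|C0 * V + c| + 1) / e.
  have t0 : 0 < t by rewrite divr_gt0 // ltr_wpDl.
  rewrite -(ler_pM2l t0) -(linear_onZ _ sB lL bY).
  apply: (le_trans (Lp _ (subspaceZ t sB bY))).
  apply: (@le_trans _ _ (\int[leb]_x (C0 * \1_Omega x + C0 * t * (norm1 (A (Y x)) * \1_Omega x)) + c)).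
    rewrite lerD2r; apply: le_Rint.
    - exact: energy_summ (subspaceZ t sB bY).
    - by apply: summD; apply: summZ => //; exact: sN.
    - move=> x; apply: (le_trans (energy_le (lexx _))).
      change (C0 * (1 + norm1 (A (t *: Y x))) * \1_Omega x <=
        C0 * \1_Omega x + C0 * t * (norm1 (A (Y x)) * \1_Omega x)).
      rewrite linearZ norm1Z gtr0_norm // le_eqVlt; apply/orP; left; apply/eqP; ring.
  rewrite RintD; [|exact: summZ|by apply: summZ; exact: sN].
  rewrite !RintZ //; last exact: sN.
  rewrite -/V -/I mulrDr /t.
  have -> : (`|C0 * V + c| + 1) / e * e = `|C0 * V + c| + 1 by rewrite divfK // gt_eqF.
  have := ler_norm (C0 * V + c); rewrite mulrAC; set a := C0 * V; lra.
have zero Y : bmx Y -> (forall x, A (Y x) = 0) -> L Y = 0.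
  have le0 Y' : bmx Y' -> (forall x, A (Y' x) = 0) -> L Y' <= 0.
    move=> bY h; apply: (le_trans (bound _ bY)).
    under eq_Rintegral => x _ do rewrite h.
    have -> : norm1 (0 : M) = 0.
      by apply: big1 => i _; apply: big1 => j _; rewrite mxE normr0.
    by under eq_Rintegral do rewrite mul0r; rewrite Rint0 mulr0.
  move=> bY h; apply/eqP; rewrite eq_le le0 //=.
  have := le0 _ (subspaceZ (-1) sB bY); rewrite (linear_onZ _ sB lL bY) mulN1r oppr_le0; apply.
  by move=> x; change (A ((-1) *: Y x) = 0); rewrite scaleN1r linearN h oppr0.
pose D (k : 'I_m * 'I_n) : M := delta_mx k.1 k.2.
have Lk (k : 'I_m * 'I_n) : exists z : X -> R, [/\ bounded_measurable z, vanish_outside Omega z &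
    forall h, bounded_measurable h -> L (fun x => h x *: D k) = \int[leb]_x (h x * z x)].
  apply: (@dominated_functional_density _ _ _ (fun h => L (fun x => h x *: D k))
    (C0 * norm1 (A (D k)))) => //; last 1 first.
  - have le1 h : bounded_measurable h -> L (fun x => h x *: D k) <=
        C0 * norm1 (A (D k)) * \int[leb]_x (`|h x| * \1_Omega x).
      move=> bh; apply: (le_trans (bound _ (bmx_scale (D k) bh))).
      have [mh [K hK]] := bh.
      have s1 : summ leb (fun x => `|h x| * \1_Omega x).
        apply: (@eq_summ _ _ _ _ (fun x => \1_Omega x * `|h x|)) => [x|]; first exact: mulrC.
        by apply: (@summM_bounded _ _ _ _ K) => // [|x]; [exact: measurableT_comp|rewrite normr_id].
      rewrite -mulrA ler_wpM2l // -RintZ //.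
      rewrite le_eqVlt; apply/orP; left; apply/eqP; apply: eq_Rintegral => x _.
      by rewrite linearZ norm1Z; ring.
    move=> h bh; rewrite ler_norml le1 // andbT lerNl.
    have bh' := subspaceZ (-1) (@bounded_measurable_subspace _ X R) bh.
    have := le1 _ bh'.
    have -> : L (fun x => ((-1) *: h) x *: D k) = - L (fun x => h x *: D k).
      have := linear_onZ (-1) sB lL (bmx_scale (D k) bh); rewrite mulN1r => <-; congr L.
      by apply/funext => x; change (((-1) * h x) *: D k = (-1) *: (h x *: D k)); rewrite scalerA.
    move=> /le_trans; apply; rewrite le_eqVlt; apply/orP; left; apply/eqP; congr (_ * _).
    by apply: eq_Rintegral => x _; change (`|(-1) * h x| * \1_Omega x = `|h x| * \1_Omega x);
      rewrite mulN1r normrN.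
  - move=> a h h' bh bh'; rewrite -(lL a _ _ (bmx_scale (D k) bh) (bmx_scale (D k) bh')); congr L.
    apply/funext => x; change ((a * h x + h' x) *: D k = a *: (h x *: D k) + h' x *: D k).
    by rewrite scalerDl scalerA.
  - by rewrite mulr_ge0 // norm1_ge0.
have /choice[z hz] := Lk.
pose Z x : M := \matrix_(i, j) z (i, j) x.
have bZ : bmx Z.
  by move=> i j; have [h _ _] := hz (i, j); move: h; congr bounded_measurable;
    apply/funext => x; rewrite mxE.
have LZ Y : bmx Y -> L Y = \int[leb]_x frob (Z x) (Y x).
  move=> bY.
  have step (s : seq ('I_m * 'I_n)) : bmx (fun x => \sum_(k <- s) Y x k.1 k.2 *: D k) /\
      L (fun x => \sum_(k <- s) Y x k.1 k.2 *: D k) =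
      \sum_(k <- s) \int[leb]_x (Y x k.1 k.2 * z k x).
    elim: s => [|k s [IH1 IH2]].
      have -> : (fun x => \sum_(k <- [::]) Y x k.1 k.2 *: D k) = 0.
        by apply/funext => x; rewrite big_nil.
      by rewrite big_nil (linear_on0 sB lL); split=> //; have [] := sB.
    have -> : (fun x => \sum_(k <- k :: s) Y x k.1 k.2 *: D k) =
        1 *: (fun x => Y x k.1 k.2 *: D k) + (fun x => \sum_(k <- s) Y x k.1 k.2 *: D k).
      apply/funext => x; rewrite big_cons.
      by change (Y x k.1 k.2 *: D k + \sum_(j <- s) Y x j.1 j.2 *: D j =
        1 *: (Y x k.1 k.2 *: D k) + \sum_(j <- s) Y x j.1 j.2 *: D j); rewrite scale1r.
    have bk := bmx_scale (D k) (bY k.1 k.2).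
    split; first by have [_ cl] := sB; exact: cl.
    rewrite lL // IH2 mul1r big_cons; congr (_ + _).
    by have [_ _ h] := hz k; exact: h (bY k.1 k.2).
  have [_ E] := step (index_enum ('I_m * 'I_n)%type).
  have YE : (fun x => \sum_k Y x k.1 k.2 *: D k) = Y.
    apply/funext => x; rewrite [RHS]matrix_sum_delta pair_big /=.
    by apply: eq_bigr => k _.
  rewrite YE in E; rewrite E.
  have s2 (k : 'I_m * 'I_n) : summ leb (fun x => Y x k.1 k.2 * z k x).
    have [mY [K hK]] := bY k.1 k.2; have [[mz [K' hK']] vz _] := hz k.
    have sz : summ leb (z k).
      apply: (le_summ (g := fun x => K' * \1_Omega x)) => //; last exact: summZ.
      move=> x; apply: le_indic => // nO; exact: vz.
    by apply: (eq_summ _ (summM_bounded mY hK sz)) => x; exact: mulrC.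
  rewrite -Rint_sum //; apply: eq_Rintegral => x _; rewrite /frob pair_big /=.
  by apply: eq_bigr => -[i j] _ /=; rewrite mxE mulrC.
exists Z; split=> //.
  by move=> x nO; apply/matrixP => i j; rewrite !mxE; have [_ h _] := hz (i, j); exact: h.
(* With [q] the entry [k] of [Z - A Z], the field [q x *: (D k - A (D k))] is killed by [A], hence
   by [L]; the density formula turns this into a vanishing integral of [q ^+ 2]. *)
have : {ae leb, forall x (k : 'I_m * 'I_n), (Z x - A (Z x)) k.1 k.2 = 0}.
  apply: filter_forall => k; pose q x := frob (Z x) (D k - A (D k)).
  have bq : bounded_measurable q := bmx_frob _ bZ.
  have qE x : q x = (Z x - A (Z x)) k.1 k.2.
    rewrite /q -[- A _]scaleN1r frobDr frobZr -A_symmetric !frob_delta mulN1r.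
    by rewrite !mxE.
  have e0 : \int[leb]_x (q x * q x) = 0.
    have bW := bmx_scale (D k - A (D k)) bq.
    rewrite -(zero _ bW); last by move=> x; rewrite linearZ linearB /= A_idempotent subrr scaler0.
    by rewrite LZ //; apply: eq_Rintegral => x _; rewrite frobZr.
  have sq : summ leb (fun x => q x * q x).
    have [mq [K hK]] := bq.
    apply: (le_summ (g := fun x => K * K * \1_Omega x)); [exact: measurable_funM| |exact: summZ].
    move=> x; apply: (@le_indic R n (K * K) (fun y => q y * q y) Omega x) => [y|nO]; first by rewrite normrM ler_pM.
    rewrite /q; have -> : Z x = 0.
      by apply/matrixP => i j; rewrite !mxE; have [_ h _] := hz (i, j); exact: h.
    have -> : frob (0 : M) (D k - A (D k)) = 0; last by rewrite mulr0.
    by apply: big1 => i _; apply: big1 => j _; rewrite mxE mul0r.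
  have := Rint_eq0_ae sq (fun x => sqr_ge0 (q x)) e0.
  by apply: filterS => x; rewrite -qE => /eqP; rewrite mulf_eq0 orbb => /eqP.
apply: filterS => x h; apply/esym/eqP; rewrite -subr_eq0; apply/eqP/matrixP => i j.
by rewrite (h (i, j)) mxE.
Qed.

Section conjugate.
Variable Z : X -> M.
Hypothesis bZ : bmx Z.

Definition gain Y x : R := frob (Z x) (Y x) * \1_Omega x - energy Y x.

(* Picks, at each point, the best of finitely many candidate matrices; run over the
   rational matrices, its gains increase to the conjugate. *)
Fixpoint selection (y : nat -> M) (N : nat) : X -> M :=
  if N is N'.+1 then
    fun x => if gain (selection y N') x < gain (fun=> y N') x then y N' else selection y N' x
  else fun=> 0.

Lemma gain_measurable Y : bmx Y -> measurable_fun setT (gain Y).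
Proof.
move=> bY; apply: measurable_funB; last by apply: energy_measurable => i j; have [] := bY i j.
apply: measurable_funM; last exact: measurable_indic.
apply: measurable_sum => i; apply: measurable_sum => j; apply: measurable_funM.
  by have [] := bZ i j.
by have [] := bY i j.
Qed.

Lemma gain_summ Y : bmx Y -> summ leb (gain Y).
Proof.
move=> bY; apply: summB; last exact: energy_summ.
have [K K0 hK] := bmx_norm1 bY; have [K' K0' hK'] := bmx_norm1 bZ.
apply: (le_summ (g := fun x => K' * K * \1_Omega x)); last exact: summZ.
  apply: measurable_funM; last exact: measurable_indic.
  apply: measurable_sum => i; apply: measurable_sum => j; apply: measurable_funM.
    by have [] := bZ i j.
  by have [] := bY i j.
move=> x; rewrite normrM (@ger0_norm _ (\1_Omega x)) // ler_wpM2r //.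
by apply: (le_trans (frob_le _ _)); rewrite ler_pM ?norm1_ge0.
Qed.

Lemma gain_pointwise Y Y' x : Y x = Y' x -> gain Y x = gain Y' x.
Proof. by move=> e; rewrite /gain /energy !patchE e. Qed.

Lemma selection_bmx y N : bmx (selection y N).
Proof.
elim: N => [|N IH]; first exact: bmx_cst.
pose E := [set x | gain (selection y N) x < gain (fun=> y N) x].
have mE : measurable E.
  rewrite -[E]setTI; apply: measurable_fun_ltr => //; apply: gain_measurable => //.
  exact: bmx_cst.
move=> i j.
have -> : (fun x => selection y N.+1 x i j) =
    (fun x => y N i j * \1_E x + selection y N x i j * \1_(~` E) x).
  apply/funext => x /=; case: ifP => h; rewrite !indicE.
    by rewrite mem_set // memNset ?mulr1 ?mulr0 ?addr0 //; apply.
  by rewrite memNset ?mem_set ?mulr1 ?mulr0 ?add0r //= /E /= h.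
have [m1 [K hK]] := IH i j; split.
  apply: measurable_funD; apply: measurable_funM => //; apply: measurable_indic => //.
  exact: measurableC.
exists (`|y N i j| + K) => x; apply: (le_trans (ler_normD _ _)); apply: lerD.
  by rewrite normrM ler_piMr // indicE; case: (_ \in _); rewrite ?normr1 ?normr0.
rewrite normrM (le_trans _ (hK x)) // ler_piMr // indicE.
by case: (_ \in _); rewrite ?normr1 ?normr0.
Qed.

Lemma selection_gain y N x :
  gain (selection y N) x <= gain (selection y N.+1) x /\
  gain (fun=> y N) x <= gain (selection y N.+1) x.
Proof.
have [h|h] := boolP (gain (selection y N) x < gain (fun=> y N) x).
  have -> : gain (selection y N.+1) x = gain (fun=> y N) x by apply: gain_pointwise; rewrite /= h.
  by rewrite ltW.
have -> : gain (selection y N.+1) x = gain (selection y N) x.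
  by apply: gain_pointwise; rewrite /= (negbTE h).
by split=> //; rewrite leNgt.
Qed.

Lemma rational_matrix_approx (y : M) (e : R) : 0 < e ->
  exists p : 'M[rat]_(m, n), norm1 (map_mx (ratr : rat -> R) p - y) <= e.
Proof.
move=> e0; pose d := e / (m * n).+1%:R; have d0 : 0 < d by rewrite divr_gt0.
have /choice[p hp] (ij : 'I_m * 'I_n) : exists q : rat, `|ratr q - y ij.1 ij.2| <= d.
  have /rat_in_itvoo [q] : y ij.1 ij.2 - d < y ij.1 ij.2 + d by rewrite ltrBlDr -addrA ltrDl addr_gt0.
  rewrite in_itv /= => /andP[q1 q2]; exists q.
  by rewrite ltW // ltr_distl q1.
exists (\matrix_(i, j) p (i, j)).
apply: (@le_trans _ _ (\sum_(i < m) \sum_(j < n) d)).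
  by apply: ler_sum => i _; apply: ler_sum => j _; rewrite !mxE; exact: (hp (i, j)).
rewrite !sumr_const !card_ord -mulrnA -mulr_natr /d mulrAC ler_pdivrMr //.
by rewrite ler_wpM2l ?(ltW e0) // ler_nat mulnC.
Qed.

Definition rational_matrix k : M :=
  map_mx (ratr : rat -> R) (odflt 0 (unpickle k : option 'M[rat]_(m, n))).

(** Since [f x] is Lipschitz, the rational matrices already realise the supremum in the conjugate.
    The gains of the selections increase to it, which yields its measurability, and monotone
    convergence passes the bound [c] to the limit. *)
Lemma conjugate_integral c : (forall Y, bmx Y -> \int[leb]_x gain Y x <= c) ->
  leb.-integrable Omega (fun x => conjugate f x (Z x)) /\
  (\int[leb]_(x in Omega) conjugate f x (Z x) <= c%:E)%E.
Proof.
move=> hc; pose sel := selection rational_matrix.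
have bs N : bmx (sel N) by exact: selection_bmx.
have nd x : {homo (fun N => gain (sel N) x) : a b / (a <= b)%N >-> a <= b}.
  by apply: homo_leq => //; [exact: le_trans|move=> N; have [] := selection_gain rational_matrix N x].
(* The selections start at the zero matrix, whose gain is [- f x 0], at least [- C0]; adding [C0]
   gives the nonnegativity that monotone convergence asks for. *)
have g0 N x : Omega x -> 0 <= gain (sel N) x + C0.
  move=> xO; rewrite -lerBlDr sub0r; apply: le_trans (nd x 0%N N (leq0n N)).
  have -> : gain (sel 0%N) x = - f x 0.
    rewrite /gain /energy patch_in //=.
    have -> : frob (Z x) 0 = 0 by apply: big1 => i _; apply: big1 => j _; rewrite mxE mulr0.
    by rewrite mul0r sub0r.
  rewrite lerN2; have /andP[_] := f_growth 0 xO; rewrite linear0.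
  have -> : norm1 (0 : M) = 0 by apply: big1 => i _; apply: big1 => j _; rewrite mxE normr0.
  by rewrite addr0 mulr1.
pose g N x : \bar R := (gain (sel N) x + C0)%:E.
have nde x : {homo g ^~ x : a b / (a <= b)%N >-> (a <= b)%E}.
  by move=> a b ab; rewrite lee_fin lerD2r; exact: nd.
pose G x := (conjugate f x (Z x) + C0%:E)%E.
have gainE Y x : Omega x -> gain Y x = frob (Z x) (Y x) - f x (Y x).
  by move=> xO; rewrite /gain /energy patch_in // indicE mem_set // mulr1.
have GE x : Omega x -> G x = ereal_sup (range (g ^~ x)).
  move=> xO; apply/eqP; rewrite eq_le; apply/andP; split; last first.
    apply: ge_ereal_sup => _ [N _ <-]; rewrite /g EFinD /G leeD2r //.
    rewrite gainE //; apply: ereal_sup_ubound; by exists (sel N x).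
  rewrite /G -leeBrDr //; apply: ge_ereal_sup => _ [y _ <-]; rewrite leeBrDr //.
  apply/lee_addgt0Pr => e e0.
  have [KA KA0 hA] := norm1_linear A.
  (* A Lipschitz constant of [frob (Z x) y - f x y] in [y], obtained from [f_increment]; the 1 keeps
     it positive. *)
  pose B := norm1 (Z x) + C0 * KA + 1.
  have B0 : 0 < B by rewrite ltr_wpDl // addr_ge0 ?norm1_ge0 // mulr_ge0.
  have [p hp] := rational_matrix_approx y (divr_gt0 e0 B0).
  pose k := pickle p.
  have kE : rational_matrix k = map_mx (ratr : rat -> R) p by rewrite /rational_matrix pickleK.
  apply: (@le_trans _ _ (g k.+1 x + e%:E)%E); last first.
    by rewrite leeD2r //; apply: ereal_sup_ubound; exists k.+1.
  rewrite /g -!EFinD lee_fin.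
  have [_] := selection_gain rational_matrix k x; rewrite -/(sel k.+1).
  rewrite [gain (fun=> _) x]gainE // kE; set q := map_mx _ p.
  have := f_increment y (q - y) xO; rewrite addrC subrK.
  have := frob_le (Z x) (q - y); rewrite frobDr -[- y]scaleN1r frobZr mulN1r scaleN1r.
  have h1 : norm1 (Z x) * norm1 (q - y) + C0 * norm1 (A (q - y)) <= e.
    apply: (@le_trans _ _ (B * norm1 (q - y))); last by rewrite mulrC -ler_pdivlMr.
    have := hA (q - y); have := norm1_ge0 (q - y); rewrite /B => n0 h.
    have : C0 * norm1 (A (q - y)) <= C0 * (KA * norm1 (q - y)) by rewrite ler_wpM2l.
    lra.
  rewrite ler_norml => /andP[h2 _]; lra.
have gG x : Omega x -> g ^~ x @ \oo --> G x.
  by move=> xO; rewrite GE //; apply: ereal_nondecreasing_cvgn => a b; exact: nde.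
have mg N : measurable_fun Omega (g N).
  apply: measurable_funTS; apply/measurable_EFinP; apply: measurable_funD => //.
  exact: gain_measurable.
have mG : measurable_fun Omega G by exact: (emeasurable_fun_cvg g).
have G0 x : Omega x -> (0 <= G x)%E.
  move=> xO; rewrite GE //; apply: (@le_trans _ _ (g 0%N x)); first by rewrite lee_fin g0.
  by apply: ereal_sup_ubound; exists 0%N.
pose V := \int[leb]_x (\1_Omega x : R).
have Vint (a : R) : (\int[leb]_(x in Omega) a%:E = (a * V)%:E)%E.
  rewrite integral_cst // EFinM; congr (_ * _)%E.
  by rewrite /V /Rintegral integral_indic // setIT fineK // ge0_fin_numE.
have ig N : (\int[leb]_(x in Omega) g N x <= (c + C0 * V)%:E)%E.
  rewrite integral_mkcond.
  have s1 := gain_summ (bs N); have s2 : summ leb (fun x => C0 * \1_Omega x) by exact: summZ.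
  have -> : (\int[leb]_x (g N \_ Omega) x = (\int[leb]_x (gain (sel N) x + C0 * \1_Omega x))%:E)%E.
    rewrite EFin_Rint; last exact: summD.
    apply: eq_integral => x _; rewrite patchE; case: ifP => [h|/negbT h].
      by rewrite indicE h mulr1.
    by rewrite indicE (negbTE h) mulr0 addr0 /gain /energy patchE (negbTE h) indicE (negbTE h) mulr0 subr0.
  by rewrite lee_fin RintD // RintZ // lerD2r; exact: hc.
have iG : (\int[leb]_(x in Omega) G x <= (c + C0 * V)%:E)%E.
  rewrite (eq_integral (fun x => limn (g ^~ x))); last first.
    by move=> x; rewrite inE => xO; apply/esym/cvg_lim => //; exact: gG.
  rewrite monotone_convergence //.
  apply: lime_le; last by apply: nearW => N; exact: ig.
  apply: ereal_nondecreasing_is_cvgn => a b ab; apply: ge0_le_integral => //.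
  - by move=> x xO; rewrite lee_fin; exact: g0.
  - by move=> x xO; exact: nde.
have intG : leb.-integrable Omega G.
  apply/integrableP; split=> //; apply: (@le_lt_trans _ _ (c + C0 * V)%:E); last exact: ltry.
  apply: le_trans iG; rewrite (eq_integral G) // => x; rewrite inE => xO.
  by rewrite gee0_abs // G0.
have intC : leb.-integrable Omega (fun=> C0%:E).
  apply/integrableP; split=> //.
  rewrite (eq_integral (fun=> C0%:E)); first by rewrite Vint ltry.
  by move=> x _; rewrite gee0_abs // lee_fin.
have cE x : Omega x -> conjugate f x (Z x) = (G x - C0%:E)%E.
  by move=> xO; rewrite /G addeK.
split.
  apply: eq_integrable (integrableB mO intG intC) => // x.
  by rewrite inE => xO; rewrite cE.
rewrite (eq_integral (fun x => G x - C0%:E)%E); last by move=> x; rewrite inE => xO; rewrite cE.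
rewrite integralB // Vint leeBlDr //.
Qed.

End conjugate.

End convex_duality.

(** * Normal traces and optimality *)

(* Stated for a set function: [hausdorff] is not known here to be a measure, so the
   library's [integral0] does not apply. *)
Lemma integral_zero d (T : measurableType d) (R : realType) (mu : set T -> \bar R) (D : set T)
    (g : T -> \bar R) : mu set0 = 0%E -> (forall x, g x = 0%E) -> (\int[mu]_(x in D) g x = 0)%E.
Proof.
move=> mu0 g0.
have nn0 (k : T -> \bar R) : (forall x, k x = 0%E) -> ereal_sup [set sintegral mu h |
    h in [set h : {nnsfun T >-> R} | forall x, ((h x)%:E <= k x)%E]] = 0%E.
  move=> k0.
  have s0 (h : T -> R) : (forall x, h x = 0) -> sintegral mu h = 0%E.
    move=> h0; rewrite /sintegral; apply: fsbig1 => y _.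
    have [->|y0] := eqVneq y 0; first by rewrite mul0e.
    have -> : h @^-1` [set y] = set0.
      by apply/seteqP; split=> // x /= hx; move: y0; rewrite -hx h0 eqxx.
    by rewrite mu0 mule0.
  apply/eqP; rewrite eq_le; apply/andP; split.
    apply: ge_ereal_sup => _ [h /= hk <-]; rewrite s0 // => x.
    apply/eqP; rewrite eq_le; apply/andP; split; first by rewrite -lee_fin; have := hk x; rewrite k0.
    exact: fun_ge0.
  apply: ereal_sup_ubound; exists nnsfun0; last exact: s0.
  by move=> x /=; rewrite k0.
rewrite /integral !nn0 ?sube0 // => x; rewrite ?funeposE ?funenegE patchE;
  by case: ifP; rewrite ?g0 ?oppe0 maxxx.
Qed.

Lemma hausdorff_set0 (R : realType) (n s : nat) : @hausdorff R n s set0 = 0%E.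
Proof.
have dge0 (C : set 'rV[R]_n) : C !=set0 -> (0 <= diam C)%E.
  move=> [x Cx]; apply: le_trans (_ : ((fnorm (x - x))%:E <= _)%E).
    by rewrite lee_fin sqrtr_ge0.
  by apply: ereal_sup_ubound; exists x => //; exists x.
have gge0 (C : set 'rV[R]_n) : (0 <= hausdorff_gauge s C)%E.
  rewrite /hausdorff_gauge; case: ifPn => // /set0P /dge0 h.
  apply: mule_ge0; first exact: measure_ge0.
  apply: expe_ge0; apply: mule_ge0; first exact: h.
  by rewrite lee_fin invr_ge0.
have del (d : R) : 0 < d -> hausdorff_delta s d (set0 : set 'rV[R]_n) = 0%E.
  move=> d0; apply/eqP; rewrite eq_le; apply/andP; split.
    apply: ereal_inf_lbound; exists (fun=> set0); first split=> // k.
      rewrite /diam; have -> : [set (fnorm (x - y))%:E | x in (set0 : set 'rV[R]_n) & y in set0] = set0.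
        by apply/seteqP; split=> // t [x []].
      by rewrite ereal_sup0 leNye.
    by apply: eseries0 => k _ _; rewrite /hausdorff_gauge eqxx.
  by apply: le_ereal_inf_tmp => _ [C _ <-]; apply: nneseries_ge0.
rewrite /hausdorff; have -> : [set hausdorff_delta s d (set0 : set 'rV[R]_n) | d in [set d | 0 < d]] = [set 0%E].
  apply/seteqP; split=> [_ [d d0 <-]|_ ->]; first by rewrite del.
  by exists 1; [exact: ltr01|exact: del].
exact: ereal_sup1.
Qed.

Lemma sqsumm_Lfun2 d (T : measurableType d) (R : realType) (mu : {measure set T -> \bar R})
  (h : T -> R) : sqsumm mu h -> h \in Lfun mu 2%:E.
Proof.
move=> [mh sh]; rewrite inE; apply/andP; split; first by rewrite inE.
rewrite inE /= /finite_norm unlock; apply: poweR_lty.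
have /integrableP[_] := sh; congr (_ < _)%E; apply: eq_integral => x _ /=.
by rewrite powR_mulrn // normrX.
Qed.

(* Convolving with the kernel turns a test against any bounded [g] supported
   well inside [Omega] into tests against translates of the kernel. *)
Lemma fundamental_lemma (R : realType) (n : nat) (Omega : set 'rV[R]_n) (h : 'rV[R]_n -> R) :
  open Omega -> bounded_set Omega -> summ (leb n) h -> vanish_outside Omega h ->
  (forall psi, test_function Omega psi -> \int[leb n]_x (h x * psi x) = 0) ->
  {ae leb n, forall x, h x = 0}.
Proof.
move=> oO bO sh vh H; have mh := summ_measurable sh.
have key (g : 'rV[R]_n -> R) (K : set 'rV[R]_n) : bounded_measurable g -> compact K ->
    K `<=` Omega -> vanish_outside K g -> \int[leb n]_x (h x * g x) = 0.
  move=> [mg [M gM]] cK KO vg.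
  have [a a0 Ka] := compact_uniform_ball cK oO KO.
  have sg : summ (leb n) g.
    have [r [r0 Kr]] := bounded_set_ball bO.
    apply: (@summ_bounded_support _ _ M r) => // x nx; apply: vg => /KO /Kr; exact: nx.
  have shg y : summ (leb n) (fun x => h x * g (y + x)).
    by apply: (@summM_bounded _ _ _ _ M) => //; exact: measurable_translate.
  have cv (y : nat -> 'rV[R]_n) : y k @[k --> \oo] --> (0 : 'rV[R]_n) ->
      translate_pair h g (y k) @[k --> \oo] --> translate_pair h g 0.
    move=> y0; rewrite /translate_pair; under [in X in _ --> X]eq_Rintegral do rewrite add0r.
    exact: (translate_L1_cvg y0 sh mg gM).
  have E0 : \int[leb n]_x (h x * g x) = translate_pair h g 0.
    by apply: eq_Rintegral => x _; rewrite add0r.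
  rewrite E0; clear E0; apply/eqP; rewrite -normr_le0; apply/ler_addgt0Pr => e e0; rewrite add0r.
  have [r r0 hr] := seq_continuous_at0 cv e0.
  pose s := Num.min r (a / 2).
  have s0 : 0 < s by rewrite lt_min r0 divr_gt0.
  have tk := kernel_test (n := n) s0.
  have c0 := kernel_mass_gt0 (n := n) s0.
  have := @mollify_approx _ _ h g (kernel s) 1 s e sh sg shg (test_summ tk) (kernel01 s)
    (kernel_even s) (kernel_support s0).
  have -> : \int[leb n]_y (g y * \int[leb n]_x (h x * kernel s (x - y))) = 0.
    rewrite -[RHS](@Rint0 _ _ _ (leb n)); apply: eq_Rintegral => y _.
    have [Ky|nK] := pselect (K y); last by rewrite vg // mul0r.
    rewrite H ?mulr0 //; apply/test_functionP; split; first exact: smooth_translate (test_smooth tk).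
    exists (closed_ball y s); split; first exact: closed_ball_compact.
      apply: subset_trans (Ka y Ky) => x; rewrite closed_ballE // => xy.
      rewrite -ball_normE /=; apply: (le_lt_trans xy).
      by rewrite gt_min [X in _ || X]ltr_pdivrMr // ltr_pMr // ltr1n orbT.
    move=> x nx; apply: kernel_support => // hx; apply: nx; apply: subset_closed_ball.
    by move: hx; rewrite -!ball_normE /= sub0r normrN distrC.
  have H' (y : 'rV[R]_n) : ball (0 : 'rV[R]_n) s y -> `|translate_pair h g y - translate_pair h g 0| <= e.
    by move=> ys; apply: hr; apply: le_ball ys; rewrite ge_min lexx.
  by move=> /(_ H'); rewrite sub0r normrN normrM gtr0_norm // mulrC ler_pM2r.
have [theta [h1 h2 h3]] := exhaustion bO oO.
have ex : is_exhaustion Omega theta by split.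
(* Testing with the sign of [h] times a cutoff gives a vanishing integral of [|h|] times the cutoff;
   the cutoffs then exhaust [Omega]. *)
pose sg x : R := if 0 <= h x then 1 else -1.
have sgh x : h x * sg x = `|h x|.
  rewrite /sg; have [hx|hx] := boolP (0 <= h x); first by rewrite mulr1 ger0_norm.
  by rewrite mulrN1 ltr0_norm // ltNge.
have msg : measurable_fun setT sg.
  have -> : sg = fun x => 2 * \1_[set x | 0 <= h x] x - 1.
    apply/funext => x; rewrite /sg indicE; have [h0|/negP h0] := boolP (0 <= h x).
      by rewrite mem_set //=; lra.
    by rewrite memNset //=; lra.
  apply: measurable_funB => //; apply: measurable_funM => //; apply: measurable_indic.
  by rewrite -[X in measurable X]setTI; apply: measurable_fun_ler.
have Z k : \int[leb n]_x (`|h x| * theta k x) = 0.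
  have [_ [K [cK KO hK]]] := (test_functionP _ _).1 (h1 k).
  have mt := smooth_measurable (test_smooth (h1 k)).
  have := key (fun x => sg x * theta k x) K _ cK KO _.
  under eq_Rintegral do rewrite mulrA sgh.
  apply; last by move=> x nx; rewrite hK // mulr0.
  split; first exact: measurable_funM.
  exists 1 => x; have /andP[t0 t1] := h2 k x; rewrite normrM (ger0_norm t0) /sg.
  by case: ifP => _; rewrite ?normrN normr1 mul1r.
have := exhaustion_Rint_cvg ex oO (summ_norm sh); under eq_fun do rewrite Z.
move=> c1; have E : \int[leb n]_x (`|h x| * \1_Omega x) = 0.
  by apply: (cvg_unique (@Rhausdorff R) c1); exact: cvg_cst.
have sa : summ (leb n) (fun x => `|h x| * \1_Omega x).
  apply: (eq_summ _ (summ_norm sh)) => x; have [xO|nO] := pselect (Omega x).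
    by rewrite indicE mem_set // mulr1.
  by rewrite vh // normr0 mul0r.
have := Rint_eq0_ae sa _ E.
move=> /(_ _)[].
  by move=> x; rewrite mulr_ge0.
move=> B [mB B0 hB]; exists B; split=> // x /= hx; apply: hB => /= hx'; apply: hx.
have [xO|nO] := pselect (Omega x); last exact: vh.
by move: hx' => /eqP; rewrite indicE mem_set // mulr1 normr_eq0 => /eqP.
Qed.

(** * Smooth fields with a single nonzero component *)

Section test_fields.
Context {R : realType} {m n : nat}.
Local Notation X := 'rV[R]_n.
Local Notation leb := (leb n).
Variable Omega : set X.
Hypotheses (oO : open Omega) (bO : bounded_set Omega).

Definition row_field (w : 'I_m -> X -> R) : X -> 'rV[R]_m := fun x => \row_i w i x.

Definition single (i : 'I_m) (psi : X -> R) (k : 'I_m) : X -> R :=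
  if k == i then psi else fun=> 0.

Lemma single_test U i psi : test_function U psi -> forall k, test_function U (single i psi k).
Proof. by move=> t k; rewrite /single; case: ifP => _ //; exact: test0. Qed.

Lemma single_sum i psi (a : 'I_m -> R) x : \sum_k a k * single i psi k x = a i * psi x.
Proof.
rewrite (bigD1 i) //= big1 ?addr0; first by rewrite /single eqxx.
by move=> k /negPf ki; rewrite /single ki mulr0.
Qed.

Lemma frob_jac_single i psi (y : 'M[R]_(m, n)) x :
  frob y (jac (single i psi) x) = \sum_j y i j * partial j psi x.
Proof.
rewrite /frob (bigD1 i) //= [X in _ + X]big1 ?addr0.
  by apply: eq_bigr => j _; rewrite mxE /single eqxx.
move=> k /negPf ki; apply: big1 => j _; rewrite mxE /single ki.
by rewrite (partial_cst (n := n) j (0 : R)) mulr0.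
Qed.

Lemma Lp_bounded p q (Y : X -> 'M[R]_(p, q)) :
  (forall i j, bounded_measurable (fun x => Y x i j)) -> Lp Omega 1%:E Y /\ Lp Omega 2%:E Y.
Proof.
move=> bY.
have bp i j : bounded_measurable ((fun x => Y x i j) \_ Omega).
  have [mY [K hK]] := bY i j; split.
    apply/(measurable_restrictT _ (open_measurable_rV oO)); exact: measurable_funTS.
  by exists `|K| => x; rewrite patchE; case: ifP => _; rewrite ?normr0 // (le_trans (hK x)) // ler_norm.
have sq i j : sqsumm leb ((fun x => Y x i j) \_ Omega).
  by apply: (vanish_bounded_sqsumm bO) => //; exact: patch_out.
split=> i j; last exact: sqsumm_Lfun2.
apply/Lfun1_integrable; apply: (vanish_sqsumm_summ bO) => //; exact: patch_out.
Qed.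

Lemma row_field_Lp w : (forall i, test_function setT (w i)) ->
  Lp Omega 1%:E (row_field w) /\ Lp Omega 2%:E (row_field w).
Proof.
move=> tw; apply: Lp_bounded => i j; have := test_bounded_measurable (tw j).
by congr bounded_measurable; apply/funext => x; rewrite mxE.
Qed.

Lemma row_field_gradient w : (forall i, test_function setT (w i)) ->
  is_weak_gradient Omega (row_field w) (jac w).
Proof.
move=> tw psi tpsi i j.
have vp : vanish_outside Omega psi by exact: test_vanish.
have [_ [K [cK KO hK]]] := (test_functionP _ _).1 tpsi.
rewrite (@Rint_restrict _ _ Omega leb _ (fun x => w i x * partial j psi x)); first last.
- move=> x nx; rewrite (@partial_eq0 _ _ K) ?mulr0 //; first exact: compact_closed_rV.
  by move=> /KO.
- by move=> x _; rewrite mxE.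
rewrite (@Rint_restrict _ _ Omega leb _ (fun x => partial j (w i) x * psi x)); first last.
- by move=> x nx; rewrite vp // mulr0.
- by move=> x _; rewrite mxE.
exact: Rint_by_parts (test_smooth (tw i)) tpsi.
Qed.

End test_fields.

(** * The implications between the four conditions *)

Section main.
Context {R : realType} {m n : nat}.
Local Notation X := 'rV[R]_n.
Local Notation leb := (leb n).
Local Notation M := 'M[R]_(m, n).
Variable Omega : set X.
Hypotheses (oO : open Omega) (bO : bounded_set Omega).
Hypothesis sh : forall p, bd Omega p -> shiftable Omega p.
Variable A : {linear M -> M}.
Hypothesis A_symmetric : forall y y', frob (A y) y' = frob y (A y').
Hypothesis A_idempotent : forall y, A (A y) = A y.
Variables (f : X -> M -> R) (C0 : R).
Hypothesis C00 : 0 <= C0.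
Hypothesis f_borel : measurable_fun (closure Omega `*` [set: M]) (fun xy => f xy.1 xy.2).
Hypothesis f_growth : forall x y, Omega x -> 0 <= f x y <= C0 * (1 + norm1 (A y)).
Hypothesis f_convex : forall x, Omega x -> forall t y y', 0 <= t <= 1 ->
  f x (t *: y + (1 - t) *: y') <= t * f x y + (1 - t) * f x y'.
Local Notation F := (F_dual Omega A f).
Local Notation BVA := (BVA Omega A).
Local Notation X2 := (X2 Omega A).
Local Notation L2 := (Lp Omega 2%:E).
Local Notation admissible := (admissible Omega A f).
Local Notation mass := (pairing_mass Omega).
Local Notation wd := (weak_div Omega).
Local Notation tests w := (forall i : 'I_m, test_function [set: X] (w i)).

Let mO : measurable Omega := open_measurable_rV oO.

Definition inner (u v : X -> 'rV[R]_m) : R := \int[leb]_(x in Omega) frob (u x) (v x).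
Definition conj_energy (z : X -> M) : R := fine (\int[leb]_(x in Omega) conjugate f x (z x)).

Lemma innerE u v : inner u v = \int[leb]_x (\sum_i comp1 Omega u i x * comp1 Omega v i x).
Proof.
apply: Rint_restrict => x xO; last by apply: big1 => i _; rewrite comp1_vanish // mul0r.
by rewrite /frob big_ord1; apply: eq_bigr => i _; rewrite !comp1_in.
Qed.

Lemma inner_summ (u v : X -> 'rV[R]_m) : L2 u -> L2 v ->
  summ leb (fun x => \sum_i comp1 Omega u i x * comp1 Omega v i x).
Proof. by move=> u2 v2; apply: summ_sum => i _; apply: sqsummM; exact: comp1_sqsumm. Qed.

Lemma innerC u v : inner u v = inner v u.
Proof.
by apply: eq_Rintegral => x _; apply: eq_bigr => i _; apply: eq_bigr => j _; exact: mulrC.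
Qed.

Lemma inner_lin t w u r : L2 w -> L2 u -> L2 r ->
  inner (fun x => t *: w x - u x) r = t * inner w r - inner u r.
Proof.
move=> w2 u2 r2; rewrite [inner w r]innerE [inner u r]innerE.
rewrite -RintZ; last exact: inner_summ.
rewrite -RintB; [|by apply: summZ; exact: inner_summ|exact: inner_summ].
apply: Rint_restrict => x xO.
  rewrite /frob big_ord1 mulr_sumr -sumrB; apply: eq_bigr => i _.
  by rewrite !comp1_in // !mxE; ring.
rewrite !big1 ?mulr0 ?subr0 // => i _; by rewrite comp1_vanish // mul0r.
Qed.

Lemma inner_sub w u r : L2 w -> L2 u -> L2 r ->
  inner (fun x => w x - u x) r = inner w r - inner u r.
Proof.
move=> w2 u2 r2; rewrite -[inner w r]mul1r -inner_lin //.
by congr inner; apply/funext => x; rewrite scale1r.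
Qed.

Lemma dual_energyE z w : admissible z ->
  dual_energy Omega f z w = (- conj_energy z + mass z w)%:E.
Proof.
move=> [_ iz]; rewrite /dual_energy EFinD; congr (_ + _)%E.
rewrite EFinN /conj_energy fineK; last exact: integrable_fin_num.
under eq_integral do rewrite -mulN1e.
by rewrite (integralZl mO iz (-1)) mulN1e.
Qed.

Lemma F_ge z w : BVA w -> admissible z -> (dual_energy Omega f z w <= F w)%E.
Proof. by move=> bw az; rewrite /F_dual asboolT //; apply: ereal_sup_ubound; exists z. Qed.

Lemma gain_le (Z : X -> M) c : bmx Z -> {ae leb, forall x, A (Z x) = Z x} ->
  (forall Y, bmx Y -> \int[leb]_x gain Omega f Z Y x <= c) ->
  (exists d, L2 d /\ is_weak_div Omega Z d) -> admissible Z /\ conj_energy Z <= c.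
Proof.
move=> bZ aZ gc dZ.
have [ic le] := conjugate_integral oO bO C00 f_borel f_growth f_convex bZ gc.
have fin := integrable_fin_num mO ic.
split; last by rewrite -lee_fin /conj_energy fineK.
split=> //; split=> //; last by apply: filterS aZ.
move=> i j; have [mz [K hK]] := bZ i j; apply: (@bounded_Lfuny _ _ _ _ _ `|K|).
  by apply/(measurable_restrictT _ mO); exact: measurable_funTS.
by move=> x; rewrite patchE; case: ifP => _; rewrite ?normr0 // (le_trans (hK x)) // ler_norm.
Qed.

Let ler12 : (1 : R) <= 2. Proof. by rewrite ler1n. Qed.

Let zero_tests : tests (fun=> (fun=> 0) : X -> R).
Proof. by move=> i; exact: test0. Qed.

Let row0 : row_field (fun=> fun=> 0) = (fun=> 0) :> (X -> 'rV[R]_m).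
Proof. by apply/funext => x; apply/rowP => i; rewrite !mxE. Qed.

Lemma BVA_row_field w : tests w -> BVA (row_field w).
Proof.
move=> tw; apply: (@BVA_weak_gradient _ _ _ Omega A _ (jac w)).
- by have [] := row_field_Lp oO bO tw.
- by have [] := Lp_bounded oO bO (jac_bmx tw).
- exact: row_field_gradient.
Qed.

Lemma L2_zero : L2 (fun=> 0 : 'rV[R]_m).
Proof. by rewrite -row0; have [] := row_field_Lp oO bO zero_tests. Qed.

Lemma BVA_zero : BVA (fun=> 0).
Proof. by rewrite -row0; exact: BVA_row_field. Qed.

(** The gain of any field against [Z = 0] is at most 0, as [f] is nonnegative. The zero field keeps
    the supremum in [F_dual] above -oo. *)
Lemma admissible_zero : admissible (fun=> 0).
Proof.
have [] := @gain_le (fun=> 0) 0 (bmx_cst 0) _ _ _ => //.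
- by apply: nearW => x; rewrite linear0.
- move=> Y bY; rewrite -(@Rint0 _ _ _ leb); apply: le_Rint.
  + exact: (gain_summ oO bO C00 f_borel f_growth (bmx_cst 0) bY).
  + exact: summ0.
  + move=> x; rewrite /gain.
    have -> : frob (0 : M) (Y x) = 0 by apply: big1 => i _; apply: big1 => j _; rewrite mxE mul0r.
    by rewrite mul0r sub0r oppr_le0; exact: (energy_ge0 f_growth).
- exists (fun=> 0); split; first exact: L2_zero.
  move=> psi tpsi i.
  rewrite (@Rint_restrict _ _ Omega leb _ (fun=> 0)) //; last first.
    by move=> x _; apply: big1 => j _; rewrite mxE mul0r.
  rewrite (@Rint_restrict _ _ Omega leb _ (fun=> 0)) //; last by move=> x _; rewrite mxE mul0r.
  by rewrite Rint0 oppr0.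
Qed.

Lemma F_finite u : F u != +oo%E -> BVA u /\ exists a, F u = a%:E.
Proof.
move=> Fu; have bu : BVA u.
  by apply: contrapT => nb; move: Fu; rewrite /F_dual asboolF.
split=> //; have := F_ge bu admissible_zero; rewrite dual_energyE; last exact: admissible_zero.
by case: (F u) Fu => // a _ _; exists a.
Qed.

(** The divergence of [z] is picked by choice; the fundamental lemma makes it agree almost
    everywhere with any other weak divergence. *)
Lemma weak_div_ae (z : X -> M) d : X2 z -> L2 d -> is_weak_div Omega z d ->
  {ae leb, forall x i, comp1 Omega (wd z) i x = comp1 Omega d i x}.
Proof.
move=> Xz d2 dz; have [w2 wz] := X2_weak_div Xz.
apply: filter_forall => i.
have s1 v : L2 v -> summ leb (comp1 Omega v i).
  move=> v2; apply: (vanish_sqsumm_summ bO); [exact: comp1_sqsumm|exact: comp1_vanish].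
have := @fundamental_lemma _ _ Omega (fun x => comp1 Omega (wd z) i x - comp1 Omega d i x) oO bO _ _ _.
move=> /(_ _ _ _)[].
- by apply: summB; exact: s1.
- by move=> x nx; rewrite !comp1_vanish // subrr.
- move=> psi tpsi; have [K [_ hK]] := test_bounded tpsi.
  have mpsi := smooth_measurable (test_smooth tpsi).
  have e1 := is_weak_divc wz tpsi i; have e2 := is_weak_divc dz tpsi i.
  transitivity (\int[leb]_x (comp1 Omega (wd z) i x * psi x) - \int[leb]_x (comp1 Omega d i x * psi x)).
    rewrite -RintB; [|exact: summM_bounded mpsi hK (s1 _ w2)|exact: summM_bounded mpsi hK (s1 _ d2)].
    by apply: eq_Rintegral => x _; rewrite mulrBl.
  by apply/eqP; rewrite subr_eq0 -eqr_opp -e1 -e2.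
move=> B [mB B0 hB]; exists B; split=> // x /= h; apply: hB => /= /eqP; rewrite subr_eq0 => /eqP; exact: h.
Qed.

(* The test functions need not vanish on the boundary: this is the weak form of a
   zero normal trace. *)
Lemma mass_of_tests (z : X -> M) (r w : X -> 'rV[R]_m) : X2 z -> L2 r ->
  (forall i psi, test_function setT psi ->
    \int[leb]_x (\sum_j comp2 Omega z i j x * partial j psi x) =
    \int[leb]_x (comp1 Omega r i x * psi x)) ->
  {ae leb, forall x i, comp1 Omega (wd z) i x = - comp1 Omega r i x} ->
  L2 w -> BVA w -> mass z w = inner w r.
Proof.
move=> Xz r2 H ae w2 bw; have [d2 _] := X2_weak_div Xz.
have md i : measurable_fun setT (comp1 Omega (wd z) i) by have [] := comp1_sqsumm d2 i.
have mr i : measurable_fun setT (comp1 Omega r i) by have [] := comp1_sqsumm r2 i.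
have mw i : measurable_fun setT (comp1 Omega w i) by have [] := comp1_sqsumm w2 i.
have sr i : summ leb (comp1 Omega r i).
  by apply: (vanish_sqsumm_summ bO); [exact: comp1_sqsumm|exact: comp1_vanish].
rewrite (mass_flux oO bO A_symmetric sh Xz _ w2 bw).
  rewrite -/(inner _ _) innerC !innerE -RintN; last exact: inner_summ.
  apply: ae_eq_Rint.
  - by apply: measurableT_comp => //; apply: measurable_sum => i; exact: measurable_funM.
  - by apply: measurable_sum => i; exact: measurable_funM.
  apply: filterS ae => x h; rewrite -sumrN; apply: eq_bigr => i _.
  by rewrite h mulrN opprK.
move=> psi tpsi i; rewrite H // -RintN.
  apply: ae_eq_Rint.
  - by apply: measurable_funM => //; exact: smooth_measurable (test_smooth tpsi).
  - apply: measurableT_comp => //; apply: measurable_funM => //; exact: smooth_measurable (test_smooth tpsi).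
  by apply: filterS ae => x h; rewrite h mulNr opprK.
have [K [_ hK]] := test_bounded tpsi.
apply: summM_bounded (smooth_measurable (test_smooth tpsi)) hK _.
by apply: (vanish_sqsumm_summ bO); [exact: comp1_sqsumm|exact: comp1_vanish].
Qed.

(** For a smooth field the mass is the integral of [z : D w], so Fenchel's inequality can be applied
    pointwise. *)
Lemma F_smooth_le w : tests w -> (F (row_field w) <= (\int[leb]_x energy Omega f (jac w) x)%:E)%E.
Proof.
move=> tw; rewrite /F_dual asboolT; last exact: BVA_row_field.
apply: ge_ereal_sup => _ [z az <-]; rewrite dual_energyE // lee_fin.
have [Xz iz] := az; have [w1 w2] := row_field_Lp oO bO tw.
have bj := jac_bmx tw; have [j1 _] := Lp_bounded oO bO bj.
have [sg ->] := mass_gradient oO bO A_symmetric Xz w2 w1 j1 (row_field_gradient tw).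
have se := energy_summ oO bO C00 f_borel f_growth bj.
pose k x := \sum_i \sum_j comp2 Omega (jac w) i j x * comp2 Omega z i j x - energy Omega f (jac w) x.
have sk : summ leb k by exact: summB.
have -> : \int[leb]_(x in Omega) frob (z x) (jac w x) =
    \int[leb]_x (\sum_i \sum_j comp2 Omega (jac w) i j x * comp2 Omega z i j x).
  apply: Rint_restrict => x xO.
    by apply: eq_bigr => i _; apply: eq_bigr => j _; rewrite !comp2_in // mulrC.
  by apply: big1 => i _; apply: big1 => j _; rewrite comp2_out // mul0r.
rewrite addrC lerBlDr -lerBlDl -RintB // -lee_fin EFin_Rint // /conj_energy fineK; last exact: integrable_fin_num.
have -> : (\int[leb]_x (k x)%:E = \int[leb]_(x in Omega) (k x)%:E)%E.
  rewrite [RHS]integral_mkcond; apply: eq_integral => x _; rewrite patchE; case: ifPn => //.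
  move=> /negP; rewrite inE => nO; rewrite /k /energy patch_out // subr0 big1 // => i _.
  by apply: big1 => j _; rewrite comp2_out // mul0r.
apply: le_integral => //; first exact: (integrableS measurableT mO (@subsetT _ _) sk).
move=> x; rewrite inE => xO; apply: ereal_sup_ubound; exists (jac w x) => //; congr EFin.
rewrite /k /energy patch_in //; congr (_ - _).
by apply: eq_bigr => i _; apply: eq_bigr => j _; rewrite !comp2_in // mulrC.
Qed.

Lemma weak_div_of_tests (z : X -> M) (r : X -> 'rV[R]_m) : L2 r ->
  (forall i psi, test_function setT psi ->
    \int[leb]_x (\sum_j comp2 Omega z i j x * partial j psi x) =
    \int[leb]_x (comp1 Omega r i x * psi x)) ->
  L2 (fun x => - r x) /\ is_weak_div Omega z (fun x => - r x).
Proof.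
move=> r2 H; split.
  have := Lp_scale (-1) ler12 r2.
  by congr (Lp Omega _ _); apply/funext => x; rewrite scaleN1r.
move=> psi tpsi i; have tT := test_subset (@subsetT _ Omega) tpsi.
rewrite (@Rint_restrict _ _ Omega leb _ (fun x => \sum_j comp2 Omega z i j x * partial j psi x)); first last.
- by move=> x nx; apply: big1 => j _; rewrite comp2_out // mul0r.
- by move=> x xO; apply: eq_bigr => j _; rewrite comp2_in.
rewrite H // (@Rint_restrict _ _ Omega leb _ (fun x => - (comp1 Omega r i x * psi x))); first last.
- by move=> x nx; rewrite comp1_vanish // mul0r oppr0.
- by move=> x xO; rewrite comp1_in // mxE mulNr.
rewrite RintN ?opprK //; have [K [_ hK]] := test_bounded tpsi.
apply: summM_bounded (smooth_measurable (test_smooth tpsi)) hK _.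
by apply: (vanish_sqsumm_summ bO); [exact: comp1_sqsumm|exact: comp1_vanish].
Qed.

Lemma weak_div_opp (z : X -> M) (r : X -> 'rV[R]_m) : X2 z -> L2 r ->
  (forall i psi, test_function setT psi ->
    \int[leb]_x (\sum_j comp2 Omega z i j x * partial j psi x) =
    \int[leb]_x (comp1 Omega r i x * psi x)) ->
  {ae leb, forall x i, comp1 Omega (wd z) i x = - comp1 Omega r i x}.
Proof.
move=> Xz r2 H; have [rn2 dz] := weak_div_of_tests r2 H.
apply: filterS (weak_div_ae Xz rn2 dz) => x h i; rewrite h.
have [xO|nO] := pselect (Omega x); first by rewrite !comp1_in // mxE.
by rewrite !comp1_vanish // oppr0.
Qed.

Lemma minimizer_to_field (u r : X -> 'rV[R]_m) : L2 u -> L2 r ->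
  subdifferential Omega F u r ->
  exists2 z, admissible z & forall w, BVA w -> L2 w ->
    ((inner (fun x => (w x - u x)%R) r)%:E <= dual_energy Omega f z w - F u)%E.
Proof.
move=> u2 r2 H.
(* If [F u] were +oo, the right-hand side of the subgradient inequality at the zero field would be
   -oo. *)
have [bu [a Fu]] : BVA u /\ exists a, F u = a%:E.
  apply: F_finite; apply/eqP => Fu; have := H _ L2_zero; rewrite Fu /=.
  by case: (F _).
pose c := inner u r - a.
have sr i : summ leb (comp1 Omega r i).
  by apply: (vanish_sqsumm_summ bO); [exact: comp1_sqsumm|exact: comp1_vanish].
have workE w : tests w -> work (comp1 Omega r) w = inner (row_field w) r.
  move=> tw; rewrite innerE Rint_sum; last first.
    move=> i _; apply: sqsummM; apply: comp1_sqsumm => //.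
    by have [] := row_field_Lp oO bO tw.
  apply: eq_bigr => i _; apply: eq_Rintegral => x _.
  have [xO|nO] := pselect (Omega x); last by rewrite !comp1_vanish // !mul0r.
  by rewrite !comp1_in // mxE mulrC.
have work_le w : tests w -> work (comp1 Omega r) w <= \int[leb]_x energy Omega f (jac w) x + c.
  move=> tw; have [w1 w2] := row_field_Lp oO bO tw.
  have := H _ w2; rewrite Fu -/(inner _ _) innerC inner_sub // workE // => h.
  have := F_smooth_le tw; case: (F _) h => [b| |] //=; rewrite -?EFinB ?lee_fin // /c; lra.
have [L [lL Lp LW]] := dominated_dual oO bO C00 f_borel f_growth f_convex sr work_le.
have [Z [bZ vZ aZ LZ]] := dual_density oO bO A_symmetric A_idempotent C00 f_borel f_growth lL Lp.
have frobZ i psi : test_function setT psi ->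
    \int[leb]_x (\sum_j comp2 Omega Z i j x * partial j psi x) = \int[leb]_x (comp1 Omega r i x * psi x).
  move=> tpsi; have ts := single_test i tpsi.
  transitivity (L (jac (single i psi))).
    rewrite LZ; last exact: jac_bmx.
    apply: eq_Rintegral => x _; rewrite frob_jac_single; apply: eq_bigr => j _; congr (_ * _).
    have [xO|nO] := pselect (Omega x); first by rewrite comp2_in.
    by rewrite comp2_out // vZ // mxE.
  rewrite LW // /work -Rint_sum; last first.
    move=> k _; have [K [_ hK]] := test_bounded (ts k).
    exact: summM_bounded (smooth_measurable (test_smooth (ts k))) hK (sr k).
  by apply: eq_Rintegral => x _; rewrite (single_sum i psi (fun k => comp1 Omega r k x)).
have [rn2 dZ] := weak_div_of_tests r2 frobZ.
have gc Y : bmx Y -> \int[leb]_x gain Omega f Z Y x <= c.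
  move=> bY; have se := energy_summ oO bO C00 f_borel f_growth bY.
  have E : (fun x => gain Omega f Z Y x + energy Omega f Y x) =1 (fun x => frob (Z x) (Y x)).
    move=> x; rewrite /gain subrK; have [xO|nO] := pselect (Omega x).
      by rewrite indicE mem_set // mulr1.
    rewrite vZ //; have -> : frob (0 : M) (Y x) = 0; last by rewrite mul0r.
    by apply: big1 => i _; apply: big1 => j _; rewrite mxE mul0r.
  have := Lp Y bY; rewrite LZ //.
  under eq_Rintegral do rewrite -E.
  rewrite RintD //; last exact: (gain_summ oO bO C00 f_borel f_growth bZ bY).
  lra.
have [az cz] := gain_le bZ aZ gc (ex_intro _ _ (conj rn2 dZ)).
exists Z => // w bw w2; have [Xz _] := az.
rewrite dual_energyE // Fu -EFinB lee_fin inner_sub //.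
rewrite (mass_of_tests Xz r2 frobZ (weak_div_opp Xz r2 frobZ) w2 bw).
move: cz; rewrite /c; lra.
Qed.

Lemma field_identities (u r : X -> 'rV[R]_m) (z : X -> M) : L2 u -> L2 r -> admissible z ->
  (forall w, BVA w -> L2 w ->
    ((inner (fun x => (w x - u x)%R) r)%:E <= dual_energy Omega f z w - F u)%E) ->
  [/\ BVA u, F u = dual_energy Omega f z u & forall w, BVA w -> L2 w -> mass z w = inner w r].
Proof.
move=> u2 r2 az H.
have [bu [a Fu]] : BVA u /\ exists a, F u = a%:E.
  apply: F_finite; apply/eqP => Fu; have := H _ BVA_zero L2_zero.
  by rewrite Fu dual_energyE.
have H' w : BVA w -> L2 w -> inner w r - inner u r <= - conj_energy z + mass z w - a.
  by move=> bw w2; have := H w bw w2; rewrite Fu dual_energyE // -EFinB lee_fin inner_sub.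
have massE w : BVA w -> L2 w -> mass z w = inner w r.
  move=> bw w2; apply/esym/eqP; rewrite -subr_eq0; apply/eqP.
  apply: (@bounded_multiples_eq0 _ _ (inner u r - conj_energy z - a)) => t.
  have tw2 := Lp_scale t ler12 w2; have btw := BVA_scale t bw.
  have := H' _ btw tw2; have [Xz _] := az.
  rewrite (mass_scale oO bO A_symmetric Xz w2 bw tw2 btw).
  have -> : inner (fun x => t *: w x) r = t * inner w r.
    have := inner_lin t w2 L2_zero r2.
    have -> : inner (fun=> 0) r = 0.
      rewrite innerE -[RHS](@Rint0 _ _ _ leb); apply: eq_Rintegral => x _; apply: big1 => i _.
      rewrite /comp1 patchE; case: ifP => _; by rewrite ?mxE mul0r.
    rewrite subr0 => <-; congr inner; by apply/funext => x; rewrite subr0.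
  by rewrite mulrBr; set p := t * inner w r; set q := t * mass z w; lra.
split=> //; rewrite dual_energyE // Fu; congr EFin; apply/eqP; rewrite eq_le.
have := H' u bu u2; have := F_ge bu az; rewrite dual_energyE // Fu lee_fin => h1 h2.
by apply/andP; split=> //; lra.
Qed.

Lemma frob_single_tests (z : X -> M) (i : 'I_m) (psi : X -> R) : test_function setT psi ->
  \int[leb]_(x in Omega) frob (z x) (jac (single i psi) x) =
  \int[leb]_x (\sum_j comp2 Omega z i j x * partial j psi x).
Proof.
move=> tpsi; apply: Rint_restrict => x xO.
  by rewrite frob_jac_single; apply: eq_bigr => j _; rewrite comp2_in.
by apply: big1 => j _; rewrite comp2_out // mul0r.
Qed.

Lemma inner_single (v : X -> 'rV[R]_m) (i : 'I_m) (psi : X -> R) :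
  inner (row_field (single i psi)) v = \int[leb]_x (comp1 Omega v i x * psi x).
Proof.
apply: Rint_restrict => x xO; last by rewrite comp1_vanish // mul0r.
rewrite comp1_in // -(single_sum i psi (fun k => v x 0 k)) /frob big_ord1.
by apply: eq_bigr => k _; rewrite mxE mulrC.
Qed.

Lemma tests_of_mass (z : X -> M) (r : X -> 'rV[R]_m) : X2 z ->
  (forall w, BVA w -> L2 w -> mass z w = inner w r) ->
  forall i psi, test_function setT psi ->
    \int[leb]_x (\sum_j comp2 Omega z i j x * partial j psi x) =
    \int[leb]_x (comp1 Omega r i x * psi x).
Proof.
move=> Xz H i psi tpsi; have ts := single_test i tpsi.
have [w1 w2] := row_field_Lp oO bO ts; have [j1 _] := Lp_bounded oO bO (jac_bmx ts).
have [_ e] := mass_gradient oO bO A_symmetric Xz w2 w1 j1 (row_field_gradient ts).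
by rewrite -frob_single_tests // -e H ?inner_single //; exact: BVA_row_field.
Qed.

Lemma trace_integral (z : X -> M) (phi : X -> 'rV[R]_m) (G : X -> M) : X2 z -> L2 phi -> Lp Omega 1%:E phi ->
  Lp Omega 1%:E G -> is_weak_gradient Omega phi G ->
  (\int[leb]_(x in Omega) (frob (wd z x) (phi x) + frob (z x) (G x))%:E =
   (inner (wd z) phi + \int[leb]_(x in Omega) frob (z x) (G x))%:E)%E.
Proof.
move=> Xz p2 p1 G1 pG; have [d2 _] := X2_weak_div Xz.
have [s2 _] := mass_gradient oO bO A_symmetric Xz p2 p1 G1 pG.
have s1 := inner_summ d2 p2.
have -> : \int[leb]_(x in Omega) frob (z x) (G x) =
    \int[leb]_x (\sum_i \sum_j comp2 Omega G i j x * comp2 Omega z i j x).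
  apply: Rint_restrict => x xO.
    by apply: eq_bigr => i _; apply: eq_bigr => j _; rewrite !comp2_in // mulrC.
  by apply: big1 => i _; apply: big1 => j _; rewrite comp2_out // mul0r.
rewrite innerE -RintD // EFin_Rint; last exact: summD.
rewrite [LHS]integral_mkcond; apply: eq_integral => x _; rewrite patchE; case: ifPn => [|/negP].
  rewrite inE => xO; congr EFin; congr (_ + _).
    by rewrite /frob big_ord1; apply: eq_bigr => i _; rewrite !comp1_in.
  by apply: eq_bigr => i _; apply: eq_bigr => j _; rewrite !comp2_in // mulrC.
rewrite inE => nO; rewrite !big1 ?addr0 // => i _; last by rewrite comp1_vanish // mul0r.
by apply: big1 => j _; rewrite comp2_out // mul0r.
Qed.

Lemma inner_weak_div (z : X -> M) (r w : X -> 'rV[R]_m) : X2 z -> L2 r -> L2 w ->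
  {ae leb, forall x i, comp1 Omega (wd z) i x = - comp1 Omega r i x} ->
  inner (wd z) w = - inner w r.
Proof.
move=> Xz r2 w2 ae; have [d2 _] := X2_weak_div Xz.
have md i : measurable_fun setT (comp1 Omega (wd z) i) by have [] := comp1_sqsumm d2 i.
have mr i : measurable_fun setT (comp1 Omega r i) by have [] := comp1_sqsumm r2 i.
have mw i : measurable_fun setT (comp1 Omega w i) by have [] := comp1_sqsumm w2 i.
rewrite !innerE -RintN; last exact: inner_summ.
apply: ae_eq_Rint.
- by apply: measurable_sum => i; exact: measurable_funM.
- by apply: measurableT_comp => //; apply: measurable_sum => i; exact: measurable_funM.
apply: filterS ae => x h; rewrite -sumrN; apply: eq_bigr => i _.
by rewrite h mulNr mulrC.
Qed.

(** The volume integral in the trace identity is [inner (wd z) phi] plus the mass of the pairing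
    with [phi]. The first is [- inner phi r], the second [inner phi r]. *)
Lemma normal_trace_zero (z : X -> M) (r : X -> 'rV[R]_m) : X2 z -> L2 r ->
  (forall w, BVA w -> L2 w -> mass z w = inner w r) ->
  is_normal_trace Omega z (fun=> 0).
Proof.
move=> Xz r2 H; have H0 : hausdorff n.-1 (set0 : set X) = 0%E by exact: hausdorff_set0.
split; first by move=> i; exact: measurable_cst.
split.
  exists 0; exists set0; split=> // x /= h; apply: h => _.
  rewrite /fnorm; have -> : frob (0 : 'rV[R]_m) 0 = 0; last by rewrite sqrtr0.
  by apply: big1 => i _; apply: big1 => j _; rewrite mxE mul0r.
move=> phi G p1 p2 G1 pG; rewrite (trace_integral Xz p2 p1 G1 pG).
have bp : BVA phi := @BVA_weak_gradient _ _ _ Omega A _ _ p1 G1 pG.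
have [_ <-] := mass_gradient oO bO A_symmetric Xz p2 p1 G1 pG.
rewrite (H _ bp p2) (inner_weak_div Xz r2 p2 (weak_div_opp Xz r2 (tests_of_mass Xz H))) addNr.
apply/esym; apply: integral_zero => // x; congr EFin.
by apply: big1 => i _; apply: big1 => j _; rewrite [X in _ * X]mxE mulr0.
Qed.

(** A zero trace, tested on one component at a time, gives the divergence identity on the whole
    space, and Gauss-Green turns the mass into [inner v r]. The dual energy of [z] is then an affine
    minorant of [F] with slope [r] that touches it at [u]. *)
Lemma field_to_minimizer (u r : X -> 'rV[R]_m) (z : X -> M) :
  L2 u -> L2 r -> BVA u -> admissible z ->
  {ae leb, forall x, Omega x -> r x = - wd z x} -> is_normal_trace Omega z (fun=> 0) ->
  F u = dual_energy Omega f z u -> subdifferential Omega F u r.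
Proof.
move=> u2 r2 bu az ae [_ [_ tr]] Fu w w2; have [Xz _] := az.
have H0 : hausdorff n.-1 (set0 : set X) = 0%E by exact: hausdorff_set0.
have ae' : {ae leb, forall x i, comp1 Omega (wd z) i x = - comp1 Omega r i x}.
  apply: filterS ae => x h i; have [xO|nO] := pselect (Omega x).
    by rewrite !comp1_in // h // mxE opprK.
  by rewrite !comp1_vanish // oppr0.
have tests i psi : test_function setT psi ->
    \int[leb]_x (\sum_j comp2 Omega z i j x * partial j psi x) =
    \int[leb]_x (comp1 Omega r i x * psi x).
  move=> tpsi; have ts := single_test i tpsi.
  have [w1 ww2] := row_field_Lp oO bO ts; have [j1 _] := Lp_bounded oO bO (jac_bmx ts).
  have := tr _ _ w1 ww2 j1 (row_field_gradient ts).
  rewrite (trace_integral Xz ww2 w1 j1 (row_field_gradient ts)).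
  rewrite integral_zero //; last first.
    by move=> x; congr EFin; apply: big1 => k _; apply: big1 => j _; rewrite [X in _ * X]mxE mulr0.
  rewrite (inner_weak_div Xz r2 ww2 ae') frob_single_tests // inner_single => -[e].
  by apply/eqP; rewrite -subr_eq0 addrC; apply/eqP.
have massE v : BVA v -> L2 v -> mass z v = inner v r.
  by move=> bv v2; exact: mass_of_tests Xz r2 tests ae' v2 bv.
have [bw|nb] := pselect (BVA w); last first.
  by rewrite [F w]/F_dual asboolF // Fu dual_energyE // leey.
rewrite -/(inner _ _) innerC inner_sub // Fu dual_energyE // leeBrDr //.
have := F_ge bw az; apply: le_trans; rewrite dual_energyE // -EFinD lee_fin.
by rewrite !massE //; set p := inner w r; set q := inner u r; lra.
Qed.

End main.

Theorem theorem4p7 (R : realType) (m n : nat) (Omega : set 'rV[R]_n.+1)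
  (A : {linear 'M[R]_(m, n.+1) -> 'M[R]_(m, n.+1)})
  (f : 'rV[R]_n.+1 -> 'M[R]_(m, n.+1) -> R) (c0 C0 : R)
  (Omega_bounded : bounded_set Omega)
  (Omega_open : open Omega)
  (Omega_lipschitz : lipschitz_boundary Omega)
  (A_symmetric : forall y y', frob (A y) y' = frob y (A y'))
  (A_idempotent : forall y, A (A y) = A y)
  (f_ge0 : forall x y, closure Omega x -> 0 <= f x y)
  (f_borel : measurable_fun (closure Omega `*` [set: 'M[R]_(m, n.+1)])
               (fun xy => f xy.1 xy.2))
  (f_convex : forall x, closure Omega x -> convex_function setT (f x))
  (c0_gt0 : 0 < c0)
  (C0_gt0 : 0 < C0)
  (f_growth : forall x y, closure Omega x ->
     c0 * fnorm (A y) <= f x y <= C0 * (1 + fnorm (A y)))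
  (u r : 'rV[R]_n.+1 -> 'rV[R]_m)
  (u_L2 : Lp Omega 2%:E u)
  (r_L2 : Lp Omega 2%:E r) :
  let F := F_dual Omega A f in
  [<-> subdifferential Omega F u r;
       exists2 z, admissible Omega A f z &
         forall w, BVA Omega A w -> Lp Omega 2%:E w ->
         ((\int[leb n.+1]_(x in Omega) frob (w x - u x) (r x))%:E
            <= dual_energy Omega f z w - F u)%E;
       exists2 z, admissible Omega A f z &
         forall w, BVA Omega A w -> Lp Omega 2%:E w ->
         ((\int[leb n.+1]_(x in Omega) frob (w x - u x) (r x))%:E
            = dual_energy Omega f z w - F u)%E;
       BVA Omega A u /\
       exists z,
         [/\ admissible Omega A f z,
             {ae leb n.+1, forall x, Omega x -> r x = - weak_div Omega z x},
             is_normal_trace Omega z (fun=> 0)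
           & F u = dual_energy Omega f z u]].
Proof.
move=> F; have C00 := ltW C0_gt0.
have fg x y : Omega x -> 0 <= f x y <= C0 * (1 + norm1 (A y)).
  move=> xO; have xc := subset_closure xO; rewrite f_ge0 //=.
  have /andP[_ h] := f_growth x y xc; apply: (le_trans h).
  by rewrite ler_wpM2l // lerD2l fnorm_le_norm1.
have fc x : Omega x -> forall t y y', 0 <= t <= 1 ->
    f x (t *: y + (1 - t) *: y') <= t * f x y + (1 - t) * f x y'.
  move=> xO t y y' /andP[t0 t1].
  exact: (f_convex x (subset_closure xO) (Itv01 t0 t1) y y' (in_setT _) (in_setT _)).
have sh p : bd Omega p -> shiftable Omega p by move=> bp; exact: chart_shift.
have ids z := @field_identities _ _ _ _ Omega_open Omega_bounded A A_symmetric f C0 C00 f_borel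
  fg fc u r z u_L2 r_L2.
tfae.
- exact: (@minimizer_to_field _ _ _ _ Omega_open Omega_bounded sh A A_symmetric A_idempotent f C0 C00
    f_borel fg fc u r u_L2 r_L2).
- move=> [z az H]; have [bu Fu massE] := ids z az H; exists z => // w bw w2.
  have [Xz _] := az; rewrite /F Fu !(dual_energyE Omega_open _ az) -EFinB; congr EFin.
  rewrite -/(inner Omega _ _) inner_sub // !massE //.
  by set p := inner _ w r; set q := inner _ u r; ring.
- move=> [z az H].
  have [bu Fu massE] := ids z az (fun w bw w2 => eq_ind _ (fun t => (_ <= t)%E) (lexx _) _ (H w bw w2)).
  have [Xz _] := az; split=> //; exists z; split=> //; last exact: normal_trace_zero massE.
  have ae := weak_div_opp Omega_open Omega_bounded Xz r_L2
    (tests_of_mass Omega_open Omega_bounded A_symmetric Xz massE).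
  apply: filterS ae => x h xO; apply/rowP => i.
  by have := h i; rewrite !comp1_in // !mxE => ->; rewrite opprK.
- move=> [bu [z [az ae nt Fu]]].
  exact: (field_to_minimizer Omega_open Omega_bounded sh A_symmetric u_L2 r_L2 bu az ae nt Fu).
Qed.
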